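(* Let $n\ge 2$. Up to a constant multiple there is exactly one nonzero linear CR invariant differential operator $\mathcal{E}\to\mathcal{E}(-n)$, i.e. a linear differential operator $\mathcal{E}\to\mathcal{E}(-n)$ commuting with the action of $G=SU(1,n)$.
   Context: Let $n\ge2$, $m=2n-1$. On $\mathbb{C}^{n+1}$ with coordinates $\zeta=(\zeta_0,\dots,\zeta_n)$ put $L(\zeta)=|\zeta_0|^2-|\zeta_1|^2-\cdots-|\zeta_n|^2$, and let $G=SU(1,n)$ be the group of complex linear maps of determinant one preserving $L$. Let $\mathcal{N}=\{\zeta\in\mathbb{C}^{n+1}\setminus\{0\}: L(\zeta)=0\}$, a $\mathbb{C}^*$-bundle over the sphere $S^m=\partial\{z\in\mathbb{C}^n:|z|<1\}$ via $\zeta\mapsto z=(\zeta_1/\zeta_0,\dots,\zeta_n/\zeta_0)$. For $p\in\mathbb{Z}$, $\mathcal{E}(p)=\{f\in C^\infty(\mathcal{N},\mathbb{R}): f(\lambda\zeta)=|\lambda|^{2p}f(\zeta)\ \forall\lambda\in\mathbb{C}^*\}$, with $G$ acting by $(g\cdot f)(\zeta)=f(g^{-1}\zeta)$; $\mathcal{E}=\mathcal{E}(0)$ is identified with $C^\infty(S^m,\mathbb{R})$ via $f\mapsto f(1,z)$ (and $\mathcal{E}(-n)$ with volume forms on $S^m$). A ''CR invariant'' operator means a $G$-equivariant one. *)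

(* Defs.v *)
From HB Require Import structures.
From mathcomp Require Import all_boot all_order all_algebra.
From mathcomp Require Import all_classical all_reals all_analysis.
From mathcomp Require Import complex.
Set Implicit Arguments. Unset Strict Implicit. Unset Printing Implicit Defensive.
Import Order.TTheory GRing.Theory Num.Theory.
Import numFieldNormedType.Exports.
Local Open Scope ring_scope.

Section CRDefs.
Variable R : realType.
Variable n : nat.

Definition pt := 'rV[R[i]]_(n.+1).
Definition rdim := (n.+1 + n.+1)%N.
Definition rpt := 'rV[R]_rdim.
Definition realify (z : pt) : rpt := row_mx (map_mx (@complex.Re R) z) (map_mx (@complex.Im R) z).

Definition normsq (l : R[i]) : R := complex.Re l ^+ 2 + complex.Im l ^+ 2.

Definition Lform (z : pt) : R :=
  normsq (z 0 ord0) - \sum_(i < n.+1 | i != ord0) normsq (z 0 i).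

Definition nullcone (z : pt) : Prop := z != 0 /\ Lform z = 0.

(* linear action of a matrix on C^{n+1} (zeta viewed as a column vector) *)
Definition act (g : 'M[R[i]]_(n.+1)) (z : pt) : pt := z *m g^T.

Definition inSU1n (g : 'M[R[i]]_(n.+1)) : Prop :=
  \det g = 1 /\ forall z : pt, Lform (act g z) = Lform z.

Definition pdir (j : 'I_rdim) : rpt := delta_mx 0 j.
Fixpoint iterD (s : seq 'I_rdim) (F : rpt -> R) : rpt -> R :=
  match s with
  | [::] => F
  | j :: s' => fun x => 'D_(pdir j) (iterD s' F) x
  end.
Definition smooth0 (F : rpt -> R) : Prop :=
  forall (s : seq 'I_rdim) (x : rpt), x != 0 ->
    {for x, continuous (iterD s F)} /\
    forall j, derivable (iterD s F) x (pdir j).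

(* f : N -> R is smooth: it is the restriction of a smooth function on a
   neighbourhood (here R^{2n+2} \ {0}) of the closed submanifold N *)
Definition smoothN (f : pt -> R) : Prop :=
  exists F, smooth0 F /\ forall z, nullcone z -> f z = F (realify z).

Definition Ep (p : int) (f : pt -> R) : Prop :=
  smoothN f /\
  forall z (l : R[i]), nullcone z -> l != 0 -> f (l *: z) = normsq l ^ p * f z.

(* Only values on N matter; an operator is a map on functions N -> R. *)
Definition operator := (pt -> R) -> (pt -> R).

Definition diffop_on_E0 (D : operator) : Prop :=
  exists (S : seq (seq 'I_rdim)) (a : seq 'I_rdim -> rpt -> R),
    (forall s, smooth0 (a s)) /\
    forall f, Ep 0 f -> forall F, smooth0 F ->
      (forall z, nullcone z -> f z = F (realify z)) ->
      forall z, nullcone z ->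
        D f z = \sum_(s <- S) a s (realify z) * iterD s F (realify z).

Definition linear_on_E0 (D : operator) : Prop :=
  forall (c d : R) f h, Ep 0 f -> Ep 0 h ->
    forall z, nullcone z -> D (fun w => c * f w + d * h w) z = c * D f z + d * D h z.

Definition maps_E0_Emn (D : operator) : Prop :=
  forall f, Ep 0 f -> Ep (- (n%:Z)) (D f).

Definition equivariant (D : operator) : Prop :=
  forall g, inSU1n g -> forall f, Ep 0 f -> forall z, nullcone z ->
    D (fun w => f (act (invmx g) w)) z = D f (act (invmx g) z).

Definition CR_invariant_op (D : operator) : Prop :=
  [/\ diffop_on_E0 D, linear_on_E0 D, maps_E0_Emn D & equivariant D].

Definition nonzero_op (D : operator) : Prop :=
  exists f z, Ep 0 f /\ nullcone z /\ D f z != 0.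

End CRDefs.

(* Main.v *)
Require Import Defs.
From HB Require Import structures.
From mathcomp Require Import all_boot all_order all_algebra.
From mathcomp Require Import all_classical all_reals all_analysis.
From mathcomp Require Import complex.
From mathcomp Require Import ring lra zify.
Set Implicit Arguments. Unset Strict Implicit. Unset Printing Implicit Defensive.
Import Order.TTheory GRing.Theory Num.Theory.
Import numFieldNormedType.Exports.
Local Open Scope ring_scope.
(** Write N for the null cone in V = R^(2n+2) and E, Lap for the Euler operator and the
    ultrahyperbolic Laplacian of V. Existence: Thomas' operators
    D_i = d_i (2E + 2n - 2) - x_i Lap commute and preserve the ideal of functions vanishing
    on N, because x_k D_i is there a combination of E and of the fields x_k d_j - x_j d_k
    tangent to N. If F is homogeneous of degree 0 on N, then D_i^n F = x_i^n P F on N with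
    P F independent of i; P is the operator, and its naturality gives invariance.

    Uniqueness: SU(1,n) is transitive on N up to similitudes, so an invariant operator is
    determined by a functional on jets at z0 = (1,1,0,...,0) that kills functions vanishing
    on N and is invariant under the stabilizer. In the coordinates u = (z_0+z_1)/2,
    v = z_0-z_1, w_j, and modulo jets, degree 0 functions are polynomials in X_j = w_j/u,
    V = v/u and their conjugates, with V + Vb = sum X_j Xb_j on N. The infinitesimal dilation
    confines the functional to weight 2n, and the nilpotent fields w_j -> v, ub -> wb_j
    (with their conjugates) reduce its value on every monomial to the one on V Vb^(n-1). *)

(** * Smooth functions on the punctured space *)

(** [P] is well defined because of the identity x_k D_i - x_i D_k = 2 (x_k d_i - x_i d_k)(E + n -
    1), from which the Laplacian has disappeared. Each D_i lowers the degree by one, so a function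
    of degree 0 reaches after n - 1 steps the degree 1 - n, where the right side vanishes on N. The
    n-th operator, and by commutativity every other one, can then be exchanged for D_k at the price
    of x_i / x_k; this fixes the order n. Two obstacles shape the rest. Functions on N are known
    only through extensions, so identities become congruences modulo functions vanishing on N. And u
    has zeros on N, so 1/u is replaced by globally smooth functions that agree with it at z0 to an
    order beyond that of the operators. That P is not zero is seen on H = Re(z_1 conj z_2): modulo
    high jets at a null point, the Thomas operator in the direction d/dz_0 maps H z_0^-k zb_0^-1 to
    2k(k - n - 1) H z_0^(-k-1) zb_0^-1, and no factor with 1 <= k <= n vanishes. *)

Section Schwarz.
Variables (R : realType) (V : normedModType R).
Implicit Types (F : V -> R) (x y v w : V).

Lemma is_derive_line F y v (t : R) : derivable F (y + t *: v) v ->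
  is_derive t 1 (fun s : R => F (y + s *: v)) ('D_v F (y + t *: v)).
Proof.
move=> dF.
have E : (fun h : R => h^-1 *: ((fun s : R => F (y + s *: v)) (h *: (1 : R) + t)
           - F (y + t *: v))) =
         (fun h : R => h^-1 *: (F (h *: v + (y + t *: v)) - F (y + t *: v))).
  apply/funext => h; congr (_ *: (F _ - _)).
  by rewrite scalerDl addrCA [h *: 1]mulr1.
by apply: DeriveDef; rewrite /derivable/derive /= ?E.
Qed.

(** The mean value theorem is applied along [v] to the increment of [F] in the direction [w], then
    along [w] to ['D_v F]. The left side is symmetric in [v] and [w], the right side is not;
    [schwarz] lives on this difference. *)
Lemma second_difference F x v w (s : R) : 0 < s ->
  (forall a b, 0 <= a <= s -> 0 <= b <= s -> derivable F (x + a *: v + b *: w) v) ->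
  (forall a b, 0 <= a <= s -> 0 <= b <= s ->
     derivable ('D_v F) (x + a *: v + b *: w) w) ->
  exists a b, [/\ 0 <= a <= s, 0 <= b <= s &
    F (x + s *: v + s *: w) - F (x + s *: v) - (F (x + s *: w) - F x) =
      'D_w ('D_v F) (x + a *: v + b *: w) * s * s].
Proof.
move=> s0 dF ddF.
have ss : 0 <= s <= s by rewrite lexx ltW.
have s00 : 0 <= (0 : R) <= s by rewrite lexx ltW.
have inI (t : R) : t \in `]0, s[ -> 0 <= t <= s.
  by rewrite in_itv /= => /andP[? ?]; rewrite !ltW.
have inC (t : R) : t \in `[0, s] -> 0 <= t <= s by rewrite in_itv.
pose g := (fun a : R => F (x + s *: w + a *: v)) - (fun a : R => F (x + a *: v)).
pose dg a := 'D_v F (x + s *: w + a *: v) - 'D_v F (x + a *: v).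
have Dg a : 0 <= a <= s -> is_derive a 1 g (dg a).
  move=> a0; apply: is_deriveB; apply: is_derive_line.
    by rewrite addrAC; apply: dF.
  by have := dF a 0 a0 s00; rewrite scale0r addr0.
have [| |a /inI a0] := @MVT R g dg 0 s s0.
- by move=> t /inI /Dg.
- by apply: derivable_within_continuous => t /inC /Dg D; apply: ex_derive.
rewrite subr0.
pose k (b : R) := 'D_v F (x + a *: v + b *: w).
have Dk b : 0 <= b <= s -> is_derive b 1 k ('D_w ('D_v F) (x + a *: v + b *: w)).
  by move=> b0; apply: (@is_derive_line ('D_v F)); apply: ddF.
have [|b /inI b0] := @MVT R k _ 0 s s0 (fun t tI => Dk t (inI t tI)).
- by apply: derivable_within_continuous => t /inC /Dk D; apply: ex_derive.
rewrite subr0 => Ek Eg; exists a, b; split => //.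
rewrite -Ek /k scale0r addr0 (addrAC x (a *: v)) -/(dg a) -Eg /g.
rewrite -![((_ - _) _)]/(_ - _) !scale0r !addr0 (addrAC x (s *: w)).
by ring.
Qed.

Lemma schwarz F x v w :
  (\forall y \near x, [/\ derivable F y v, derivable F y w,
      derivable ('D_v F) y w & derivable ('D_w F) y v]) ->
  {for x, continuous ('D_w ('D_v F))} -> {for x, continuous ('D_v ('D_w F))} ->
  'D_w ('D_v F) x = 'D_v ('D_w F) x.
Proof.
move=> dF c1 c2; apply/eqP; rewrite -subr_eq0 -normr_le0.
apply/ler_addgt0Pr => e e0; rewrite add0r.
have e20 : 0 < e / 2 by rewrite divr_gt0.
have /cvgrPdist_le/(_ _ e20) H1 := c1.
have /cvgrPdist_le/(_ _ e20) H2 := c2.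
have : \forall y \near x, [/\ derivable F y v, derivable F y w,
      derivable ('D_v F) y w & derivable ('D_w F) y v] /\
   (`|'D_w ('D_v F) x - 'D_w ('D_v F) y| <= e / 2 /\
   `|'D_v ('D_w F) x - 'D_v ('D_w F) y| <= e / 2).
  exact: filterI dF (filterI H1 H2).
move=> /nbhs_normP[r /= r0 Hr].
pose s := r / (2 * (`|v| + `|w| + 1)).
have q0 : 0 < `|v| + `|w| + 1 by rewrite ltr_wpDl // addr_ge0.
have s0 : 0 < s by rewrite divr_gt0 // mulr_gt0.
have inb a b : 0 <= a <= s -> 0 <= b <= s -> ball_ Num.norm x r (x + a *: v + b *: w).
  move=> /andP[a0 as_] /andP[b0 bs]; rewrite /ball_ /= -addrA opprD addNKr normrN.
  apply: le_lt_trans (ler_normD _ _) _; rewrite !normrZ !ger0_norm //.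
  apply: (@le_lt_trans _ _ (s * (`|v| + `|w| + 1))).
    rewrite !mulrDr mulr1; apply: ler_wpDr; first exact: ltW.
    by apply: lerD; apply: ler_wpM2r.
  have -> : s * (`|v| + `|w| + 1) = r / 2.
    by rewrite /s invfM -!mulrA mulVf ?mulr1 // gt_eqF.
  by rewrite ltr_pdivrMr // ltr_pMr // ltr1n.
have [a [b [ha hb E1]]] : exists a b, [/\ 0 <= a <= s, 0 <= b <= s &
    F (x + s *: v + s *: w) - F (x + s *: v) - (F (x + s *: w) - F x) =
      'D_w ('D_v F) (x + a *: v + b *: w) * s * s].
  apply: (second_difference s0) => a b a0 b0;
    have [[d1 d2 d3 d4] _] := Hr _ (inb a b a0 b0); [exact: d1 | exact: d3].
have [a' [b' [ha' hb' E2]]] : exists a b, [/\ 0 <= a <= s, 0 <= b <= s &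
    F (x + s *: w + s *: v) - F (x + s *: w) - (F (x + s *: v) - F x) =
      'D_v ('D_w F) (x + a *: w + b *: v) * s * s].
  apply: (second_difference s0) => a' b' a0 b0; rewrite addrAC;
    have [[d1 d2 d3 d4] _] := Hr _ (inb b' a' b0 a0); [exact: d2 | exact: d4].
have [_ [B1 _]] := Hr _ (inb a b ha hb).
have [_ [_ B2]] := Hr _ (inb b' a' hb' ha').
(* Both orders of differentiation compute the same second difference, so the two mixed derivatives
   coincide at two points close to [x]; continuity transfers this to [x]. *)
have E : 'D_w ('D_v F) (x + a *: v + b *: w) = 'D_v ('D_w F) (x + b' *: v + a' *: w).
  have sn0 : s != 0 by rewrite gt_eqF.
  apply: (mulIf sn0); apply: (mulIf sn0).
  rewrite (addrAC x (b' *: v) (a' *: w)).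
  apply: etrans (esym E1) _; apply: etrans _ E2.
  rewrite (addrAC x (s *: w) (s *: v)).
  move: (F _) (F _) (F _) (F _) => p1 p2 p3 p4; ring.
move: B1 B2; rewrite E.
move: ('D_v ('D_w F) (_ + _ + _)) ('D_w ('D_v F) x) ('D_v ('D_w F) x) => z p q B1 B2.
have -> : p - q = (p - z) + - (q - z) by ring.
by apply: le_trans (ler_normD _ _) _; rewrite normrN [leRHS]splitr lerD.
Qed.
End Schwarz.

(** * Total differentiability and the chain rule from continuous partial derivatives *)

Section Calculus.
Variables (R : realType) (d : nat).
Local Notation V := 'rV[R]_d.
Implicit Types (F : V -> R) (x y v : V).

Lemma mvt_line F y v (h c e : R) :
  (forall t, `|t| <= `|h| -> derivable F (y + t *: v) v) ->
  (forall t, `|t| <= `|h| -> `|'D_v F (y + t *: v) - c| <= e) ->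
  `|F (y + h *: v) - F y - h * c| <= `|h| * e.
Proof.
move=> dF bF.
have main a b : a < b -> (forall t, a <= t <= b -> `|t| <= `|h|) ->
    `|F (y + b *: v) - F (y + a *: v) - (b - a) * c| <= (b - a) * e.
  move=> ab hab.
  have [| |t tab ->] := @MVT R (fun s => F (y + s *: v))
      (fun t => 'D_v F (y + t *: v)) a b ab.
  - move=> t; rewrite in_itv /= => /andP[at_ tb]; apply: is_derive_line.
    by apply: dF; apply: hab; rewrite !ltW.
  - apply: derivable_within_continuous => t; rewrite in_itv /= => tab.
    by apply: (@ex_derive _ _ _ _ _ _ _ (is_derive_line _)); apply/dF/hab.
  - rewrite [_ * (b - a)]mulrC -mulrBr normrM (ger0_norm (ltW _)) ?subr_gt0 //.
    apply: ler_wpM2l; first by rewrite subr_ge0 ltW.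
    by apply/bF/hab; move: tab; rewrite in_itv /= => /andP[? ?]; rewrite !ltW.
have [h0|h0|->] := ltgtP h 0.
- have := main h 0 h0; rewrite scale0r addr0 => /(_ _)/wrap[].
    by move=> t /andP[ht t0]; rewrite ler0_norm // ltr0_norm // lerN2.
  have -> : F (y + h *: v) - F y - h * c =
      - (F y - F (y + h *: v) - (0 - h) * c) by ring.
  by rewrite normrN sub0r (ltr0_norm h0).
- have := main 0 h h0; rewrite scale0r addr0 subr0 => /(_ _)/wrap[].
    by move=> t /andP[t0 th]; rewrite ger0_norm // gtr0_norm.
  by rewrite (gtr0_norm h0).
- by rewrite scale0r addr0 subrr !mul0r subr0 normr0 mul0r.
Qed.

Let e_ (j : 'I_d) : V := delta_mx 0 j.

Lemma norm_coord_le (h : V) j : `|h 0 j| <= `|h|.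
Proof.
rewrite [leRHS]/Num.Def.normr/= mx_normrE.
exact: (le_bigmax _ (fun i : 'I_1 * 'I_d => `|h i.1 i.2|) (0, j)).
Qed.

Lemma norm_row_le (h : V) (r : R) : 0 <= r -> (forall j, `|h 0 j| <= r) -> `|h| <= r.
Proof.
move=> r0 H; rewrite [leLHS]/Num.Def.normr/= mx_normrE bigmax_le // => -[i j] _ /=.
by rewrite ord1.
Qed.

Let trunc (h : V) (k : nat) : V := \row_j (if (j < k)%N then h 0 j else 0).

Let truncS (h : V) (k : 'I_d) : trunc h k.+1 = trunc h k + h 0 k *: e_ k.
Proof.
apply/rowP => j; rewrite !mxE /= ltnS leq_eqVlt eq_sym val_eqE eq_sym.
by have [->|_] := eqVneq j k; rewrite ?ltnn /= ?mulr1 ?add0r ?mulr0 ?addr0.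
Qed.

(** The increment from [x] to [x + h] is split into steps along the coordinate axes, each controlled
    by [mvt_line]. It is needed because [smooth0] speaks of partial derivatives only, while the
    chain rule rests on a total differential. *)
Lemma C1_estimate F x (e : R) : 0 < e ->
  (\forall y \near x, forall j, derivable F y (e_ j)) ->
  (forall j, {for x, continuous ('D_(e_ j) F)}) ->
  \forall h \near (0 : V),
    `|F (x + h) - F x - \sum_j h 0 j * 'D_(e_ j) F x| <= d%:R * (`|h| * e).
Proof.
move=> e0 dF cF.
have : \forall y \near x, forall j, derivable F y (e_ j) /\
    `|'D_(e_ j) F y - 'D_(e_ j) F x| <= e.
  have cF' : \forall y \near x, forall j, `|'D_(e_ j) F y - 'D_(e_ j) F x| <= e.
    near=> y; near: y; apply: filter_forall => j; have /cvgrPdist_le/(_ e e0) := cF j.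
    by move=> K; near=> y; rewrite distrC; near: y; exact: K.
  by apply: filterS2 dF cF' => y H1 H2 j; split.
move=> /nbhs_normP[r /= r0 Hr].
apply: filterS (@nbhs0_lt R V r r0) => h hr.
(* The norm is the maximum norm, so the corners of the path from [x] to [x + h] stay in the same
   ball. *)
have Htr k t j : (k <= d)%N -> `|t| <= `|h 0 j| -> (j = k :> nat) ->
    ball_ Num.norm x r (x + trunc h k + t *: e_ j).
  move=> kd th jk; rewrite /ball_ /= -addrA opprD addNKr normrN.
  apply: le_lt_trans hr; apply: norm_row_le => // i; rewrite !mxE /=.
  rewrite -jk; have [->|ij] := eqVneq i j.
    by rewrite ltnn add0r mulr1 (le_trans th) // norm_coord_le.
  by rewrite mulr0 addr0; case: ifP => _; rewrite ?normr0 // norm_coord_le.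
have -> : F (x + h) - F x - \sum_j h 0 j * 'D_(e_ j) F x =
    \sum_(j < d) (F (x + trunc h j.+1) - F (x + trunc h j) - h 0 j * 'D_(e_ j) F x).
  rewrite sumrB; congr (_ - _).
  rewrite -(big_mkord predT (fun j => F (x + trunc h j.+1) - F (x + trunc h j))).
  rewrite telescope_sumr //; congr (F _ - F _).
    by congr (_ + _); apply/rowP => j; rewrite mxE ltn_ord.
  by rewrite -[LHS]addr0; congr (_ + _); apply/rowP => j; rewrite !mxE.
apply: le_trans (ler_norm_sum _ _ _) _.
apply: (@le_trans _ _ (\sum_(j < d) `|h| * e)).
  apply: ler_sum => j _; rewrite truncS addrA.
  apply: (@le_trans _ _ (`|h 0 j| * e)).
    apply: mvt_line => t th.
      by have [] := Hr _ (Htr j t j (ltnW (ltn_ord j)) th erefl) j.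
    by have [] := Hr _ (Htr j t j (ltnW (ltn_ord j)) th erefl) j.
  by apply: ler_wpM2r; [apply: ltW | apply: norm_coord_le].
by rewrite sumr_const card_ord mulr_natl.
Unshelve.
all: by end_near. Qed.

Definition dlin (c : 'I_d -> R) (h : V) : R := \sum_j h 0 j * c j.
Lemma dlin_is_linear c : linear (dlin c).
Proof.
move=> a u w; rewrite /dlin scaler_sumr -big_split /=; apply: eq_bigr => j _.
by rewrite !mxE mulrDl scalerAl.
Qed.
HB.instance Definition _ c := GRing.isLinear.Build R V R _ (dlin c) (dlin_is_linear c).

Lemma C1_differentiable F x :
  (\forall y \near x, forall j, derivable F y (e_ j)) ->
  (forall j, {for x, continuous ('D_(e_ j) F)}) ->
  differentiable F x /\ 'd F x = dlin (fun j => 'D_(e_ j) F x) :> (V -> R).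
Proof.
move=> dF cF; set df := dlin _.
have cdf : continuous df.
  apply: continuous_big => [|j _ y]; first exact: add_continuous.
  have cj : {for y, continuous (fun M : V => M 0 j)} by exact: coord_continuous.
  exact: cvgMr_tmp cj.
have E : F \o shift x = cst (F x) + df +o_ (0 : V) id.
  apply/eqaddoP => e e0; have e0' : 0 < e / d.+1%:R by rewrite divr_gt0.
  near=> h; rewrite /= -[((_ - _) h)]/(F (h + x) - (F x + df h)).
  rewrite [h + x]addrC opprD addrA.
  apply: (@le_trans _ _ (d%:R * (`|h| * (e / d.+1%:R)))).
    by near: h; exact: C1_estimate.
  rewrite mulrCA [X in _ <= X]mulrC; apply: ler_wpM2l => //.
  rewrite mulrCA; apply: ler_piMr; first exact: ltW.
  by rewrite ler_pdivrMr // mul1r ler_nat.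
have D := diff_unique cdf E.
split=> //; apply/diff_locallyP; rewrite D; split => //.
Unshelve. all: by end_near. Qed.

(** Restriction to the line through [x] in the direction [v] reduces the claim to a function of one
    real variable; thus [g] only has to be derivable along [v]. *)
Lemma chain_rule (W : normedModType R) F (g : W -> V) (x v : W) :
  (\forall y \near g x, forall j, derivable F y (e_ j)) ->
  (forall j, {for g x, continuous ('D_(e_ j) F)}) ->
  (forall j, derivable (fun w => g w 0 j) x v) ->
  is_derive x v (F \o g)
    (\sum_j 'D_v (fun w => g w 0 j) x * 'D_(e_ j) F (g x)).
Proof.
move=> dF cF dg; have [DF dFE] := C1_differentiable dF cF.
have dg' : derivable g x v by apply/derivable_mxP => i j; rewrite ord1.
have dline : is_derive (0 : R) 1 (fun s : R => g (s *: v + x)) ('D_v g x).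
  have E : (fun h : R => h^-1 *: (g ((h *: (1 : R) + 0) *: v + x) - g (0 *: v + x))) =
     (fun h : R => h^-1 *: (g (h *: v + x) - g x)).
    by apply/funext => h; rewrite addr0 scale0r add0r [h *: 1]mulr1.
  by apply: DeriveDef; rewrite /derivable/derive /= E.
have Dl : differentiable (fun s : R => g (s *: v + x)) 0.
  by apply/derivable1_diffP; apply: ex_derive.
have g0 : g (0 *: v + x) = g x by rewrite scale0r add0r.
have DF' : differentiable F (g (0 *: v + x)) by rewrite g0.
have DC := differentiable_comp Dl DF'.
have HE : (fun h : R => h^-1 *: (F (g (h *: v + x)) - F (g x))) =
  (fun h : R => h^-1 *: ((F \o (fun s : R => g (s *: v + x))) (h *: (1 : R) + 0)
             - (F \o (fun s : R => g (s *: v + x))) 0)).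
  by apply/funext => h; rewrite /= addr0 scale0r add0r [h *: 1]mulr1.
have DD : derivable (F \o (fun s : R => g (s *: v + x))) (0 : R) 1.
  exact/derivable1_diffP.
apply: DeriveDef; first by rewrite /derivable /= HE; exact: DD.
transitivity ('D_1 (F \o (fun s : R => g (s *: v + x))) (0 : R)).
  by rewrite /derive /= HE.
rewrite deriveE // diff_comp //= g0 dFE -deriveE //.
rewrite (@derive_val _ _ _ _ _ _ _ dline) derive_mx // /dlin.
by apply: eq_bigr => j _; rewrite mxE.
Qed.

End Calculus.

(** * Closure properties of smooth functions *)

Section SmoothFunctions.
Variables (R : realType) (n : nat).
Local Notation V := 'rV[R]_(rdim n).
Local Notation I := 'I_(rdim n).
Local Notation e_ := (@pdir R n).
Implicit Types (F G : V -> R) (x : V) (j k : I).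

Lemma near_nonzero x : x != 0 -> \forall y \near x, y != 0.
Proof.
move=> x0; apply/nbhs_normP; exists `|x|; first by rewrite /= normr_gt0.
by move=> y; rewrite /ball_ /=; apply: contraTneq => ->; rewrite subr0 ltxx.
Qed.

(** Proving each closure property of [smooth0] directly would take an induction on words of
    derivatives with the Leibniz and chain rules inside. This class is stable under partial
    derivatives, so continuity and derivability of its members are enough. [elem_ext] belongs to it
    because derivatives are computed away from the origin only. *)
Inductive elementary : (V -> R) -> Prop :=
| elem_smooth F : smooth0 F -> elementary F
| elem_cst c : elementary (cst c)
| elem_coord k : elementary (fun x => x 0 k)
| elem_add F G : elementary F -> elementary G -> elementary (fun x => F x + G x)
| elem_mul F G : elementary F -> elementary G -> elementary (fun x => F x * G x)
| elem_inv F : elementary F -> (forall x, x != 0 -> F x != 0) ->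
    elementary (fun x => (F x)^-1)
| elem_comp F (g : I -> V -> R) : smooth0 F -> (forall k, elementary (g k)) ->
    (forall x, x != 0 -> \row_k g k x != 0) ->
    elementary (fun x => F (\row_k g k x))
| elem_ext F G : elementary F -> (forall x, x != 0 -> F x = G x) -> elementary G.

Lemma elem_sum (J : Type) (r : seq J) (f : J -> V -> R) :
  (forall i, elementary (f i)) -> elementary (fun x => \sum_(i <- r) f i x).
Proof.
move=> Hf; elim: r => [|i r IH].
  by apply: elem_ext (elem_cst 0) _ => x _; rewrite big_nil.
by apply: elem_ext (elem_add (Hf i) IH) _ => x _; rewrite big_cons.
Qed.

Lemma iterD_rcons s j F : Defs.iterD (rcons s j) F = Defs.iterD s ('D_(e_ j) F).
Proof. by elim: s => //= k s ->. Qed.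

Lemma smooth0_D F j : smooth0 F -> smooth0 ('D_(e_ j) F).
Proof. by move=> HF s x x0; rewrite -iterD_rcons; apply: HF. Qed.

Lemma smooth0_cont F x : smooth0 F -> x != 0 -> {for x, continuous F}.
Proof. by move=> HF x0; have [] := HF [::] x x0. Qed.

Lemma smooth0_der F x j : smooth0 F -> x != 0 -> derivable F x (e_ j).
Proof. by move=> HF x0; have [_] := HF [::] x x0. Qed.

Lemma smooth0_C1 F x : smooth0 F -> x != 0 ->
  (\forall y \near x, forall j, derivable F y (delta_mx 0 j)) /\
  (forall j, {for x, continuous ('D_(delta_mx 0 j) F)}).
Proof.
move=> HF x0; split=> [|j].
  near=> y => j; have y0 : y != 0 by near: y; exact: near_nonzero.
  exact: smooth0_der HF y0.
exact: smooth0_cont (smooth0_D j HF) x0.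
Unshelve. all: by end_near. Qed.

Lemma smooth0_chain F (W : normedModType R) (g : W -> V) (x v : W) :
  smooth0 F -> g x != 0 -> (forall k, derivable (fun w => g w 0 k) x v) ->
  is_derive x v (F \o g) (\sum_k 'D_v (fun w => g w 0 k) x * 'D_(e_ k) F (g x)).
Proof.
by move=> HF gx0 dg; have [h1 h2] := smooth0_C1 HF gx0; exact: chain_rule h1 h2 dg.
Qed.

Lemma cont_row (g : I -> V -> R) x :
  (forall k, {for x, continuous (g k)}) ->
  {for x, continuous (fun y => \row_k g k y : V)}.
Proof.
move=> cg; rewrite /continuous_at.
have FF : Filter (nbhs x) by exact: nbhs_filter.
apply/(@cvgrPdist_le R V _ _ FF) => e e0.
near=> y; apply: norm_row_le; first exact: ltW.
move=> j; rewrite !mxE; move: j; near: y; apply: filter_forall => j.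
by have /cvgrPdist_le/(_ e e0) := cg j.
Unshelve. all: by end_near. Qed.

Lemma elementaryP F : elementary F ->
  (forall x, x != 0 -> {for x, continuous F} /\ forall j, derivable F x (e_ j)) /\
  (forall j, elementary ('D_(e_ j) F)).
Proof.
elim=> {F}.
- move=> F HF; split=> [x x0|j]; last by apply/elem_smooth/smooth0_D.
  by split=> [|j]; [apply: smooth0_cont | apply: smooth0_der].
- move=> c; split=> [x x0|j]; first by split=> [|j]; [exact: cst_continuous | exact: derivable_cst].
  by apply: elem_ext (elem_cst 0) _ => x _; rewrite derive_cst.
- move=> k.
  have D x j : is_derive x (e_ j) (fun y : V => y 0 k) ((j == k)%:R : R).
    have dk : derivable (fun y : V => y) x (e_ j) by [].
    have := (@derivable_mxP _ _ _ _ _ _ _).1 dk 0 k => D; apply: DeriveDef => //.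
    have := derive_mx dk; rewrite derive_id => /rowP/(_ k).
    by rewrite !mxE /= eq_sym => <-.
  split=> [x x0|j].
    by split=> [|j]; [exact: coord_continuous | apply: ex_derive].
  apply: elem_ext (elem_cst ((j == k)%:R)) _ => x _.
  by rewrite (@derive_val _ _ _ _ _ _ _ (D x j)).
- move=> F G _ [cF dF] _ [cG dG]; split=> [x x0|j].
    have [cF1 cF2] := cF x x0; have [cG1 cG2] := cG x x0.
    by split=> [|j]; [apply: continuousD | apply: derivableD].
  apply: elem_ext (elem_add (dF j) (dG j)) _ => x x0; rewrite -deriveD //.
    by have [_] := cF x x0.
  by have [_] := cG x x0.
- move=> F G eF [cF dF] eG [cG dG]; split=> [x x0|j].
    have [cF1 cF2] := cF x x0; have [cG1 cG2] := cG x x0.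
    by split=> [|j]; [apply: continuousM | apply: derivableM].
  apply: elem_ext (elem_add (elem_mul eF (dG j)) (elem_mul eG (dF j))) _ => x x0.
  rewrite -deriveM //.
    by have [_] := cF x x0.
  by have [_] := cG x x0.
- move=> F eF [cF dF] F0; split=> [x x0|j].
    have [cF1 cF2] := cF x x0.
    by split=> [|j]; [apply: continuousV => //; apply: F0 | apply: derivableV => //; apply: F0].
  have eFV := elem_inv eF F0.
  apply: elem_ext (elem_mul (elem_cst (-1)) (elem_mul (elem_mul eFV eFV) (dF j))) _.
  move=> x x0; rewrite deriveV; [|exact: F0|by have [_] := cF x x0].
  by rewrite -[RHS]/(- _ * _) /= mulN1r mulNr -exprVn expr2.
- move=> F g HF eg IH g0.
  have Dg x j : x != 0 -> is_derive x (e_ j) (fun x => F (\row_k g k x))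
      (\sum_k 'D_(e_ j) (g k) x * 'D_(e_ k) F (\row_k g k x)).
    move=> x0; have E k : (fun w : V => (\row_k g k w : V) 0 k) = g k.
      by apply/funext => w; rewrite mxE.
    have H k : derivable (fun w : V => (\row_k g k w : V) 0 k) x (e_ j).
      by rewrite E; have [/(_ x x0)[]] := IH k.
    have := smooth0_chain HF (g0 x x0) H.
    by under eq_bigr do rewrite E.
  split=> [x x0|j].
    split=> [|j]; last by have := Dg x j x0 => D; apply: ex_derive.
    apply: (@continuous_comp _ _ _ (fun x => \row_k g k x) F).
      by apply: cont_row => k; have [/(_ x x0)[]] := IH k.
    by apply: smooth0_cont => //; apply: g0.
  pose h k (y : V) := 'D_(e_ j) (g k) y * 'D_(e_ k) F (\row_i g i y).
  have eh k : elementary (h k).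
    apply: elem_mul; first by have [_] := IH k.
    exact: elem_comp (smooth0_D k HF) eg g0.
  apply: elem_ext (elem_sum (index_enum I) eh) _.
  by move=> x x0; have D := Dg x j x0; rewrite derive_val.
- move=> F G eF [cF dF] FG.
  have nFG x : x != 0 -> \forall y \near x, F y = G y.
    by move=> x0; apply: filterS (near_nonzero x0).
  split=> [x x0|j].
    have [cF1 cF2] := cF x x0; split=> [|j].
      have := nFG x x0 => E; rewrite /prop_for /continuous_at -(FG x x0).
      have FF : Filter (nbhs x) by exact: nbhs_filter.
      exact: cvg_trans (@near_eq_cvg _ _ _ FF _ _ E) cF1.
    by apply: near_eq_derivable (nFG x x0) _.
  by apply: elem_ext (dF j) _ => x x0; apply/near_eq_derive/nFG.
Qed.

Lemma elementary_smooth0 F : elementary F -> smooth0 F.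
Proof.
move=> eF s; have : elementary (Defs.iterD s F) by elim: s => //= j s /elementaryP[_].
by move=> /elementaryP[H _] x /H.
Qed.
End SmoothFunctions.

(** * The ring of smooth complex functions and its commuting derivations *)

Section SmoothRing.
Variables (R : realType) (n : nat).
Local Notation V := 'rV[R]_(rdim n).
Local Notation I := 'I_(rdim n).
Local Notation C := R[i].
Local Notation Re := (@complex.Re R).
Local Notation Im := (@complex.Im R).
Local Notation e_ := (@pdir R n).

Lemma smooth0_ext (F G : V -> R) :
  smooth0 F -> (forall x, x != 0 -> F x = G x) -> smooth0 G.
Proof. by move=> sF FG; exact: elementary_smooth0 (elem_ext (elem_smooth sF) FG). Qed.

Lemma derive_ext (F G : V -> R) : (forall x, x != 0 -> F x = G x) ->
  forall v x, x != 0 -> 'D_v F x = 'D_v G x.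
Proof.
move=> FG v x x0; apply: near_eq_derive.
near=> y; have y0 : y != 0 by near: y; exact: near_nonzero.
exact: FG y0.
Unshelve. all: by end_near. Qed.

Lemma iterD_ext (F G : V -> R) s : (forall x, x != 0 -> F x = G x) ->
  forall x, x != 0 -> Defs.iterD s F x = Defs.iterD s G x.
Proof. by move=> FG; elim: s => //= j s IH x x0; apply: derive_ext. Qed.

Lemma smooth0D (F G : V -> R) : smooth0 F -> smooth0 G -> smooth0 (fun x => F x + G x).
Proof. by move=> hF hG; apply/elementary_smooth0/elem_add; apply: elem_smooth. Qed.

Lemma smooth0M (F G : V -> R) : smooth0 F -> smooth0 G -> smooth0 (fun x => F x * G x).
Proof. by move=> hF hG; apply/elementary_smooth0/elem_mul; apply: elem_smooth. Qed.

Lemma smooth0_cst (c : R) : smooth0 (fun _ : V => c).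
Proof. exact/elementary_smooth0/elem_cst. Qed.

Lemma smooth0N (F : V -> R) : smooth0 F -> smooth0 (fun x => - F x).
Proof.
move=> hF; apply: smooth0_ext (smooth0M (smooth0_cst (-1)) hF) _ => x _.
by rewrite mulN1r.
Qed.

Lemma smooth0V (F : V -> R) : smooth0 F -> (forall x, x != 0 -> F x != 0) ->
  smooth0 (fun x => (F x)^-1).
Proof. by move=> hF H; apply/elementary_smooth0/elem_inv => //; apply: elem_smooth. Qed.

Lemma smooth0_coord (k : I) : smooth0 (fun x : V => x 0 k).
Proof. exact/elementary_smooth0/elem_coord. Qed.

Lemma smooth0_comp (F : V -> R) (g : I -> V -> R) : smooth0 F ->
  (forall k, smooth0 (g k)) -> (forall x, x != 0 -> \row_k g k x != 0) ->
  smooth0 (fun x => F (\row_k g k x)).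
Proof.
move=> hF hg g0; apply/elementary_smooth0/elem_comp => // k.
exact: elem_smooth (hg k).
Qed.

Lemma derive_comp_coord (F : V -> R) (g : I -> V -> R) x j : smooth0 F ->
  (forall k, smooth0 (g k)) -> \row_k g k x != 0 -> x != 0 ->
  'D_(e_ j) (fun x => F (\row_k g k x)) x =
    \sum_k 'D_(e_ j) (g k) x * 'D_(e_ k) F (\row_k g k x).
Proof.
move=> hF hg g0 x0; have E k : (fun w : V => (\row_k g k w : V) 0 k) = g k.
  by apply/funext => w; rewrite mxE.
have H k : derivable (fun w : V => (\row_k g k w : V) 0 k) x (e_ j).
  by rewrite E; exact: smooth0_der (hg k) x0.
have D := smooth0_chain hF g0 H; rewrite (@derive_val _ _ _ _ _ _ _ D).
by under eq_bigr do rewrite E.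
Qed.

Lemma smooth0_schwarz (F : V -> R) x j k : smooth0 F -> x != 0 ->
  'D_(e_ j) ('D_(e_ k) F) x = 'D_(e_ k) ('D_(e_ j) F) x.
Proof.
move=> hF x0; apply: schwarz.
- near=> y; have y0 : y != 0 by near: y; exact: near_nonzero.
  have hj := smooth0_D j hF; have hk := smooth0_D k hF.
  split; [exact: smooth0_der hF y0 | exact: smooth0_der hF y0 | |].
    exact: smooth0_der hk y0.
  exact: smooth0_der hj y0.
- exact: smooth0_cont (smooth0_D j (smooth0_D k hF)) x0.
- exact: smooth0_cont (smooth0_D k (smooth0_D j hF)) x0.
Unshelve. all: by end_near. Qed.

Lemma derive_coord (x : V) j k : 'D_(e_ j) (fun y : V => y 0 k) x = (j == k)%:R.
Proof.
have dk : derivable (fun y : V => y) x (e_ j) by [].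
have := derive_mx dk; rewrite derive_id => /rowP/(_ k).
by rewrite !mxE /= eq_sym => <-.
Qed.

Definition csmooth (F : V -> C) :=
  smooth0 (fun x => Re (F x)) /\ smooth0 (fun x => Im (F x)).

(* Smooth complex functions on the punctured space; the junk value at the origin is
   normalized to 0, so that equality of functions is equality away from the origin. *)
Record cinf := SFun {
  sfun_val :> V -> C; sfun_csmooth : csmooth sfun_val; sfun_at0 : sfun_val 0 = 0 }.

HB.instance Definition _ := gen_eqMixin cinf.
HB.instance Definition _ := gen_choiceMixin cinf.

Implicit Types (F G : cinf) (x : V) (j k : I).

Lemma sfunP F G : (forall x, x != 0 -> F x = G x) -> F = G.
Proof.
case: F G => [F sF F0] [G sG G0] /= FG.
have E : F = G.
  by apply/funext => x; have [->|/FG//] := eqVneq x 0; rewrite F0 G0.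
by case: _ / E in sG G0 FG *; congr SFun; exact: Prop_irrelevance.
Qed.

Lemma csmooth_ext (F G : V -> C) : csmooth F -> (forall x, x != 0 -> F x = G x) -> csmooth G.
Proof. by move=> [h1 h2] FG; split; [apply: smooth0_ext h1 _|apply: smooth0_ext h2 _] => x /FG ->. Qed.

Section Mk.
Variables (F : V -> C) (sF : csmooth F).
Let mkf x := if x == 0 then 0 else F x.
Fact mk_smooth : csmooth mkf.
Proof. by apply: csmooth_ext sF _ => x x0; rewrite /mkf (negbTE x0). Qed.
Fact mk_at0 : mkf 0 = 0. Proof. by rewrite /mkf eqxx. Qed.
Definition mkS := SFun mk_smooth mk_at0.
Lemma mkSE x : x != 0 -> mkS x = F x.
Proof. by move=> x0; rewrite /= /mkf (negbTE x0). Qed.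
End Mk.

Lemma cReD (a b : C) : Re (a + b) = Re a + Re b. Proof. by case: a b => [? ?] []. Qed.
Lemma cImD (a b : C) : Im (a + b) = Im a + Im b. Proof. by case: a b => [? ?] []. Qed.
Lemma cReN (a : C) : Re (- a) = - Re a. Proof. by case: a. Qed.
Lemma cImN (a : C) : Im (- a) = - Im a. Proof. by case: a. Qed.
Lemma cReM (a b : C) : Re (a * b) = Re a * Re b - Im a * Im b.
Proof. by case: a b => [? ?] []. Qed.
Lemma cImM (a b : C) : Im (a * b) = Re a * Im b + Im a * Re b.
Proof. by case: a b => [? ?] []. Qed.
Lemma complexP (a b : C) : Re a = Re b -> Im a = Im b -> a = b.
Proof. by case: a b => [? ?] [? ?] /= -> ->. Qed.

Lemma csmooth_cst (c : C) : csmooth (fun _ => c).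
Proof. by split; exact: smooth0_cst. Qed.
Lemma csmoothD F G : csmooth (fun x => F x + G x).
Proof.
have [[? ?] [? ?]] := (sfun_csmooth F, sfun_csmooth G).
split; [under eq_fun do rewrite cReD | under eq_fun do rewrite cImD]; exact: smooth0D.
Qed.
Lemma csmoothN F : csmooth (fun x => - F x).
Proof.
have [? ?] := sfun_csmooth F.
split; [under eq_fun do rewrite cReN | under eq_fun do rewrite cImN]; exact: smooth0N.
Qed.
Lemma csmoothM F G : csmooth (fun x => F x * G x).
Proof.
have [[? ?] [? ?]] := (sfun_csmooth F, sfun_csmooth G).
split; [under eq_fun do rewrite cReM | under eq_fun do rewrite cImM].
  by apply: smooth0D; [|apply: smooth0N]; apply: smooth0M.
by apply: smooth0D; apply: smooth0M.
Qed.

Definition scst (c : C) : cinf := mkS (csmooth_cst c).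
Definition sadd F G : cinf := mkS (csmoothD F G).
Definition sopp F : cinf := mkS (csmoothN F).
Definition smul F G : cinf := mkS (csmoothM F G).

Fact saddA : associative sadd.
Proof. by move=> F G H; apply: sfunP => x x0; rewrite !mkSE // addrA. Qed.
Fact saddC : commutative sadd.
Proof. by move=> F G; apply: sfunP => x x0; rewrite !mkSE // addrC. Qed.
Fact sadd0 : left_id (scst 0) sadd.
Proof. by move=> F; apply: sfunP => x x0; rewrite !mkSE // add0r. Qed.
Fact saddN : left_inverse (scst 0) sopp sadd.
Proof. by move=> F; apply: sfunP => x x0; rewrite !mkSE // addNr. Qed.
HB.instance Definition _ := GRing.isZmodule.Build cinf saddA saddC sadd0 saddN.

Fact smulA : associative smul.
Proof. by move=> F G H; apply: sfunP => x x0; rewrite !mkSE // mulrA. Qed.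
Fact smulC : commutative smul.
Proof. by move=> F G; apply: sfunP => x x0; rewrite !mkSE // mulrC. Qed.
Fact smul1 : left_id (scst 1) smul.
Proof. by move=> F; apply: sfunP => x x0; rewrite !mkSE // mul1r. Qed.
Fact smulDl : left_distributive smul sadd.
Proof. by move=> F G H; apply: sfunP => x x0; rewrite !mkSE // mulrDl. Qed.
Fact sone_neq0 : scst 1 != scst 0.
Proof.
apply/eqP => E; pose x : V := const_mx 1.
have x0 : x != 0.
  apply/eqP => /rowP/(_ ord0); rewrite !mxE => /eqP; by rewrite oner_eq0.
have : scst 1 x = scst 0 x by rewrite E.
by rewrite !mkSE // => /eqP; rewrite oner_eq0.
Qed.
HB.instance Definition _ :=
  GRing.Zmodule_isComNzRing.Build cinf smulA smulC smul1 smulDl sone_neq0.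

Lemma sE_D F G x : (F + G) x = F x + G x.
Proof. by have [->|x0] := eqVneq x 0; rewrite ?sfun_at0 ?addr0 // mkSE. Qed.
Lemma sE_N F x : (- F) x = - F x.
Proof. by have [->|x0] := eqVneq x 0; rewrite ?sfun_at0 ?oppr0 // mkSE. Qed.
Lemma sE_M F G x : (F * G) x = F x * G x.
Proof. by have [->|x0] := eqVneq x 0; rewrite ?sfun_at0 ?mulr0 // mkSE. Qed.
Lemma sE_0 x : (0 : cinf) x = 0.
Proof. by have [->|x0] := eqVneq x 0; rewrite ?sfun_at0 // mkSE. Qed.
Lemma sE_cst c x : x != 0 -> scst c x = c.
Proof. exact: mkSE. Qed.
Lemma sE_1 x : x != 0 -> (1 : cinf) x = 1.
Proof. exact: mkSE. Qed.
Lemma sE_X F m x : x != 0 -> (F ^+ m) x = F x ^+ m.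
Proof. by move=> x0; elim: m => [|m IH]; rewrite ?sE_1 // !exprS sE_M IH. Qed.
Lemma sE_sum (J : Type) (r : seq J) (P : pred J) (f : J -> cinf) x :
  (\sum_(i <- r | P i) f i) x = \sum_(i <- r | P i) f i x.
Proof. by elim/big_rec2: _ => [|i a b _ <-]; rewrite ?sE_0 ?sE_D. Qed.

Fact scst_is_additive : zmod_morphism scst.
Proof. by move=> a b; apply: sfunP => x x0; rewrite sE_D sE_N !sE_cst. Qed.
Fact scst_is_multiplicative : monoid_morphism scst.
Proof. by split=> [//|a b]; apply: sfunP => x x0; rewrite sE_M !sE_cst. Qed.
HB.instance Definition _ := GRing.isZmodMorphism.Build C cinf scst scst_is_additive.
HB.instance Definition _ := GRing.isMonoidMorphism.Build C cinf scst scst_is_multiplicative.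

Lemma csmooth_coord k : csmooth (fun x => ((x 0 k)%:C)%C).
Proof. by split; [exact: smooth0_coord | exact: smooth0_cst]. Qed.
Definition scoord k : cinf := mkS (csmooth_coord k).
Lemma sE_coord k x : scoord k x = ((x 0 k)%:C)%C.
Proof. by have [->|x0] := eqVneq x 0; rewrite ?sfun_at0 ?mxE // mkSE. Qed.

Lemma csmooth_der j F : csmooth (fun x =>
  ('D_(e_ j) (fun y => Re (F y)) x +i* 'D_(e_ j) (fun y => Im (F y)) x)%C).
Proof. by have [h1 h2] := sfun_csmooth F; exact: conj (smooth0_D j h1) (smooth0_D j h2). Qed.
Definition der j F : cinf := mkS (csmooth_der j F).

Lemma Re_der j F x : x != 0 -> Re (der j F x) = 'D_(e_ j) (fun y => Re (F y)) x.
Proof. by move=> x0; rewrite mkSE. Qed.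
Lemma Im_der j F x : x != 0 -> Im (der j F x) = 'D_(e_ j) (fun y => Im (F y)) x.
Proof. by move=> x0; rewrite mkSE. Qed.

Lemma sderivable_Re F j x : x != 0 -> derivable (fun y => Re (F y)) x (e_ j).
Proof. by have [sF _] := sfun_csmooth F; exact: smooth0_der. Qed.
Lemma sderivable_Im F j x : x != 0 -> derivable (fun y => Im (F y)) x (e_ j).
Proof. by have [_ sF] := sfun_csmooth F; exact: smooth0_der. Qed.

Lemma der_cst j c : der j (scst c) = 0.
Proof.
apply: sfunP => x x0; rewrite sE_0; apply: complexP.
  rewrite Re_der // (@derive_ext _ (cst (Re c))) ?derive_cst // => y y0.
  by rewrite sE_cst.
rewrite Im_der // (@derive_ext _ (cst (Im c))) ?derive_cst // => y y0.
by rewrite sE_cst.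
Qed.

Section DeriveRules.
Variables (f g h k : V -> R) (x v : V).
Hypotheses (df : derivable f x v) (dg : derivable g x v).
Hypotheses (dh : derivable h x v) (dk : derivable k x v).

Lemma derive_sub : 'D_v (fun y => f y - g y) x = 'D_v f x - 'D_v g x.
Proof. exact: deriveB. Qed.

Lemma derive_mulD : 'D_v (fun y => f y * g y + h y * k y) x =
  f x * 'D_v g x + g x * 'D_v f x + (h x * 'D_v k x + k x * 'D_v h x).
Proof.
apply: etrans (deriveD (derivableM df dg) (derivableM dh dk)) _.
by rewrite (deriveM df dg) (deriveM dh dk).
Qed.

Lemma derive_mulB : 'D_v (fun y => f y * g y - h y * k y) x =
  f x * 'D_v g x + g x * 'D_v f x - (h x * 'D_v k x + k x * 'D_v h x).
Proof.
apply: etrans (deriveB (derivableM df dg) (derivableM dh dk)) _.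
by rewrite (deriveM df dg) (deriveM dh dk).
Qed.
End DeriveRules.

Fact der_is_additive j : zmod_morphism (der j).
Proof.
move=> F G; apply: sfunP => x x0; rewrite sE_D sE_N; apply: complexP.
  rewrite cReD cReN !Re_der //; under eq_fun do rewrite sE_D sE_N cReD cReN.
  exact: (derive_sub (@sderivable_Re F j x x0) (@sderivable_Re G j x x0)).
rewrite cImD cImN !Im_der //; under eq_fun do rewrite sE_D sE_N cImD cImN.
exact: (derive_sub (@sderivable_Im F j x x0) (@sderivable_Im G j x x0)).
Qed.
HB.instance Definition _ j := GRing.isZmodMorphism.Build cinf cinf (der j) (der_is_additive j).

Lemma derM j F G : der j (F * G) = der j F * G + F * der j G.
Proof.
apply: sfunP => x x0; rewrite sE_D !sE_M.
have [dRF dRG] := (@sderivable_Re F j x x0, @sderivable_Re G j x x0).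
have [dIF dIG] := (@sderivable_Im F j x x0, @sderivable_Im G j x x0).
apply: complexP.
  rewrite cReD !cReM !Re_der // !Im_der //.
  under eq_fun do rewrite sE_M cReM.
  apply: etrans (derive_mulB dRF dRG dIF dIG) _.
  move: (derive _ _ _) (derive _ _ _) (derive _ _ _) (derive _ _ _) => a b c d.
  by ring.
rewrite cImD !cImM !Re_der // !Im_der //.
under eq_fun do rewrite sE_M cImM.
apply: etrans (derive_mulD dRF dIG dIF dRG) _.
move: (derive _ _ _) (derive _ _ _) (derive _ _ _) (derive _ _ _) => a b c d.
by ring.
Qed.
End SmoothRing.

Section SmoothRingTheory.
Variables (R : realType) (n : nat).
Local Notation V := 'rV[R]_(rdim n).
Local Notation I := 'I_(rdim n).
Local Notation C := R[i].
Local Notation Re := (@complex.Re R).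
Local Notation Im := (@complex.Im R).
Local Notation e_ := (@pdir R n).
Local Notation cinf := (cinf R n).
Local Notation cst := (@scst R n).
Local Notation xx := (@scoord R n).
Implicit Types (F G : cinf) (x : V) (j k : I).

Local Opaque der scst scoord.

Lemma der_coord j k : der j (xx k) = (j == k)%:R.
Proof.
apply: sfunP => x x0; have -> : ((j == k)%:R : cinf) x = (j == k)%:R.
  by case: (j == k); rewrite ?sE_0 // sE_1.
apply: complexP; rewrite ?Re_der ?Im_der //.
  under eq_fun do rewrite sE_coord /=.
  by rewrite derive_coord; case: (j == k).
under eq_fun do rewrite sE_coord /=.
by rewrite derive_cst; case: (j == k).
Qed.

Lemma derC j k F : der j (der k F) = der k (der j F).
Proof.
have [h1 h2] := sfun_csmooth F.
have main (a b : I) x : x != 0 -> der a (der b F) x =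
    ('D_(e_ a) ('D_(e_ b) (fun y => Re (F y))) x +i*
     'D_(e_ a) ('D_(e_ b) (fun y => Im (F y))) x)%C.
  move=> x0; apply: complexP; rewrite ?Re_der ?Im_der //=.
    by apply: derive_ext => // y y0; rewrite Re_der.
  by apply: derive_ext => // y y0; rewrite Im_der.
apply: sfunP => x x0; apply: etrans (main j k x x0) (etrans _ (esym (main k j x x0))).
by rewrite (smooth0_schwarz j k h1 x0) (smooth0_schwarz j k h2 x0).
Qed.

Lemma derX j F m : der j (F ^+ m.+1) = m.+1%:R * F ^+ m * der j F.
Proof.
elim: m => [|m IH]; first by rewrite !expr1 expr0 !mul1r.
rewrite exprS derM IH (exprS F m) -[m.+2%:R]/(1 *+ m.+1.+1) (mulrS 1 m.+1).
by move: (der j F) (F ^+ m) (1 *+ m.+1) => d p c; ring.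
Qed.

Lemma der_cstM j c F : der j (cst c * F) = cst c * der j F.
Proof. by rewrite derM der_cst mul0r add0r. Qed.

Lemma der_nat j m : der j (m%:R : cinf) = 0.
Proof. by rewrite -(rmorph_nat cst) der_cst. Qed.

Lemma der1 j : der j (1 : cinf) = 0.
Proof. exact: (der_nat j 1). Qed.

Definition derw (s : seq I) F := foldr (@der R n) F s.

Lemma derwE s F x : x != 0 -> derw s F x =
  (Defs.iterD s (fun y => Re (F y)) x +i* Defs.iterD s (fun y => Im (F y)) x)%C.
Proof.
elim: s x => [|j s IH] x x0 /=; first by case: (F x).
apply: complexP; rewrite ?Re_der ?Im_der //=;
  by apply: derive_ext => // y y0; rewrite IH.
Qed.

Lemma sfun_inv F : (forall x, x != 0 -> F x != 0) -> exists G : cinf, F * G = 1.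
Proof.
move=> F0; pose N y := (Re (F y) ^+ 2 + Im (F y) ^+ 2)^-1.
have [h1 h2] := sfun_csmooth F.
have sN : smooth0 N.
  apply: smooth0V => [|x x0].
    by apply: smooth0D; apply: smooth0M.
  apply: contra_neq (F0 x x0) => /eqP; rewrite paddr_eq0 ?sqr_ge0 //.
  by rewrite !sqrf_eq0 => /andP[/eqP a /eqP b]; apply: complexP.
have sG : csmooth (fun y => (Re (F y) * N y +i* - (Im (F y) * N y))%C).
  split; first exact: smooth0M h1 sN.
  exact: smooth0N (smooth0M h2 sN).
exists (mkS sG); apply: sfunP => x x0; rewrite sE_M sE_1 // mkSE //.
have : Re (F x) ^+ 2 + Im (F x) ^+ 2 != 0.
  apply: contra_neq (F0 x x0) => /eqP; rewrite paddr_eq0 ?sqr_ge0 //.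
  by rewrite !sqrf_eq0 => /andP[/eqP a /eqP b]; apply: complexP.
rewrite /N; case: (F x) => a b /= H.
by apply: complexP => /=; field.
Qed.

Definition srealb F := forall x, Im (F x) = 0.

(** Substitution goes through real coordinates and must avoid the origin, where nothing is known
    about the function substituted into. *)
Definition comp_ok (g : I -> cinf) :=
  (forall k, srealb (g k)) /\ forall x, x != 0 -> \row_k Re (g k x) != 0.

Lemma csmooth_comp (g : I -> cinf) F : comp_ok g ->
  csmooth (fun x => F (\row_k Re (g k x))).
Proof.
move=> [_ g0]; have [h1 h2] := sfun_csmooth F.
have hg k : smooth0 (fun x => Re (g k x)) := proj1 (sfun_csmooth (g k)).
by split; [exact: smooth0_comp h1 hg g0 | exact: smooth0_comp h2 hg g0].
Qed.

Definition scomp (g : I -> cinf) F : cinf :=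
  match pselect (comp_ok g) with
  | left ok => mkS (csmooth_comp F ok) | right _ => 0 end.

Lemma sE_comp g F x : comp_ok g -> x != 0 -> scomp g F x = F (\row_k Re (g k x)).
Proof. by rewrite /scomp; case: pselect => // ok _ x0; rewrite mkSE. Qed.

Section Comp.
Variables (g : I -> cinf) (ok : comp_ok g).

Lemma comp_row_neq0 x : x != 0 -> \row_k Re (g k x) != 0.
Proof. by case: ok => _; apply. Qed.
Hint Resolve comp_row_neq0 : core.

Fact scomp_is_additive : zmod_morphism (scomp g).
Proof. by move=> F G; apply: sfunP => x x0; rewrite !(sE_D, sE_N, sE_comp). Qed.
Lemma scompB F G : scomp g (F - G) = scomp g F - scomp g G.
Proof. exact: scomp_is_additive. Qed.
Lemma scompD F G : scomp g (F + G) = scomp g F + scomp g G.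
Proof. by apply: sfunP => x x0; rewrite !(sE_D, sE_comp). Qed.
Lemma scompM F G : scomp g (F * G) = scomp g F * scomp g G.
Proof. by apply: sfunP => x x0; rewrite !(sE_M, sE_comp). Qed.
Lemma scomp_cst c : scomp g (cst c) = cst c.
Proof. by apply: sfunP => x x0; rewrite sE_comp // !sE_cst // comp_row_neq0. Qed.
Lemma scomp_coord k : scomp g (xx k) = g k.
Proof.
apply: sfunP => x x0; rewrite sE_comp // sE_coord mxE.
by apply: complexP => //=; case: ok => ->.
Qed.
Lemma scomp1 : scomp g 1 = 1.
Proof. by apply: sfunP => x x0; rewrite sE_comp // !sE_1 // comp_row_neq0. Qed.
Lemma der_comp j F : der j (scomp g F) = \sum_k der j (g k) * scomp g (der k F).
Proof.
apply: sfunP => x x0; rewrite sE_sum.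
have [h1 h2] := sfun_csmooth F.
have hg k : smooth0 (fun x => Re (g k x)) := proj1 (sfun_csmooth (g k)).
have gx0 := comp_row_neq0 x0.
have dg k : der j (g k) x = ('D_(e_ j) (fun y => Re (g k y)) x +i* 0)%C.
  apply: complexP; rewrite ?Re_der ?Im_der //=.
  have -> : (fun y => Im (g k y)) = (fun _ => 0).
    by apply/funext => y; case: ok => ->.
  exact: derive_cst.
apply: complexP.
  rewrite Re_der // (@derive_ext _ _ _ (fun y => Re (F (\row_k Re (g k y))))) //; last first.
    by move=> y y0; rewrite sE_comp.
  rewrite (@derive_comp_coord _ _ (fun y => Re (F y)) (fun k y => Re (g k y))) //.
  rewrite (big_morph Re (@cReD R) (erefl : Re 0 = 0)); apply: eq_bigr => k _.
  by rewrite sE_M dg sE_comp // cReM /= mul0r subr0 Re_der.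
rewrite Im_der // (@derive_ext _ _ _ (fun y => Im (F (\row_k Re (g k y))))) //; last first.
  by move=> y y0; rewrite sE_comp.
rewrite (@derive_comp_coord _ _ (fun y => Im (F y)) (fun k y => Re (g k y))) //.
rewrite (big_morph Im (@cImD R) (erefl : Im 0 = 0)); apply: eq_bigr => k _.
by rewrite sE_M dg sE_comp // cImM /= mul0r addr0 Im_der.
Qed.
End Comp.
End SmoothRingTheory.

(** * The null cone and Thomas' operators *)

Section Cone.
Variables (R : realType) (n : nat).
Local Notation V := 'rV[R]_(rdim n).
Local Notation I := 'I_(rdim n).
Local Notation C := R[i].
Local Notation Re := (@complex.Re R).
Local Notation Im := (@complex.Im R).
Local Notation e_ := (@pdir R n).
Local Notation cinf := (cinf R n).
Implicit Types (F G : cinf) (x : V) (i j k : I).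
Local Opaque der scst scoord.

(** Real and imaginary parts of the same complex coordinate carry the same sign, so the real form
    has signature (2, 2n). *)
Definition eps i : R :=
  if (i == lshift _ ord0) || (i == rshift _ ord0) then 1 else -1.
Definition Lq x : R := \sum_i eps i * x 0 i ^+ 2.
Definition inN F := forall x, x != 0 -> Lq x = 0 -> F x = 0.

Lemma eps_sq i : eps i * eps i = 1.
Proof. by rewrite /eps; case: ifP => _; rewrite ?mulr1 // mulrNN mulr1. Qed.

(* Curves of degree two suffice: Lq_curve produces them inside the cone, tangent to the rotations of each coordinate plane. *)
Lemma quadratic_curve_der (f : V -> R) (x a b : V) : smooth0 f -> x != 0 ->
  (forall t : R, f (x + t *: a + t ^+ 2 *: b) = 0) ->
  \sum_k a 0 k * 'D_(e_ k) f x = 0.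
Proof.
move=> sf x0 f0; pose g (t : R) : V := x + t *: a + t ^+ 2 *: b.
have g0 : g 0 = x by rewrite /g scale0r expr0n /= scale0r !addr0.
have D k : is_derive (0 : R) 1 (fun t => g t 0 k) (a 0 k).
  have -> : (fun t => g t 0 k) =
      horner ((x 0 k)%:P + a 0 k *: 'X + b 0 k *: 'X^2).
    apply/funext => t; rewrite /g !mxE !hornerD !hornerZ hornerC hornerX hornerXn; ring.
  have H := @derivable_horner R ((x 0 k)%:P + a 0 k *: 'X + b 0 k *: 'X^2) 0.
  apply: DeriveDef => //; rewrite -derive1E -derivE.
  rewrite !derivD derivC !derivZ derivX derivXn !hornerD !hornerZ hornerMn.
  by rewrite hornerC hornerXn /= !hornerC expr1 mul0rn mulr0 add0r mulr1 addr0.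
have gx0 : g 0 != 0 by rewrite g0.
have dg k : derivable (fun t => g t 0 k) (0 : R) 1.
  by have Dk := D k; apply: ex_derive.
have H := smooth0_chain sf gx0 dg.
have E : f \o g = fun _ => 0 by apply/funext => t; exact: f0.
have := @derive_val _ _ _ _ _ _ _ H; rewrite E derive_cst g0 => H0.
apply: etrans (esym H0); by apply: eq_bigr => k _; rewrite (@derive_val _ _ _ _ _ _ _ (D k)).
Qed.

(** In the plane of [i] and [j] this is the rational half-angle parametrization of a rotation
    ([kp = 1]) or of a boost ([kp = -1]), multiplied by [1 + kp * t ^+ 2] to clear the
    denominator. *)
Lemma Lq_curve x i j (t : R) : i != j ->
  let kp := eps i * eps j in
  let a : V := (- 2 * kp * x 0 j) *: e_ i + (2 * x 0 i) *: e_ j in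
  let b : V := kp *: x + (- 2 * kp * x 0 i) *: e_ i + (- 2 * kp * x 0 j) *: e_ j in
  Lq (x + t *: a + t ^+ 2 *: b) = (1 + kp * t ^+ 2) ^+ 2 * Lq x.
Proof.
move=> ij kp a b.
have kp2 : kp * kp = 1 by rewrite /kp mulrACA !eps_sq mulr1.
rewrite /Lq (bigD1 i) //= (bigD1 j) 1?eq_sym //= [in RHS](bigD1 i) //=.
rewrite [in RHS](bigD1 j) 1?eq_sym //= !mulrDr mulr_sumr addrA [in RHS]addrA.
congr (_ + _); last first.
  apply: eq_bigr => k /andP[ki kj]; rewrite !mxE /= (negbTE ki) (negbTE kj) !mulr0; ring.
rewrite !mxE !eqxx (negbTE ij) eq_sym (negbTE ij) /= !mulr0 !mulr1 !addr0 !add0r.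
have ej : eps j = kp * eps i by rewrite /kp mulrAC eps_sq mul1r.
rewrite ej {ej}; clear a b; move: (x 0 i) (x 0 j) => p q.
move: kp kp2 => k0 k2; move: (eps i) => ei.
have : (k0 == 1) || (k0 == -1) by rewrite -sqrf_eq1 expr2 k2.
by case/orP => /eqP ->; ring.
Qed.

Lemma tangent_real (f : V -> R) x i j : smooth0 f -> f 0 = 0 ->
  (forall y, y != 0 -> Lq y = 0 -> f y = 0) -> x != 0 -> Lq x = 0 ->
  eps i * x 0 i * 'D_(e_ j) f x = eps j * x 0 j * 'D_(e_ i) f x.
Proof.
move=> sf f0 fN x0 Lx; have [->//|ij] := eqVneq i j.
set kp := eps i * eps j.
pose a : V := (- 2 * kp * x 0 j) *: e_ i + (2 * x 0 i) *: e_ j.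
pose b : V := kp *: x + (- 2 * kp * x 0 i) *: e_ i + (- 2 * kp * x 0 j) *: e_ j.
have fc (t : R) : f (x + t *: a + t ^+ 2 *: b) = 0.
  (* A boost curve can pass through the origin at [t = 1] or [t = -1]; there the normalization of
     the value at 0 is used. *)
  set y := _ + _; have [->//|y0] := eqVneq y 0.
  by apply: fN => //; rewrite /y (Lq_curve x t ij) Lx mulr0.
have := quadratic_curve_der sf x0 fc.
have two (d : I -> R) : \sum_k a 0 k * d k = - 2 * kp * x 0 j * d i + 2 * x 0 i * d j.
  rewrite (bigD1 i) //= (bigD1 j) 1?eq_sym //= big1 ?addr0; last first.
    move=> k /andP[ki kj].
    by rewrite !mxE /= (negbTE ki) (negbTE kj) !mulr0 addr0 mul0r.
  by rewrite !mxE !eqxx (negbTE ij) eq_sym (negbTE ij) /= !mulr0 !mulr1 addr0 add0r.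
rewrite two; move: (derive f x _) (derive f x _) => q p E; move: (p : R) (q : R) E => {}p {}q E.
have E2 : x 0 i * q = kp * x 0 j * p.
  by apply: (mulfI (_ : 2 != 0 :> R)); [rewrite pnatr_eq0 | move: E; lra].
by rewrite -mulrA E2 /kp !mulrA eps_sq mul1r.
Qed.

Lemma tangent F x i j : inN F -> x != 0 -> Lq x = 0 ->
  (eps i * x 0 i)%:C%C * der j F x = (eps j * x 0 j)%:C%C * der i F x.
Proof.
move=> FN x0 Lx; have [h1 h2] := sfun_csmooth F.
have RM (r : R) (w : C) : Re (r%:C%C * w) = r * Re w by rewrite cReM /= mul0r subr0.
have IM (r : R) (w : C) : Im (r%:C%C * w) = r * Im w by rewrite cImM /= mul0r addr0.
apply: complexP.
  rewrite RM [RHS]RM (Re_der j F x0) (Re_der i F x0).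
  apply: (tangent_real _ _ h1) => [|y y0 Ly||]; [by rewrite sfun_at0| |exact: x0|exact: Lx].
  by rewrite (FN y y0 Ly).
rewrite IM [RHS]IM (Im_der j F x0) (Im_der i F x0).
apply: (tangent_real _ _ h2) => [|y y0 Ly||]; [by rewrite sfun_at0| |exact: x0|exact: Lx].
by rewrite (FN y y0 Ly).
Qed.
End Cone.

(** * Algebra of Thomas' operators *)

Lemma rdimE m : (0 < m)%N -> rdim m = (2 * m.-1 + 4)%N.
Proof. by case: m => // m _; rewrite /rdim /= mul2n -addnn !addnS !addSn addn0. Qed.

(* The Weyl-algebra identities only use commuting derivations der i and elements xx i
   with der j (xx i) = delta_ij, and constants ee i with square one. *)
Section ThomasOperator.
Variables (A : comNzRingType) (I : finType) (pp : nat).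
Variables (der : I -> A -> A) (xx ee : I -> A).
Hypothesis derB : forall i F G, der i (F - G) = der i F - der i G.
Hypothesis derM : forall i F G, der i (F * G) = der i F * G + F * der i G.
Hypothesis derC : forall i j F, der i (der j F) = der j (der i F).
Hypothesis der_xx : forall i j, der i (xx j) = (i == j)%:R.
Hypothesis der_ee : forall i j, der i (ee j) = 0.
Hypothesis ee_sq : forall i, ee i * ee i = 1.
Implicit Types (F G : A) (i j k : I).

Definition xf i : A := ee i * xx i.
Definition Eu F : A := \sum_i xx i * der i F.
Definition Lap F : A := \sum_i ee i * der i (der i F).
Definition rot i j F : A := xf i * der j F - xf j * der i F.
Definition LL : A := \sum_i xf i * xx i.
Definition TT F : A := Eu F + pp%:R * F.
(* With #|I| = 2 pp + 4 this is Thomas' operator; pp stands for n - 1. *)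
Definition DD i F : A := 2%:R * der i (TT F) - xf i * Lap F.

Lemma der0 i : der i 0 = 0. Proof. by rewrite -{1}(subrr 0) derB subrr. Qed.
Lemma derN i F : der i (- F) = - der i F.
Proof. by rewrite -sub0r derB der0 sub0r. Qed.
Lemma derD i F G : der i (F + G) = der i F + der i G.
Proof. by rewrite -{1}[G]opprK derB derN opprK. Qed.
Lemma der_sum (J : Type) (r : seq J) (P : pred J) (f : J -> A) i :
  der i (\sum_(u <- r | P u) f u) = \sum_(u <- r | P u) der i (f u).
Proof. by rewrite (big_morph _ (derD i) (der0 i)). Qed.
Lemma der_one i : der i 1 = 0.
Proof.
have := derM i 1 1; rewrite !mulr1 mul1r => /eqP.
by rewrite -{1}[der i 1]addr0 (inj_eq (addrI _)) eq_sym => /eqP.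
Qed.
Lemma der_natM i m F : der i (m%:R * F) = m%:R * der i F.
Proof.
by elim: m => [|m IH]; rewrite ?mul0r ?der0 // mulrS !mulrDl derD IH !mul1r.
Qed.
Lemma der_eeM j i F : der j (ee i * F) = ee i * der j F.
Proof. by rewrite derM der_ee mul0r add0r. Qed.
Lemma der_xf j i : der j (xf i) = ee i * (j == i)%:R.
Proof. by rewrite der_eeM der_xx. Qed.
Lemma der_xfM j i F : der j (xf i * F) = ee i * (j == i)%:R * F + xf i * der j F.
Proof. by rewrite derM der_xf. Qed.
Lemma ee_xf i : ee i * xf i = xx i.
Proof. by rewrite mulrA ee_sq mul1r. Qed.

Lemma sum_delta j (f : I -> A) : \sum_i (i == j)%:R * f i = f j.
Proof.
rewrite (bigD1 j) //= eqxx mul1r big1 ?addr0 // => i /negbTE ->; by rewrite mul0r.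
Qed.
Lemma sum_delta' j (f : I -> A) : \sum_i (j == i)%:R * f i = f j.
Proof. by rewrite -[RHS]sum_delta; apply: eq_bigr => i _; rewrite eq_sym. Qed.

Lemma der_Eu i F : der i (Eu F) = der i F + Eu (der i F).
Proof.
rewrite /Eu der_sum -[X in _ = X + _](sum_delta' i (fun j => der j F)) -big_split /=.
by apply: eq_bigr => j _; rewrite derM der_xx (derC i j).
Qed.
Lemma Eu_der i F : Eu (der i F) = der i (Eu F) - der i F.
Proof. by rewrite der_Eu addrC addKr. Qed.

Lemma EuD F G : Eu (F + G) = Eu F + Eu G.
Proof. by rewrite /Eu -big_split; apply: eq_bigr => i _; rewrite derD mulrDr. Qed.
Lemma EuN F : Eu (- F) = - Eu F.
Proof. by rewrite /Eu -sumrN; apply: eq_bigr => i _; rewrite derN mulrN. Qed.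
Lemma EuB F G : Eu (F - G) = Eu F - Eu G.
Proof. by rewrite EuD EuN. Qed.
Lemma EuM F G : Eu (F * G) = Eu F * G + F * Eu G.
Proof.
rewrite /Eu mulr_suml mulr_sumr -big_split; apply: eq_bigr => i _ /=.
by rewrite derM; move: (xx i) (der i F) (der i G) => a b c; ring.
Qed.
Lemma Eu_natM m F : Eu (m%:R * F) = m%:R * Eu F.
Proof. by rewrite /Eu mulr_sumr; apply: eq_bigr => i _; rewrite der_natM mulrCA. Qed.
Lemma Eu_xf i : Eu (xf i) = xf i.
Proof.
rewrite /Eu -[RHS](sum_delta i (fun j => ee i * xx j)); apply: eq_bigr => j _.
by rewrite der_xf; move: (xx j) (ee i) (_%:R) => a b c; ring.
Qed.
Lemma Eu_xfM i F : Eu (xf i * F) = xf i * (F + Eu F).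
Proof. by rewrite EuM Eu_xf mulrDr. Qed.

Lemma LapD F G : Lap (F + G) = Lap F + Lap G.
Proof. by rewrite /Lap -big_split; apply: eq_bigr => i _; rewrite !derD mulrDr. Qed.
Lemma LapN F : Lap (- F) = - Lap F.
Proof. by rewrite /Lap -sumrN; apply: eq_bigr => i _; rewrite !derN mulrN. Qed.
Lemma Lap_natM m F : Lap (m%:R * F) = m%:R * Lap F.
Proof. by rewrite /Lap mulr_sumr; apply: eq_bigr => i _; rewrite !der_natM mulrCA. Qed.
Lemma der_Lap i F : der i (Lap F) = Lap (der i F).
Proof.
rewrite /Lap der_sum; apply: eq_bigr => j _.
by rewrite /= der_eeM (derC i j) (derC i j).
Qed.
Lemma Lap_xfM i F : Lap (xf i * F) = xf i * Lap F + 2%:R * der i F.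
Proof.
rewrite -[der i F](sum_delta i (fun j => der j F)) /Lap !mulr_sumr -big_split /=.
apply: eq_bigr => j _; rewrite der_xfM derD /= der_xfM.
have [->|ji] := eqVneq j i; rewrite /= ?mulr1 ?mulr0 ?mul0r ?mul1r; last first.
  by rewrite der0 !add0r ?mulr0 addr0 mulrCA.
rewrite der_eeM !mulrDr !(mulrA (ee i) (ee i)) ee_sq !mul1r.
by move: (der i F) (der i (der i F)) (ee i) (xf i) => a b c d; ring.
Qed.
Lemma Lap_Eu F : Lap (Eu F) = Eu (Lap F) + 2%:R * Lap F.
Proof.
have Eu0 : Eu 0 = 0 by rewrite /Eu big1 // => i _; rewrite der0 mulr0.
have EuE j G : Eu (ee j * G) = ee j * Eu G.
  by rewrite /Eu mulr_sumr; apply: eq_bigr => i _; rewrite der_eeM mulrCA.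
rewrite {2 3}/Lap (big_morph Eu EuD Eu0) mulr_sumr -big_split /=.
apply: eq_bigr => i _; rewrite der_Eu derD /= der_Eu EuE.
by move: (der i (der i F)) (Eu _) (ee i) => a b c; ring.
Qed.

Lemma TTD F G : TT (F + G) = TT F + TT G.
Proof. by rewrite /TT EuD mulrDr addrACA. Qed.
Lemma TTN F : TT (- F) = - TT F.
Proof. by rewrite /TT EuN mulrN opprD. Qed.
Lemma TT_natM m F : TT (m%:R * F) = m%:R * TT F.
Proof. by rewrite /TT Eu_natM mulrDr (mulrCA pp%:R). Qed.
Lemma TT_der i F : TT (der i F) = der i (TT F) - der i F.
Proof. by rewrite /TT Eu_der derD der_natM addrAC. Qed.
Lemma TT_xfM i F : TT (xf i * F) = xf i * (TT F + F).
Proof.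
rewrite /TT Eu_xfM; move: (xf i) (Eu F) (pp%:R : A) => a b c; ring.
Qed.
Lemma TT_Lap F : TT (Lap F) = Lap (TT F) - 2%:R * Lap F.
Proof.
rewrite /TT LapD Lap_Eu Lap_natM; move: (Eu (Lap F)) (Lap F) (pp%:R : A) => a b c; ring.
Qed.
Lemma Lap_TT F : Lap (TT F) = TT (Lap F) + 2%:R * Lap F.
Proof. by rewrite TT_Lap subrK. Qed.

Lemma DDD i F G : DD i (F + G) = DD i F + DD i G.
Proof.
rewrite /DD TTD LapD derD.
by move: (der i (TT F)) (der i (TT G)) (Lap F) (Lap G) (xf i) => a b c d e; ring.
Qed.
Lemma DDN i F : DD i (- F) = - DD i F.
Proof. by rewrite /DD TTN LapN derN mulrN mulrN opprB opprK addrC. Qed.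
Lemma DDB i F G : DD i (F - G) = DD i F - DD i G.
Proof. by rewrite DDD DDN. Qed.

(** Moving [TT] and [Lap] past [DD b] leaves an expression symmetric in [a] and [b], except for the
    coefficient [ee b * (a == b)%:R], which is symmetric because it lives on the diagonal. *)
Lemma DDC i j F : DD i (DD j F) = DD j (DD i F).
Proof.
have E a b : DD a (DD b F) = 4%:R * der a (der b (TT (TT F) - TT F))
   - 2%:R * (ee b * (a == b)%:R) * (TT (Lap F) + Lap F)
   - 2%:R * (xf b * der a (TT (Lap F) + Lap F) + xf a * der b (TT (Lap F) + Lap F))
   + xf a * xf b * Lap (Lap F).
  rewrite {1}/DD.
  have -> : TT (DD b F) = 2%:R * der b (TT (TT F) - TT F) - xf b * (TT (Lap F) + Lap F).
    by rewrite /DD TTD TTN TT_natM TT_der TT_xfM derB.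
  have -> : Lap (DD b F) = 2%:R * der b (TT (Lap F) + 2%:R * Lap F)
       - (xf b * Lap (Lap F) + 2%:R * der b (Lap F)).
    by rewrite /DD LapD LapN Lap_natM Lap_xfM -der_Lap Lap_TT.
  have -> : TT (Lap F) + 2%:R * Lap F = (TT (Lap F) + Lap F) + Lap F.
    by move: (TT (Lap F)) (Lap F) => u v; ring.
  move: (Lap F) => H; move: (TT H + H) (TT (TT F) - TT F) => G K.
  rewrite derB der_natM der_xfM derD.
  move: (der a (der b K)) (der a G) (der b G) (der b H) (Lap H) => p q r s t.
  by move: (xf a) (xf b) (ee b) ((a == b)%:R : A) => u v w z; ring.
have D : ee j * (i == j)%:R = ee i * (j == i)%:R.
  by rewrite [j == i]eq_sym; case: eqVneq => [->//|_]; rewrite !mulr0.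
rewrite (E i j) (E j i) (derC i j (TT (TT F) - TT F)) D.
move: (TT (TT F) - TT F) => K; move: (TT (Lap F) + Lap F) (Lap (Lap F)) => G H.
move: (der j (der i K)) (der i G) (der j G) => p q r.
by move: (ee i * (j == i)%:R) (xf i) (xf j) => s t u; ring.
Qed.

Lemma Eu_DD i F : Eu (DD i F) = DD i (Eu F) - DD i F.
Proof.
rewrite /DD EuB Eu_natM Eu_der Eu_xfM Lap_Eu.
have -> : Eu (TT F) = TT (Eu F) by rewrite /TT EuD Eu_natM.
move: (der i (TT (Eu F))) (der i (TT F)) (xf i) (Eu (Lap F)) => a b c d.
by move: (Lap F) => e; ring.
Qed.

Lemma DD_natM i m F : DD i (m%:R * F) = m%:R * DD i F.
Proof.
rewrite /DD TT_natM der_natM Lap_natM.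
by move: (der i (TT F)) (xf i) (Lap F) (m%:R : A) => a b c d; ring.
Qed.

Lemma TT_DD i F : TT (DD i F) = DD i (TT F) - DD i F.
Proof. by rewrite -[TT F]/(Eu F + _ * F) DDD DD_natM /TT Eu_DD addrAC. Qed.

(** This shows that [DD i] is tangential: on the right there are only rotations, [Eu] and a multiple
    of [LL]. The dimension enters through the term [xf k * der i F], which the double rotations
    produce once for every [j]; this ties the shift [pp] in [TT] to the dimension. *)
Lemma xf_DD k i F : #|I| = (2 * pp + 4)%N -> xf k * DD i F =
  - (\sum_j ee j * rot k j (rot i j F)) - ee i * (k == i)%:R * Eu F
  - rot i k (Eu F) + rot i k F + LL * der k (der i F).
Proof.
move=> cI.
have E j : ee j * rot k j (rot i j F) =
   xf k * xf i * (ee j * der j (der j F)) + (j == i)%:R * (xf k * ee i * (ee j * der j F))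
   - xf k * der i F - xf k * (xx j * der j (der i F))
   - ee i * (k == i)%:R * (xx j * der j F) - xf i * (xx j * der j (der k F))
   + (k == j)%:R * (xx j * ee j * der i F) + xf j * xx j * der k (der i F).
  rewrite /rot !derB !der_xfM eqxx (derC k j) -(ee_xf j) mulr1.
  have -> : xf k * der i F = xf k * (ee j * ee j) * der i F by rewrite ee_sq mulr1.
  move: (der j (der j F)) (der j (der i F)) (der j (der k F)) (der k (der i F)) => p q r s.
  move: (der i F) (der j F) ((j == i)%:R : A) ((k == i)%:R : A) => t u v w.
  by move: ((k == j)%:R : A) (ee i) (xf k) (xf i) (xf j) (ee j) => *; ring.
have m2 : \sum_(j : I) xf k * der i F = (2%:R * pp%:R + 4%:R) * (xf k * der i F).
  by rewrite sumr_const cI -[LHS]mulr_natl natrD natrM.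
have S8 (f1 f2 f3 f4 f5 f6 f7 f8 : I -> A) :
    \sum_j (f1 j + f2 j - f3 j - f4 j - f5 j - f6 j + f7 j + f8 j) =
    \sum_j f1 j + \sum_j f2 j - \sum_j f3 j - \sum_j f4 j - \sum_j f5 j - \sum_j f6 j
    + \sum_j f7 j + \sum_j f8 j.
  by rewrite !big_split /= !sumrN.
rewrite (eq_bigr _ (fun j _ => E j)) S8 {S8 E} sum_delta sum_delta' m2.
rewrite -!mulr_sumr -!mulr_suml -/(Lap F) -/(Eu _) -/(Eu _) -/(Eu _) -/LL.
rewrite !Eu_der /DD /rot /TT derD der_natM.
have -> : xf k * ee i * (ee i * der i F) = xf k * (ee i * ee i) * der i F by ring.
have -> : xx k * ee k = xf k by rewrite mulrC.
rewrite ee_sq; move: (der i (Eu F)) (der k (Eu F)) (der k (der i F)) LL => a b c d.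
move: (der i F) (der k F) (Eu F) (Lap F) ((k == i)%:R : A) => e f g h u.
by move: (xf k) (xf i) (ee i) (pp%:R : A) => v w x y; ring.
Qed.

Section Constants.
Variables (c : A) (c_const : forall j, der j c = 0).

Lemma der_constM j F : der j (c * F) = c * der j F.
Proof. by rewrite derM c_const mul0r add0r. Qed.
Lemma Eu_constM F : Eu (c * F) = c * Eu F.
Proof. by rewrite /Eu mulr_sumr; apply: eq_bigr => j _; rewrite der_constM mulrCA. Qed.
Lemma TT_constM F : TT (c * F) = c * TT F.
Proof. by rewrite /TT Eu_constM mulrDr (mulrCA c). Qed.
Lemma Lap_constM F : Lap (c * F) = c * Lap F.
Proof. by rewrite /Lap mulr_sumr; apply: eq_bigr => j _; rewrite !der_constM mulrCA. Qed.
Lemma DD_constM i F : DD i (c * F) = c * DD i F.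
Proof.
rewrite /DD TT_constM der_constM Lap_constM.
by move: (der i (TT F)) (xf i) (Lap F) => a b d; ring.
Qed.
End Constants.

Section Directions.
Variables (a : I -> A) (a_const : forall i j, der j (a i) = 0).

Definition Dv F : A := \sum_i a i * DD i F.
Definition ax : A := \sum_i a i * xf i.

Lemma DvB F G : Dv (F - G) = Dv F - Dv G.
Proof. by rewrite /Dv -sumrB; apply: eq_bigr => i _; rewrite DDB mulrBr. Qed.
Lemma DD_sum k (J : Type) (r : seq J) (P : pred J) (f : J -> A) :
  DD k (\sum_(u <- r | P u) f u) = \sum_(u <- r | P u) DD k (f u).
Proof.
have D0 : DD k 0 = 0 by rewrite -{1}(subrr 0) DDB subrr.
by rewrite (big_morph _ (DDD k) D0).
Qed.
Lemma DD_Dv k F : DD k (Dv F) = Dv (DD k F).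
Proof.
rewrite /Dv DD_sum; apply: eq_bigr => i _.
by rewrite DD_constM // (DDC k i).
Qed.
Lemma TT_sum (J : Type) (r : seq J) (P : pred J) (f : J -> A) :
  TT (\sum_(u <- r | P u) f u) = \sum_(u <- r | P u) TT (f u).
Proof.
have T0 : TT 0 = 0 by rewrite -{1}(subrr 0) TTD TTN subrr.
by rewrite (big_morph _ TTD T0).
Qed.
Lemma TT_Dv F : TT (Dv F) = Dv (TT F) - Dv F.
Proof.
rewrite {1}/Dv TT_sum -DvB; apply: eq_bigr => i _.
by rewrite TT_constM // TT_DD DDB.
Qed.
Lemma iter_DD_Dv k l F : iter l (DD k) (Dv F) = Dv (iter l (DD k) F).
Proof. by elim: l => //= l ->; rewrite DD_Dv. Qed.
End Directions.

(** * Thomas' operators modulo the ideal of the cone *)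

Section Ideal.
Variable N : A -> Prop.
Hypothesis N0 : N 0.
Hypothesis NB : forall F G, N F -> N G -> N (F - G).
Hypothesis NM : forall F G, N G -> N (F * G).
Hypothesis N_LL : N LL.
Hypothesis N_rot : forall i j F, N F -> N (rot i j F).
Hypothesis N_cancel : forall F, (forall k, N (xf k * F)) -> N F.
Hypothesis cardI : #|I| = (2 * pp + 4)%N.

Lemma NN F : N F -> N (- F). Proof. by move=> hF; rewrite -sub0r; apply: NB. Qed.
Lemma ND F G : N F -> N G -> N (F + G).
Proof. by move=> hF hG; rewrite -[G]opprK; apply: NB => //; apply: NN. Qed.
Lemma N_sum (J : Type) (r : seq J) (P : pred J) (f : J -> A) :
  (forall u, N (f u)) -> N (\sum_(u <- r | P u) f u).
Proof. by move=> H; elim/big_rec: _ => // u x _ hx; apply: ND. Qed.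

(** Multiplied by [xf k], the Euler field is a combination of rotations plus a multiple of [LL].
    [N_cancel], which expresses that the coordinates have no common zero, removes the factor
    again. *)
Lemma N_Eu F : N F -> N (Eu F).
Proof.
move=> hF; apply: N_cancel => k.
have -> : xf k * Eu F = der k F * LL + \sum_j xx j * rot k j F.
  rewrite /Eu /LL !mulr_sumr -big_split; apply: eq_bigr => j _ /=.
  by rewrite /rot; move: (xf k) (xx j) (der j F) (xf j) (der k F) => *; ring.
by apply: ND; [apply: NM | apply: N_sum => j; apply: NM; apply: N_rot].
Qed.

Lemma N_DD i F : N F -> N (DD i F).
Proof.
move=> hF; apply: N_cancel => k; rewrite xf_DD //.
apply: ND; last by rewrite mulrC; apply: NM.
apply: ND; last exact: N_rot.
apply: NB; last by apply/N_rot/N_Eu.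
apply: NB; last by apply/NM/N_Eu.
by apply/NN/N_sum => j; apply/NM/N_rot/N_rot.
Qed.

(** The two Laplacian terms cancel and [2%:R * rot k i (TT G)] remains. So for [G] of degree [- pp]
    on the cone, the covector of all [DD i G] is proportional there to the covector of all
    [xf i]. *)
Lemma rot_DD i k G : N (TT G) -> N (xf k * DD i G - xf i * DD k G).
Proof.
move=> hG; have -> : xf k * DD i G - xf i * DD k G = 2%:R * rot k i (TT G).
  by rewrite /DD /rot; move: (der i _) (der k _) (xf i) (xf k) (Lap G) => *; ring.
by apply/NM/N_rot.
Qed.

Lemma N_Dv a F : N F -> N (Dv a F).
Proof. by move=> hF; apply: N_sum => i; apply/NM/N_DD. Qed.

Lemma rot_Dv a k G : N (TT G) -> N (xf k * Dv a G - ax a * DD k G).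
Proof.
move=> hG.
have -> : xf k * Dv a G - ax a * DD k G = \sum_i a i * (xf k * DD i G - xf i * DD k G).
  rewrite /Dv /ax mulr_sumr mulr_suml -sumrB; apply: eq_bigr => i _.
  by move: (DD i G) (DD k G) (xf i) (xf k) (a i) => *; ring.
by apply: N_sum => i; apply/NM/rot_DD.
Qed.

Section Critical.
Variables (a : I -> A) (a_const : forall i j, der j (a i) = 0) (k : I) (F : A).
Hypothesis hF : N (Eu F).

(** Every operator lowers the degree by one, so after [r + l] of them [Eu] acts as [- (r + l)]
    modulo [N]. The critical order is the one at which this cancels the shift [pp]. *)
Lemma TT_weight r l : N (TT (iter l (DD k) (iter r (Dv a) F))
  - (pp%:R - (r + l)%:R) * iter l (DD k) (iter r (Dv a) F)).
Proof.
have E (T : A -> A) (q : A) G : (forall X Y, T (X - Y) = T X - T Y) ->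
    (forall m X, T (m%:R * X) = m%:R * T X) -> TT (T G) = T (TT G) - T G ->
    (forall X, N X -> N (T X)) -> forall m, q = pp%:R - m%:R ->
    N (TT G - q * G) -> N (TT (T G) - (pp%:R - m.+1%:R) * T G).
  move=> TB TM TTT TN m -> /TN; rewrite TB mulrBl TB !TM TTT => H.
  suff -> : T (TT G) - T G - (pp%:R - m.+1%:R) * T G =
     T (TT G) - (pp%:R * T G - m%:R * T G) by [].
  by rewrite [m.+1%:R]mulrS; move: (T _) (T G) (pp%:R : A) (m%:R : A) => *; ring.
elim: l => [|l IH] /=.
  elim: r => [|r IH] /=; first by rewrite /TT addn0 subr0 addrK.
  rewrite !addn0 in IH *; apply: (E (Dv a) _ _ _ _ _ _ r erefl IH).
  - exact: DvB.
  - move=> m X; rewrite /Dv mulr_sumr; apply: eq_bigr => i _.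
    by rewrite DD_natM mulrCA.
  - exact: TT_Dv.
  - exact: N_Dv.
rewrite addnS; apply: (E (DD k) _ _ _ _ _ _ (r + l)%N erefl IH).
- exact: DDB.
- by move=> m X; rewrite DD_natM.
- exact: TT_DD.
- exact: N_DD.
Qed.

Lemma critical_TT r l : (r + l)%N = pp -> N (TT (iter l (DD k) (iter r (Dv a) F))).
Proof. by move=> rl; have := TT_weight r l; rewrite rl subrr mul0r subr0. Qed.

(** Any [pp] of the [pp.+1] operators bring [F] to the critical degree, so the remaining one may be
    exchanged by [rot_Dv]. Since the operators commute, each factor [Dv a] can play the part of the
    last one, and all are exchanged in turn. *)
Lemma critical_step r l : (r + l)%N = pp.+1 ->
  N (xf k ^+ r * iter l (DD k) (iter r (Dv a) F) - ax a ^+ r * iter pp.+1 (DD k) F).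
Proof.
elim: r l => [|r IH] l; first by rewrite add0n => ->; rewrite subrr.
rewrite addSnnS => rl; have := IH l.+1 rl => {}IH.
have rl' : (r + l)%N = pp by move: rl; rewrite addnS => -[].
have := rot_Dv a k (critical_TT rl').
rewrite -iter_DD_Dv // => H.
have -> : xf k ^+ r.+1 * iter l (DD k) (iter r.+1 (Dv a) F)
    - ax a ^+ r.+1 * iter pp.+1 (DD k) F =
  xf k ^+ r * (xf k * iter l (DD k) (Dv a (iter r (Dv a) F)) -
     ax a * DD k (iter l (DD k) (iter r (Dv a) F)))
  + ax a * (xf k ^+ r * iter l.+1 (DD k) (iter r (Dv a) F)
            - ax a ^+ r * iter pp.+1 (DD k) F).
  rewrite !exprS [iter r.+1 _ _]iterS [iter l.+1 _ _]iterS.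
  move: (iter l (DD k) (Dv a _)) (DD k (iter l _ _)) (iter pp.+1 _ _) => u v w.
  by move: (xf k) (ax a) (xf k ^+ r) (ax a ^+ r) => *; ring.
by apply: ND; apply: NM.
Qed.

Lemma critical_power : N (xf k ^+ pp.+1 * iter pp.+1 (Dv a) F
   - ax a ^+ pp.+1 * iter pp.+1 (DD k) F).
Proof. by have := @critical_step pp.+1 0 (addn0 _). Qed.
End Critical.

Variable Q : A.
Hypothesis hQ : Q * \sum_k xf k ^+ (pp.+1 + pp.+1) = 1.

(* On the cone DD k ^ n F = xf k ^ n * P F; weighting with xf k ^ n recovers P F without dividing by a coordinate. *)
Definition PP F : A := Q * \sum_k xf k ^+ pp.+1 * iter pp.+1 (DD k) F.

Lemma PP_Dv a F : (forall i j, der j (a i) = 0) -> N (Eu F) ->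
  N (iter pp.+1 (Dv a) F - ax a ^+ pp.+1 * PP F).
Proof.
move=> ha hF.
have -> : iter pp.+1 (Dv a) F - ax a ^+ pp.+1 * PP F =
  Q * \sum_k xf k ^+ pp.+1 * (xf k ^+ pp.+1 * iter pp.+1 (Dv a) F
   - ax a ^+ pp.+1 * iter pp.+1 (DD k) F).
  rewrite -[X in X - _]mul1r -hQ -mulrA mulr_suml /PP mulrCA -mulrBr; congr (Q * _).
  rewrite mulr_sumr -sumrB; apply: eq_bigr => k _; rewrite exprD.
  by move: (iter _ _ _) (iter _ _ _) (xf k ^+ _) (ax a ^+ _) => *; ring.
by apply/NM/N_sum => k; apply/NM/critical_power.
Qed.

(** * Naturality under linear similitudes *)

Section Similarity.
Variables (phi : A -> A) (al : I -> I -> A) (c : A).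
Hypothesis phiD : forall F G, phi (F + G) = phi F + phi G.
Hypothesis phiM : forall F G, phi (F * G) = phi F * phi G.
Hypothesis phi1 : phi 1 = 1.
Hypothesis al_const : forall i j k, der i (al j k) = 0.
Hypothesis phi_al : forall j k, phi (al j k) = al j k.
Hypothesis phi_ee : forall i, phi (ee i) = ee i.
Hypothesis phi_xx : forall k, phi (xx k) = \sum_j al j k * xx j.
Hypothesis der_phi : forall j F, der j (phi F) = \sum_k al j k * phi (der k F).
Hypothesis al_col : forall k l, \sum_j ee j * (al j k * al j l) = c * ee k * (k == l)%:R.
Hypothesis al_row : forall j l, \sum_k ee k * (al j k * al l k) = c * ee j * (j == l)%:R.
Hypothesis N_phi : forall F, N F -> N (phi F).

Lemma phi0 : phi 0 = 0.
Proof. by apply: (addrI (phi 0)); rewrite -phiD !addr0. Qed.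
Lemma phiN F : phi (- F) = - phi F.
Proof. by apply/eqP; rewrite -addr_eq0 -phiD addNr phi0. Qed.
Lemma phi_sum (J : Type) (r : seq J) (P : pred J) (f : J -> A) :
  phi (\sum_(u <- r | P u) f u) = \sum_(u <- r | P u) phi (f u).
Proof. by rewrite (big_morph _ phiD phi0). Qed.
Lemma phi_nat m : phi m%:R = m%:R.
Proof. by elim: m => [|m IH]; rewrite ?phi0 // mulrS phiD phi1 IH. Qed.
Lemma phiX F m : phi (F ^+ m) = phi F ^+ m.
Proof. by elim: m => [|m IH]; rewrite ?phi1 // !exprS phiM IH. Qed.

Lemma Eu_phi F : Eu (phi F) = phi (Eu F).
Proof.
rewrite /Eu phi_sum; under eq_bigr do rewrite der_phi mulr_sumr.
rewrite exchange_big /=; apply: eq_bigr => k _.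
rewrite phiM phi_xx mulr_suml; apply: eq_bigr => j _.
by rewrite mulrA [xx j * _]mulrC.
Qed.

Lemma TT_phi F : TT (phi F) = phi (TT F).
Proof. by rewrite /TT Eu_phi phiD phiM phi_nat. Qed.

Lemma Lap_phi F : Lap (phi F) = c * phi (Lap F).
Proof.
rewrite /Lap.
have E j : ee j * der j (der j (phi F)) =
    \sum_k \sum_l ee j * (al j k * al j l) * phi (der l (der k F)).
  rewrite der_phi der_sum mulr_sumr; apply: eq_bigr => k _.
  rewrite der_constM // der_phi !mulr_sumr; apply: eq_bigr => l _.
  by rewrite !mulrA.
under eq_bigr do rewrite E.
rewrite exchange_big phi_sum mulr_sumr /=; apply: eq_bigr => k _.
rewrite exchange_big /=.
under eq_bigr do rewrite -mulr_suml al_col.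
rewrite phiM phi_ee.
rewrite -[phi (der k (der k F))](sum_delta' k (fun l => phi (der l (der k F)))).
rewrite !mulr_sumr; apply: eq_bigr => l _.
by rewrite !mulrA.
Qed.

Lemma al_xf j : \sum_k al j k * phi (xf k) = c * xf j.
Proof.
rewrite /xf; transitivity (\sum_l (\sum_k ee k * (al j k * al l k)) * xx l).
  under [RHS]eq_bigr do rewrite mulr_suml.
  rewrite exchange_big /=; apply: eq_bigr => k _.
  rewrite phiM phi_ee phi_xx !mulr_sumr; apply: eq_bigr => l _.
  by move: (ee k) (al j k) (al l k) (xx l) => *; ring.
under eq_bigr do rewrite al_row -mulrA.
by rewrite -mulr_sumr sum_delta' mulrA.
Qed.

(** The factor [c] of the Laplacian is absorbed by [al_xf], so [DD] transforms like the covector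
    [der], without a factor. *)
Lemma DD_phi j F : DD j (phi F) = \sum_k al j k * phi (DD k F).
Proof.
rewrite /DD Lap_phi TT_phi der_phi mulrA [xf j * c]mulrC -al_xf mulr_suml mulr_sumr.
rewrite -sumrB; apply: eq_bigr => k _.
rewrite phiD phiN !phiM phi_nat.
by move: (phi (der k _)) (phi (xf k)) (phi (Lap F)) (al j k) => *; ring.
Qed.

Section PhiDirections.
Variable a : I -> A.
Hypothesis a_const : forall i j, der j (a i) = 0.
Hypothesis phi_a : forall i, phi (a i) = a i.
Let a' k := \sum_j a j * al j k.

Let phi_a' k : phi (a' k) = a' k.
Proof.
rewrite /a' phi_sum; apply: eq_bigr => j _.
by rewrite phiM phi_a phi_al.
Qed.
Let a'_const i j : der j (a' i) = 0.
Proof. by rewrite /a' der_sum big1 // => l _; rewrite derM a_const al_const mul0r mulr0 addr0. Qed.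

Lemma Dv_phi F : Dv a (phi F) = phi (Dv a' F).
Proof.
rewrite /Dv phi_sum; under eq_bigr do rewrite DD_phi mulr_sumr.
rewrite exchange_big /=; apply: eq_bigr => k _.
rewrite phiM phi_a' mulr_suml; apply: eq_bigr => j _.
by rewrite mulrA.
Qed.

Lemma ax_phi : phi (ax a') = c * ax a.
Proof.
rewrite /ax phi_sum mulr_sumr.
transitivity (\sum_j a j * (\sum_k al j k * phi (xf k))).
  under [RHS]eq_bigr do rewrite mulr_sumr.
  rewrite exchange_big /=; apply: eq_bigr => k _.
  rewrite phiM phi_a' mulr_suml; apply: eq_bigr => j _.
  by rewrite mulrA.
by apply: eq_bigr => j _; rewrite al_xf mulrCA.
Qed.

(** In [PP_Dv] the left side is transported without a factor, while [ax] acquires [c]; comparing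
    both sides produces [c ^+ pp.+1]. A power of [ax] is left over, which [PP_phi] removes by taking
    the unit vectors as directions. *)
Lemma PP_phi_dir F : N (Eu F) ->
  N (ax a ^+ pp.+1 * (PP (phi F) - c ^+ pp.+1 * phi (PP F))).
Proof.
move=> hF.
have h1 := PP_Dv a'_const hF.
have h2 : N (Eu (phi F)) by rewrite Eu_phi; apply: N_phi.
have h3 := PP_Dv a_const h2.
have h4 := N_phi h1; rewrite phiD phiN phiM phiX ax_phi in h4.
have E m : iter m (Dv a) (phi F) = phi (iter m (Dv a') F).
  by elim: m => //= m ->; rewrite Dv_phi.
rewrite E in h3; have := NB h4 h3.
rewrite exprMn; move: (phi (iter _ _ _)) (ax a ^+ _) (c ^+ _) (PP (phi F)) (phi (PP F)).
move=> u v w x y; suff -> : u - w * v * y - (u - v * x) = v * (x - w * y) by [].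
by ring.
Qed.
End PhiDirections.

Lemma PP_phi F : N (Eu F) -> N (PP (phi F) - c ^+ pp.+1 * phi (PP F)).
Proof.
move=> hF; set G := _ - _; rewrite -[G]mul1r -hQ -mulrA mulr_suml.
apply/NM/N_sum => k; rewrite exprD -mulrA; apply: NM.
have := @PP_phi_dir (fun i => (i == k)%:R) _ _ F hF; rewrite /ax sum_delta; apply.
  by move=> i j; rewrite -[_%:R]mulr1 der_natM der_one mulr0.
by move=> i; rewrite phi_nat.
Qed.
End Similarity.
End Ideal.
End ThomasOperator.

(** * The invariant operator *)

Section ConcreteOperator.
Variables (R : realType) (n : nat).
Hypothesis n_gt0 : (0 < n)%N.
Local Notation V := 'rV[R]_(rdim n).
Local Notation I := 'I_(rdim n).
Local Notation C := R[i].
Local Notation Re := (@complex.Re R).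
Local Notation cinf := (cinf R n).
Local Notation cst := (@scst R n).
Local Notation coord := (@scoord R n).
Local Notation inN := (@inN R n).
Local Notation eps := (@eps R n).
Local Notation Lq := (@Lq R n).
Local Notation d_ := (@der R n).
Implicit Types (F G : cinf) (x : V) (i j k : I).
Local Opaque der scst scoord sadd smul sopp mkS.

Definition sgn i : cinf := cst (eps i)%:C%C.
Local Notation EU := (Eu d_ coord).
Local Notation DC := (DD n.-1 d_ coord sgn).

Lemma inN0 : inN 0. Proof. by move=> x _ _; rewrite sE_0. Qed.
Lemma inNB F G : inN F -> inN G -> inN (F - G).
Proof. by move=> hF hG x x0 Lx; rewrite sE_D sE_N hF // hG // subr0. Qed.
Lemma inNM F G : inN G -> inN (F * G).
Proof. by move=> hG x x0 Lx; rewrite sE_M hG // mulr0. Qed.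

Lemma sgn_sq i : sgn i * sgn i = 1.
Proof. by rewrite -rmorphM -rmorphM eps_sq !rmorph1. Qed.
Lemma d_sgn i j : d_ i (sgn j) = 0. Proof. exact: der_cst. Qed.
Lemma d_B i F G : d_ i (F - G) = d_ i F - d_ i G. Proof. exact: raddfB. Qed.

Lemma xfE i x : x != 0 -> xf coord sgn i x = (eps i * x 0 i)%:C%C.
Proof. by move=> x0; rewrite /xf sE_M sE_cst // sE_coord rmorphM. Qed.

Lemma xfME k F x : x != 0 -> (xf coord sgn k * F) x = (eps k * x 0 k)%:C%C * F x.
Proof. by move=> x0; rewrite (sE_M (xf coord sgn k) F) xfE. Qed.

Lemma inN_LL : inN (LL coord sgn).
Proof.
move=> x x0 Lx; rewrite /LL sE_sum.
transitivity ((Lq x)%:C%C : C); last by rewrite Lx.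
rewrite /Lq rmorph_sum; apply: eq_bigr => i _ /=.
by rewrite xfME // sE_coord -rmorphM -mulrA expr2.
Qed.

Lemma inN_rot i j F : inN F -> inN (rot d_ coord sgn i j F).
Proof.
move=> hF x x0 Lx; rewrite /rot sE_D.
rewrite (sE_N (xf coord sgn j * d_ i F)).
rewrite (xfME i (d_ j F) x0) (xfME j (d_ i F) x0).
by apply/eqP; rewrite subr_eq0; apply/eqP; apply: tangent.
Qed.

Lemma nonzero_coord x : x != 0 -> exists k, x 0 k != 0.
Proof.
move=> x0; apply/existsP; apply: contraNT x0; rewrite negb_exists => /forallP H.
by apply/eqP/rowP => k; rewrite mxE; have := H k; rewrite negbK => /eqP.
Qed.

Lemma eps_neq0 i : eps i != 0.
Proof. by apply/eqP => e0; have := eps_sq R i; rewrite e0 mulr0 => /eqP; rewrite eq_sym oner_eq0. Qed.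

Lemma inN_cancel F : (forall k, inN (xf coord sgn k * F)) -> inN F.
Proof.
move=> H x x0 Lx; have [k xk] := nonzero_coord x0.
have /eqP := H k x x0 Lx; rewrite xfME // mulf_eq0 => /orP[|/eqP//].
by rewrite -(rmorph0 (real_complex R)) (inj_eq (@complexI R)) mulf_eq0 (negbTE (eps_neq0 k)) (negbTE xk).
Qed.

Lemma cardI_rdim : #|I| = (2 * n.-1 + 4)%N.
Proof. by rewrite card_ord rdimE. Qed.

(** The exponent is even, so all summands are nonnegative real numbers and the sum is positive away
    from the origin. *)
Definition norm2n : cinf := \sum_k xf coord sgn k ^+ (n.-1.+1 + n.-1.+1).

Lemma norm2n_neq0 x : x != 0 -> norm2n x != 0.
Proof.
move=> x0; rewrite /norm2n sE_sum.
have -> : \sum_k (xf coord sgn k ^+ (n.-1.+1 + n.-1.+1)) x =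
    (\sum_k ((x 0 k) ^+ 2) ^+ n.-1.+1)%:C%C.
  rewrite rmorph_sum; apply: eq_bigr => k _ /=.
  rewrite sE_X // xfE // -rmorphXn addnn -mul2n exprM (exprMn 2).
  by rewrite -[eps k ^+ 2]/(eps k * eps k) eps_sq mul1r.
rewrite -(rmorph0 (real_complex R)) (inj_eq (@complexI R)).
have [k xk] := nonzero_coord x0.
rewrite gt_eqF // (bigD1 k) //= ltr_pwDl //.
  by rewrite exprn_gt0 // exprn_even_gt0.
by apply: sumr_ge0 => j _; rewrite exprn_ge0 // sqr_ge0.
Qed.

Definition Qinv : cinf := sval (cid (sfun_inv norm2n_neq0)).
Lemma QinvE : Qinv * norm2n = 1.
Proof. by rewrite mulrC /Qinv; case: cid. Qed.

Definition PC F : cinf := PP n.-1 d_ coord sgn Qinv F.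

Lemma inN_DC i F : inN F -> inN (DC i F).
Proof.
exact: (@N_DD cinf I n.-1 d_ coord sgn d_B (@derM R n) (@derC R n) (@der_coord R n) d_sgn sgn_sq
  inN inN0 inNB inNM inN_LL inN_rot inN_cancel cardI_rdim i F).
Qed.

Lemma DCB i F G : DC i (F - G) = DC i F - DC i G.
Proof. exact: (@DDB cinf I n.-1 d_ coord sgn d_B i F G). Qed.

Lemma PCB F G : PC (F - G) = PC F - PC G.
Proof.
rewrite /PC /PP -mulrBr -sumrB; congr (_ * _); apply: eq_bigr => k _.
rewrite -mulrBr; congr (_ * _).
by elim: n.-1.+1 => //= m ->; rewrite DCB.
Qed.

Lemma inN_PC F : inN F -> inN (PC F).
Proof.
move=> hF; apply: inNM.
apply: (N_sum inN0 inNB) => k; apply: inNM.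
by elim: n.-1.+1 => //= m; apply: inN_DC.
Qed.

Lemma PC_congr F G : inN (F - G) -> inN (PC F - PC G).
Proof. by rewrite -PCB; apply: inN_PC. Qed.

Section Pull.
Variable A : 'M[R]_(rdim n).

Definition lin k : cinf := \sum_j cst (A j k)%:C%C * coord j.
Definition pull F : cinf := scomp lin F.

Lemma linE k x : x != 0 -> lin k x = ((x *m A) 0 k)%:C%C.
Proof.
move=> x0; rewrite /lin sE_sum mxE rmorph_sum; apply: eq_bigr => j _ /=.
by rewrite sE_M sE_cst // sE_coord -rmorphM mulrC.
Qed.

Lemma lin_ok : A \in unitmx -> comp_ok lin.
Proof.
move=> uA; have L x : x != 0 -> \row_k Re (lin k x) = x *m A.
  by move=> x0; apply/rowP => k; rewrite mxE linE.
split=> [k x|x x0].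
  by have [->|x0] := eqVneq x 0; rewrite ?sfun_at0 // linE.
rewrite L //; apply: contra_neq x0 => H.
by rewrite -[x](mulmxK uA) H mul0mx.
Qed.

Lemma pullE F x : A \in unitmx -> x != 0 -> pull F x = F (x *m A).
Proof.
move=> uA x0; rewrite /pull sE_comp //; last exact: lin_ok.
by congr (F _); apply/rowP => k; rewrite mxE linE.
Qed.

Lemma der_pull j F : A \in unitmx ->
  d_ j (pull F) = \sum_k cst (A j k)%:C%C * pull (d_ k F).
Proof.
move=> uA; rewrite /pull der_comp; last exact: lin_ok.
apply: eq_bigr => k _; congr (_ * _).
rewrite /lin raddf_sum (bigD1 j) //= der_cstM der_coord eqxx mulr1 big1 ?addr0 // => i ij.
by rewrite der_cstM der_coord eq_sym (negbTE ij) mulr0.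
Qed.
End Pull.

Definition Gm : 'M[R]_(rdim n) := diag_mx (\row_i eps i).
Definition similitude (A : 'M[R]_(rdim n)) (c : R) :=
  c != 0 /\ A *m Gm *m A^T = c *: Gm.

Lemma Gm_sq : Gm *m Gm = 1%:M.
Proof.
by rewrite /Gm mulmx_diag; apply/matrixP => i j; rewrite !mxE eps_sq.
Qed.

Lemma similitude_inv A c : similitude A c -> A *m (c^-1 *: (Gm *m A^T *m Gm)) = 1%:M.
Proof.
move=> [c0 E]; rewrite -scalemxAr !mulmxA E -scalemxAl Gm_sq scalerA mulVf //.
by rewrite scale1r.
Qed.

Lemma similitude_unit A c : similitude A c -> A \in unitmx.
Proof. by move=> /similitude_inv /mulmx1_unit[]. Qed.

(** A right inverse of a square matrix is a left inverse. [PC_pull] uses the relation between the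
    rows for the transport of [xf], and this one between the columns for the Laplacian. *)
Lemma similitude_tr A c : similitude A c -> A^T *m Gm *m A = c *: Gm.
Proof.
move=> sA; have [c0 _] := sA; have /mulmx1C := similitude_inv sA.
rewrite -scalemxAl => E.
have := congr1 (fun M => c *: (Gm *m M)) E.
rewrite mulmx1 -scalemxAr scalerA mulfV // scale1r.
by rewrite !mulmxA Gm_sq mul1mx.
Qed.

Lemma Lq_mx x : x *m Gm *m x^T = (Lq x)%:M.
Proof.
apply/matrixP => i j; rewrite !ord1 !mxE eqxx mulr1n /Lq; apply: eq_bigr => k _.
by rewrite /Gm mul_mx_diag !mxE expr2 mulrCA mulrA.
Qed.

Lemma Lq_similitude A c x : similitude A c -> Lq (x *m A) = c * Lq x.
Proof.
move=> [_ E]; have : (Lq (x *m A))%:M = (c * Lq x)%:M :> 'M[R]_(1).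
  rewrite -Lq_mx trmx_mul !mulmxA -(mulmxA x) -(mulmxA x) E -scalemxAr -scalemxAl.
  by rewrite Lq_mx scale_scalar_mx.
by move=> /matrixP/(_ 0 0); rewrite !mxE eqxx !mulr1n.
Qed.

Lemma Gm_entry (M : 'M[R]_(rdim n)) j l : (M *m Gm *m M^T) j l = \sum_k eps k * (M j k * M l k).
Proof.
rewrite mxE; apply: eq_bigr => k _.
by rewrite /Gm mul_mx_diag !mxE; ring.
Qed.

Lemma GmE j l : Gm j l = eps j * (j == l)%:R.
Proof. by rewrite !mxE mulr_natr. Qed.

Lemma PC_pull A c F : similitude A c -> inN (EU F) ->
  inN (PC (pull A F) - cst c%:C%C ^+ n * pull A (PC F)).
Proof.
move=> sA hF; have uA := similitude_unit sA; have ok := lin_ok uA.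
have [c0 E] := sA; have E' := similitude_tr sA.
have cstS (f : I -> R) : \sum_k cst (f k)%:C%C = cst (\sum_k f k)%:C%C :> cinf.
  by rewrite -rmorph_sum -rmorph_sum.
rewrite -[n in _ ^+ n](prednK n_gt0).
apply: (@PP_phi cinf I n.-1 d_ coord sgn d_B (@derM R n) (@derC R n) (@der_coord R n)
  d_sgn sgn_sq inN inN0 inNB inNM inN_LL inN_rot inN_cancel cardI_rdim Qinv QinvE
  (pull A) (fun j k => cst (A j k)%:C%C)).
- exact: scompD.
- exact: scompM.
- exact: scomp1.
- by move=> *; apply: der_cst.
- by move=> *; apply: scomp_cst.
- by move=> *; apply: scomp_cst.
- by move=> k; apply: scomp_coord.
- by move=> j G; apply: der_pull.
- move=> k l; transitivity (cst ((c *: Gm) k l)%:C%C).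
    rewrite -E' -[A in _ *m A](trmxK A) Gm_entry -cstS; apply: eq_bigr => j _.
    by rewrite !mxE /sgn -!rmorphM.
  rewrite mxE GmE /sgn !rmorphM mulrA; congr (_ * _).
  by case: (k == l); rewrite ?rmorph0 ?rmorph1.
- move=> j l; transitivity (cst ((c *: Gm) j l)%:C%C).
    rewrite -E Gm_entry -cstS; apply: eq_bigr => k _.
    by rewrite /sgn -!rmorphM.
  rewrite mxE GmE /sgn !rmorphM mulrA; congr (_ * _).
  by case: (j == l); rewrite ?rmorph0 ?rmorph1.
- move=> G hG x x0 Lx; rewrite pullE // hG //.
    by apply: contra_neq x0 => H; rewrite -[x](mulmxK uA) H mul0mx.
  by rewrite (Lq_similitude _ sA) Lx mulr0.
- exact: hF.
Qed.

Lemma PC_Dv (a : I -> C) F : inN (EU F) ->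
  inN (iter n (Dv n.-1 d_ coord sgn (fun i => cst (a i))) F
       - ax coord sgn (fun i => cst (a i)) ^+ n * PC F).
Proof.
move=> hF; rewrite -[n in iter n _ _](prednK n_gt0) -[n in _ ^+ n](prednK n_gt0).
apply: (@PP_Dv cinf I n.-1 d_ coord sgn d_B (@derM R n) (@derC R n) (@der_coord R n)
  d_sgn sgn_sq inN inN0 inNB inNM inN_LL inN_rot inN_cancel cardI_rdim Qinv QinvE) => //.
by move=> *; apply: der_cst.
Qed.

Definition diff_operator (T : cinf -> cinf) :=
  exists L : seq (seq I * cinf), forall F, T F = \sum_(p <- L) p.2 * derw p.1 F.

Lemma do_id : diff_operator id.
Proof. by exists [:: ([::], 1)] => F; rewrite big_seq1 mul1r. Qed.
Lemma do_add T U : diff_operator T -> diff_operator U -> diff_operator (fun F => T F + U F).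
Proof. by move=> [L hL] [K hK]; exists (L ++ K) => F; rewrite big_cat hL hK. Qed.
Lemma do_mul G T : diff_operator T -> diff_operator (fun F => G * T F).
Proof.
move=> [L hL]; exists [seq (p.1, G * p.2) | p <- L] => F.
by rewrite hL mulr_sumr big_map; apply: eq_bigr => p _; rewrite mulrA.
Qed.
Lemma do_der j T : diff_operator T -> diff_operator (fun F => d_ j (T F)).
Proof.
move=> [L hL]; exists ([seq (p.1, d_ j p.2) | p <- L] ++ [seq (j :: p.1, p.2) | p <- L]) => F.
rewrite hL raddf_sum big_cat /= !big_map -big_split /=; apply: eq_bigr => p _.
exact: derM.
Qed.
Lemma do_sum (J : Type) (r : seq J) (T : J -> cinf -> cinf) :
  (forall u, diff_operator (T u)) -> diff_operator (fun F => \sum_(u <- r) T u F).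
Proof.
move=> hT; elim: r => [|u r [L hL]].
  by exists [::] => F; rewrite !big_nil.
have [K hK] := hT u; exists (K ++ L) => F.
by rewrite big_cons big_cat hK hL.
Qed.
Lemma do_ext T U : (forall F, T F = U F) -> diff_operator T -> diff_operator U.
Proof. by move=> TU [L hL]; exists L => F; rewrite -TU. Qed.

Lemma do_DC i T : diff_operator T -> diff_operator (fun F => DC i (T F)).
Proof.
move=> hT.
have hE U : diff_operator U -> diff_operator (fun F => TT n.-1 d_ coord (U F)).
  move=> hU; apply: do_add; last exact: do_mul.
  by apply: do_sum => k; apply/do_mul/do_der.
apply: (@do_ext (fun F => 2%:R * d_ i (TT n.-1 d_ coord (T F))
   + (- xf coord sgn i) * \sum_k sgn k * d_ k (d_ k (T F)))).
  by move=> F; rewrite mulNr.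
apply: do_add; first by apply/do_mul/do_der/hE.
by apply/do_mul/do_sum => k; apply/do_mul/do_der/do_der.
Qed.

Lemma do_PC : diff_operator PC.
Proof.
apply/do_mul/do_sum => k; apply: do_mul.
by elim: n.-1.+1 => [|m IH] /=; [exact: do_id | exact: do_DC].
Qed.
End ConcreteOperator.

(** * The operator on functions on the cone and its invariance *)

Section Existence.
Variables (R : realType) (n : nat).
Hypothesis n_gt0 : (0 < n)%N.
Local Opaque der scst scoord sadd smul sopp mkS PC.
Local Notation V := 'rV[R]_(rdim n).
Local Notation I := 'I_(rdim n).
Local Notation C := R[i].
Local Notation Re := (@complex.Re R).
Local Notation Im := (@complex.Im R).
Local Notation cinf := (cinf R n).
Local Notation cst := (@scst R n).
Local Notation coord := (@scoord R n).
Local Notation inN := (@inN R n).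
Local Notation eps := (@eps R n).
Local Notation Lq := (@Lq R n).
Local Notation d_ := (@der R n).
Local Notation EU := (Eu d_ coord).
Local Notation pt := (pt R n).
Local Notation PC := (@PC R n).
Implicit Types (F G : cinf) (x : V) (i j k : I) (z : pt) (f : pt -> R).

Lemma realify_l z (k : 'I_n.+1) : realify z 0 (lshift _ k) = Re (z 0 k).
Proof. by rewrite /realify row_mxEl mxE. Qed.
Lemma realify_r z (k : 'I_n.+1) : realify z 0 (rshift _ k) = Im (z 0 k).
Proof. by rewrite /realify row_mxEr mxE. Qed.

Definition cplx x : pt := \row_k (x 0 (lshift _ k) +i* x 0 (rshift _ k))%C.
Lemma cplxK x : realify (cplx x) = x.
Proof.
apply/rowP => i; case: (split_ordP i) => k ->.
  by rewrite realify_l mxE.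
by rewrite realify_r mxE.
Qed.
Lemma realifyK z : cplx (realify z) = z.
Proof. by apply/rowP => k; rewrite mxE realify_l realify_r; case: (z 0 k). Qed.
Lemma realify0 : realify (0 : pt) = 0.
Proof. by rewrite -[RHS]cplxK; congr realify; apply/rowP => k; rewrite !mxE. Qed.
Lemma realify_eq0 z : (realify z == 0) = (z == 0).
Proof. by rewrite -realify0 (inj_eq (can_inj realifyK)). Qed.

Lemma eps_l (k : 'I_n.+1) : eps (lshift _ k) = if k == ord0 then 1 else -1.
Proof. by rewrite /eps eq_lshift eq_lrshift orbF. Qed.
Lemma eps_r (k : 'I_n.+1) : eps (rshift _ k) = if k == ord0 then 1 else -1.
Proof. by rewrite /eps eq_rlshift eq_rshift. Qed.

Lemma Lform_Lq z : Lform z = Lq (realify z).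
Proof.
rewrite /Lform /Lq big_split_ord /= -big_split /= [RHS](bigD1 ord0) //= -sumrN.
congr (_ + _).
  by rewrite realify_l realify_r eps_l eps_r eqxx !mul1r.
apply: eq_bigr => k /negbTE k0.
by rewrite realify_l realify_r eps_l eps_r k0 !mulN1r opprD.
Qed.

Lemma realify_scale (t : R) z : realify (t%:C%C *: z) = t *: realify z.
Proof.
apply/rowP => i; rewrite [RHS]mxE; case: (split_ordP i) => k ->.
  by rewrite !realify_l mxE cReM /= mul0r subr0.
by rewrite !realify_r mxE cImM /= mul0r addr0.
Qed.

Lemma nullconeP z : nullcone z <-> realify z != 0 /\ Lq (realify z) = 0.
Proof. by rewrite /nullcone Lform_Lq -realify_eq0. Qed.

Lemma inNP F : inN F <-> forall z, nullcone z -> F (realify z) = 0.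
Proof.
split=> [H z /nullconeP[z0 Lz]|H x x0 Lx]; first exact: H.
by rewrite -(cplxK x); apply: H; apply/nullconeP; rewrite cplxK.
Qed.

(** Row vectors are multiplied on the right, which explains the transposes: [realify] turns [act h]
    into multiplication by this matrix. *)
Definition rmx (h : 'M[C]_n.+1) : 'M[R]_(rdim n) :=
  block_mx (map_mx Re h^T) (map_mx Im h^T) (- map_mx Im h^T) (map_mx Re h^T).

Lemma realify_act h z : realify (act h z) = realify z *m rmx h.
Proof.
rewrite /realify /rmx mul_row_block; congr row_mx; apply/rowP => k; rewrite !mxE.
  rewrite (big_morph Re (@cReD R) (erefl : Re 0 = 0)) -big_split /=.
  by apply: eq_bigr => j _; rewrite !mxE cReM mulrN.
rewrite (big_morph Im (@cImD R) (erefl : Im 0 = 0)) -big_split /=.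
by apply: eq_bigr => j _; rewrite !mxE cImM.
Qed.

Lemma sym_form_eq0 (d : nat) (M : 'M[R]_d) : M^T = M ->
  (forall x : 'rV_d, x *m M *m x^T = 0) -> M = 0.
Proof.
move=> sM H; apply/matrixP => i j.
have E (u v : 'I_d) : (delta_mx (0 : 'I_1) u *m M *m (delta_mx (0 : 'I_1) v)^T) 0 0 = M u v.
  by rewrite trmx_delta -rowE -colE !mxE.
have D u : M u u = 0 by rewrite -E H mxE.
have X (a b : 'rV[R]_d) : (a + b) *m M *m (a + b)^T =
    a *m M *m a^T + a *m M *m b^T + (b *m M *m a^T + b *m M *m b^T).
  by rewrite linearD /= !mulmxDl !mulmxDr addrACA.
have := congr1 (fun K : 'M[R]_1 => K 0 0) (X (delta_mx 0 i) (delta_mx 0 j)).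
rewrite H [in LHS]mxE [in RHS]mxE [X in X + _]mxE [X in _ + X]mxE !E !D.
have -> : M j i = M i j by rewrite -[in LHS]sM mxE.
by rewrite mxE add0r addr0 => h; lra.
Qed.

Lemma similitude_act (h : 'M[C]_n.+1) (c : R) : c != 0 ->
  (forall z, Lform (act h z) = c * Lform z) -> similitude (rmx h) c.
Proof.
move=> c0 H; split=> //; apply/eqP; rewrite -subr_eq0; apply/eqP.
have GmT : (Gm R n)^T = Gm R n by rewrite /Gm tr_diag_mx.
apply: sym_form_eq0.
  by rewrite linearB /= linearZ /= !trmx_mul trmxK GmT mulmxA.
move=> x; rewrite mulmxBr mulmxBl -scalemxAr -scalemxAl Lq_mx.
have -> : x *m (rmx h *m Gm R n *m (rmx h)^T) *m x^T = (Lq (x *m rmx h))%:M.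
  by rewrite -Lq_mx trmx_mul !mulmxA.
rewrite -{1}(cplxK x) -realify_act -Lform_Lq H Lform_Lq cplxK.
by rewrite scale_scalar_mx subrr.
Qed.

Lemma nullcone_act h c z : c != 0 -> (forall w, Lform (act h w) = c * Lform w) ->
  nullcone z -> nullcone (act h z).
Proof.
move=> c0 H /nullconeP[z0 Lz]; have sA := similitude_act c0 H.
have uA := similitude_unit sA.
apply/nullconeP; rewrite realify_act; split; last by rewrite (Lq_similitude _ sA) Lz mulr0.
by apply: contra_neq z0 => E; rewrite -[realify z](mulmxK uA) E mul0mx.
Qed.

Lemma act_scalar (l : C) z : act l%:M z = l *: z.
Proof. by rewrite /act tr_scalar_mx mul_mx_scalar. Qed.

Lemma normsq_eq0 (l : C) : (normsq l == 0) = (l == 0).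
Proof.
rewrite /normsq paddr_eq0 ?sqr_ge0 // !sqrf_eq0.
by case: l => a b; rewrite eq_complex.
Qed.

Lemma normsqM (l m : C) : normsq (l * m) = normsq l * normsq m.
Proof. by rewrite /normsq cReM cImM; ring. Qed.

Lemma Lform_scale (l : C) z : Lform (l *: z) = normsq l * Lform z.
Proof.
rewrite /Lform mulrBr mulr_sumr mxE normsqM; congr (_ - _).
by apply: eq_bigr => k _; rewrite mxE normsqM.
Qed.

Definition isext f F := forall z, nullcone z -> F (realify z) = (f z)%:C%C.
Definition cinv F := forall z (l : C), nullcone z -> l != 0 ->
  F (realify (l *: z)) = F (realify z).

Section OfReal.
Variables (F : V -> R) (sF : smooth0 F).
Fact csmooth_ofR : csmooth (fun x => (F x)%:C%C).
Proof. by split; [exact: sF | exact: smooth0_cst]. Qed.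
Definition ofR : cinf := mkS csmooth_ofR.
Lemma ofRE x : x != 0 -> ofR x = (F x)%:C%C.
Proof. exact: mkSE. Qed.
End OfReal.

Lemma isext_ofR f (F : V -> R) (sF : smooth0 F) :
  (forall z, nullcone z -> f z = F (realify z)) -> isext f (ofR sF).
Proof. by move=> H z hz; have [z0 _] := (nullconeP z).1 hz; rewrite ofRE // H. Qed.

Lemma Ep_ext p f : Ep p f -> exists F, isext f F.
Proof. by move=> [[F [sF H]] _]; exists (ofR sF); apply: isext_ofR. Qed.

Lemma isext_inN f F G : isext f F -> isext f G -> inN (F - G).
Proof. by move=> hF hG; apply/inNP => z hz; rewrite sE_D sE_N hF // hG // subrr. Qed.

Lemma cinv_Ep f F : isext f F -> Ep 0 f -> cinv F.
Proof.
move=> hF [_ H] z l hz l0; have hlz : nullcone (l *: z).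
  split; last by rewrite Lform_scale hz.2 mulr0.
  by rewrite scaler_eq0 negb_or l0 hz.1.
by rewrite !hF // H // expr0z mul1r.
Qed.

Lemma cinv_Eu F : cinv F -> inN (EU F).
Proof.
move=> cF x x0 Lx.
have [h1 h2] := sfun_csmooth F.
have key (t : R) : F (x + t *: x + t ^+ 2 *: x) = F x.
  (* The factor [1 + t + t ^+ 2] has derivative 1 at [t = 0] and, unlike [1 + t], no real zero, so
     homogeneity applies along the entire curve. *)
  have q0 : 1 + t + t ^+ 2 != 0 by rewrite gt_eqF //; nra.
  have -> : x + t *: x + t ^+ 2 *: x = (1 + t + t ^+ 2) *: x.
    by rewrite !scalerDl scale1r.
  have := cF (cplx x) (1 + t + t ^+ 2)%:C%C; rewrite cplxK => <- //.
  - by rewrite realify_scale cplxK.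
  - by apply/nullconeP; rewrite cplxK.
  - by rewrite -(rmorph0 (real_complex R)) (inj_eq (@complexI R)).
have Dr (a : R) : smooth0 (fun y : V => Re (F y) - a).
  by apply: smooth0D h1 _; exact: smooth0_cst.
have Di (a : R) : smooth0 (fun y : V => Im (F y) - a).
  by apply: smooth0D h2 _; exact: smooth0_cst.
have Er : \sum_k x 0 k * 'D_(pdir R k) (fun y => Re (F y) - Re (F x)) x = 0.
  by apply: (quadratic_curve_der (Dr _) x0 (b := x)) => t; rewrite key subrr.
have Ei : \sum_k x 0 k * 'D_(pdir R k) (fun y => Im (F y) - Im (F x)) x = 0.
  by apply: (quadratic_curve_der (Di _) x0 (b := x)) => t; rewrite key subrr.
have DB (f : V -> R) (a : R) k : smooth0 f ->
    'D_(pdir R k) (fun y => f y - a) x = 'D_(pdir R k) f x.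
  move=> sf; have df := @smooth0_der R n f x k sf x0.
  by apply: etrans (derive_sub df (derivable_cst a _ _)) _; rewrite derive_cst subr0.
rewrite /Eu sE_sum; apply: complexP.
  rewrite (big_morph Re (@cReD R) (erefl : Re 0 = 0)) -[RHS]Er; apply: eq_bigr => k _.
  by rewrite sE_M sE_coord cReM /= mul0r subr0 (Re_der k F x0) (DB _ _ _ h1).
rewrite (big_morph Im (@cImD R) (erefl : Im 0 = 0)) -[RHS]Ei; apply: eq_bigr => k _.
by rewrite sE_M sE_coord cImM /= mul0r addr0 (Im_der k F x0) (DB _ _ _ h2).
Qed.

Definition extf f : cinf :=
  match pselect (exists F, isext f F) with
  | left H => sval (cid H) | right _ => 0 end.

Lemma extfP f : (exists F, isext f F) -> isext f (extf f).
Proof. by move=> H; rewrite /extf; case: pselect => // H'; case: cid. Qed.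

(** An extension is chosen once and for all; by [DopE] the choice does not matter on the cone,
    because [PC] preserves the functions vanishing there. *)
Definition Dop : operator R n := fun f z => Re (PC (extf f) (realify z)).

Lemma DopE f F z : isext f F -> nullcone z -> Dop f z = Re (PC F (realify z)).
Proof.
move=> hF hz; have hE : isext f (extf f) by apply: extfP; exists F.
suff E : PC (extf f) (realify z) = PC F (realify z).
  by rewrite /Dop; exact (congr1 Re E).
have /inNP/(_ z hz) := PC_congr n_gt0 (isext_inN hE hF).
by rewrite sE_D sE_N => /eqP; rewrite subr_eq0 => /eqP.
Qed.

Lemma Re_scal (r : R) (w : C) : Re (r%:C%C * w) = r * Re w.
Proof. by rewrite cReM /= mul0r subr0. Qed.

Lemma PC_act h c F z : c != 0 -> (forall w, Lform (act h w) = c * Lform w) ->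
  inN (EU F) -> nullcone z ->
  PC (pull (rmx h) F) (realify z) = (c ^+ n)%:C%C * PC F (realify (act h z)).
Proof.
move=> c0 H hF hz; have sA := similitude_act c0 H.
have [z0 _] := (nullconeP z).1 hz; have uA := similitude_unit sA.
have E1 : (cst c%:C%C ^+ n) (realify z) = (c ^+ n)%:C%C.
  by rewrite (sE_X (cst c%:C%C) n z0) (sE_cst _ z0) -rmorphXn.
have E2 G : pull (rmx h) G (realify z) = G (realify (act h z)).
  by rewrite (pullE G uA z0) -realify_act.
have := (inNP _).1 (PC_pull n_gt0 sA hF) z hz.
move: (PC (pull _ F)) (PC F) => P1 P2.
by rewrite sE_D sE_N sE_M E1 E2 => /eqP; rewrite subr_eq0 => /eqP.
Qed.

Lemma isext_act f h c F : c != 0 -> (forall w, Lform (act h w) = c * Lform w) ->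
  isext f F -> isext (fun w => f (act h w)) (pull (rmx h) F).
Proof.
move=> c0 H hF z hz; have uA := similitude_unit (similitude_act c0 H).
have [z0 _] := (nullconeP z).1 hz.
by rewrite pullE // -realify_act hF //; exact: nullcone_act c0 H hz.
Qed.

(** Similitudes give two properties at once: [c = 1] is the equivariance, and a scalar matrix [l%:M]
    with [c = normsq l] is the homogeneity that places the result in [Ep (- n)]. *)
Lemma Dop_act f h c z : c != 0 -> (forall w, Lform (act h w) = c * Lform w) ->
  Ep 0 f -> nullcone z ->
  Dop (fun w => f (act h w)) z = c ^+ n * Dop f (act h z).
Proof.
move=> c0 H fE hz; have [F hF] := Ep_ext fE.
have hEu := cinv_Eu (cinv_Ep hF fE).
rewrite (DopE (isext_act c0 H hF) hz) (DopE hF (nullcone_act c0 H hz)).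
exact (etrans (congr1 Re (PC_act c0 H hEu hz)) (Re_scal _ _)).
Qed.

Lemma iterD_zero s x : Defs.iterD s (fun _ : V => 0 : R) x = 0.
Proof.
elim: s x => //= j s IH x; rewrite (_ : Defs.iterD s _ = fun _ => 0); last exact/funext.
exact: derive_cst.
Qed.

Lemma derw_ofR (F : V -> R) (sF : smooth0 F) s x : x != 0 ->
  derw s (ofR sF) x = (Defs.iterD s F x)%:C%C.
Proof.
move=> x0; rewrite derwE //; apply: complexP => /=.
  by apply: iterD_ext => // y y0; rewrite ofRE.
rewrite -(iterD_zero s x); apply: iterD_ext => // y y0; by rewrite ofRE.
Qed.

(** The list behind a [diff_operator] may repeat a word, whereas [diffop_on_E0] attaches one
    coefficient to each word; equal words have to be collected. *)
Lemma sum_by_key (K T : eqType) (L : seq T) (key : T -> K) (g : T -> R) :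
  \sum_(p <- L) g p = \sum_(s <- undup (map key L)) \sum_(p <- L | key p == s) g p.
Proof.
under [RHS]eq_bigr do rewrite big_mkcond /=.
rewrite exchange_big /= big_seq [RHS]big_seq; apply: eq_bigr => p pL.
rewrite (bigD1_seq (key p)) ?undup_uniq ?mem_undup ?map_f //= eqxx big1 ?addr0 // => s.
by rewrite eq_sym => /negbTE ->.
Qed.

Lemma Dop_diffop : diffop_on_E0 Dop.
Proof.
have [L hL] := @do_PC R n.
pose coef s : cinf := \sum_(p <- L | p.1 == s) p.2.
exists (undup [seq p.1 | p <- L]), (fun s x => Re (coef s x)); split.
  by move=> s; exact (proj1 (sfun_csmooth (coef s))).
move=> f hf F sF H z hz; have [z0 _] := (nullconeP z).1 hz.
rewrite (DopE (isext_ofR sF H) hz) hL sE_sum.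
rewrite (big_morph Re (@cReD R) (erefl : Re 0 = 0)).
rewrite (eq_bigr (fun p : seq I * cinf =>
    Re (p.2 (realify z)) * Defs.iterD p.1 F (realify z))); last first.
  by move=> p _; rewrite sE_M (derw_ofR sF _ z0) mulrC Re_scal mulrC.
rewrite (sum_by_key _ (fun p : seq I * cinf => p.1)); apply: eq_bigr => s _.
rewrite /coef sE_sum (big_morph Re (@cReD R) (erefl : Re 0 = 0)) mulr_suml.
by apply: eq_bigr => p /eqP ->.
Qed.

Lemma Dop_linear : linear_on_E0 Dop.
Proof.
move=> c d f h hf hh z hz; have [F hF] := Ep_ext hf; have [H hH] := Ep_ext hh.
have hE : isext (fun w => c * f w + d * h w) (cst c%:C%C * F + cst d%:C%C * H).
  move=> w hw; have [w0 _] := (nullconeP w).1 hw.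
  by rewrite sE_D !sE_M !sE_cst // hF // hH // !rmorphD !rmorphM.
rewrite (DopE hE hz) (DopE hF hz) (DopE hH hz).
have [L hL] := @do_PC R n; rewrite !hL !sE_sum.
rewrite !(big_morph Re (@cReD R) (erefl : Re 0 = 0)) !mulr_sumr -big_split /=.
apply: eq_bigr => p _; rewrite -!Re_scal -cReD; congr Re.
have [z0 _] := (nullconeP z).1 hz.
have DW s : derw s (cst c%:C%C * F + cst d%:C%C * H) = cst c%:C%C * derw s F + cst d%:C%C * derw s H.
  elim: s => //= j s ->; have A (X Y : cinf) : d_ j (X + Y) = d_ j X + d_ j Y by exact: raddfD.
  by rewrite A !der_cstM.
rewrite DW sE_M sE_D 2!sE_M !sE_cst // [in RHS]sE_M [(p.2 * derw p.1 H) _]sE_M.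
by move: (p.2 _) (derw p.1 F _) (derw p.1 H _) => u v w; ring.
Qed.

Lemma Dop_maps : maps_E0_Emn Dop.
Proof.
move=> f hf; split.
  exists (fun x => Re (PC (extf f) x)); split => //.
  exact (proj1 (sfun_csmooth (PC (extf f)))).
move=> z l hz l0.
have c0 : normsq l != 0 by rewrite normsq_eq0.
have H (w : pt) : Lform (act l%:M w) = normsq l * Lform w.
  by rewrite (act_scalar l w) Lform_scale.
have := Dop_act c0 H hf hz; rewrite act_scalar => E.
have [F hF] := Ep_ext hf.
have hF' : isext (fun w => f (act l%:M w)) F.
  move=> w hw; rewrite act_scalar -(cinv_Ep hF hf hw l0) hF //.
  by rewrite -act_scalar; apply: nullcone_act c0 H hw.
have E2 : Dop f z = normsq l ^+ n * Dop f (l *: z).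
  by rewrite -E (DopE hF hz) (DopE hF' hz).
by rewrite E2 -exprnN mulKf // expf_neq0.
Qed.

Lemma inSU1n_inv (g : 'M[C]_n.+1) : inSU1n g -> inSU1n (invmx g).
Proof.
move=> [dg H]; have ug : g \in unitmx by rewrite unitmxE dg unitr1.
split; first by rewrite det_inv dg invr1.
by move=> z; rewrite -H /act -mulmxA -trmx_mul mulmxV // trmx1 mulmx1.
Qed.

Lemma Dop_equivariant : equivariant Dop.
Proof.
move=> g hg f hf z hz; have [_ H] := inSU1n_inv hg.
have H1 w : Lform (act (invmx g) w) = 1 * Lform w by rewrite mul1r H.
by rewrite (Dop_act _ H1 hf hz) ?oner_neq0 // expr1n mul1r.
Qed.

Lemma Dop_CR_invariant : CR_invariant_op Dop.
Proof.
by split; [exact: Dop_diffop | exact: Dop_linear | exact: Dop_maps | exact: Dop_equivariant].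
Qed.
End Existence.

(** * Jets and invariant functionals *)

Section Jets.
Variables (A : comNzRingType) (I : finType) (der : I -> A -> A) (Z : A -> Prop).
Hypothesis derB : forall i F G, der i (F - G) = der i F - der i G.
Hypothesis derM : forall i F G, der i (F * G) = der i F * G + F * der i G.
Hypothesis derC : forall i j F, der i (der j F) = der j (der i F).
Hypothesis Z0 : Z 0.
Hypothesis ZB : forall F G, Z F -> Z G -> Z (F - G).
Hypothesis ZM : forall F G, Z G -> Z (F * G).
Implicit Types (F G : A) (i j k : I).

(* For Z the functions vanishing at a point, J m is the ideal of functions vanishing there to order m. *)
Fixpoint J (m : nat) F : Prop :=
  match m with 0%N => True | m'.+1 => Z F /\ forall j, J m' (der j F) end.

Let der_0 := der0 derB.
Lemma J_zero m : J m 0.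
Proof. by elim: m => //= m IH; split=> // j; rewrite der_0. Qed.
Lemma JB m F G : J m F -> J m G -> J m (F - G).
Proof.
elim: m F G => //= m IH F G [ZF HF] [ZG HG]; split=> [|j]; first exact: ZB.
by rewrite derB; apply: IH.
Qed.
Lemma JN m F : J m F -> J m (- F).
Proof. by move=> HF; rewrite -sub0r; apply: JB => //; apply: J_zero. Qed.
Lemma JD m F G : J m F -> J m G -> J m (F + G).
Proof. by move=> HF HG; rewrite -[G]opprK; apply: JB => //; apply: JN. Qed.
Lemma J_sum m (T : Type) (r : seq T) (P : pred T) (f : T -> A) :
  (forall u, J m (f u)) -> J m (\sum_(u <- r | P u) f u).
Proof. by move=> H; elim/big_rec: _ => [|u x _ hx]; [exact: J_zero | apply: JD]. Qed.
Lemma J_S m F : J m.+1 F -> J m F.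
Proof.
elim: m F => // m IH F [ZF HF]; split=> // j; apply: IH; exact: HF.
Qed.
Lemma J_le m l F : (l <= m)%N -> J m F -> J l F.
Proof.
move=> lm; rewrite -(subnK lm); elim: (m - l)%N => // q IH.
by rewrite addSn => /J_S; apply: IH.
Qed.
Lemma J_der m j F : J m.+1 F -> J m (der j F).
Proof. by move=> [_ H]; exact: H. Qed.

Lemma JMl m F G : J m G -> J m (F * G).
Proof.
elim: m F G => //= m IH F G [ZG HG]; split=> [|j]; first exact: ZM.
rewrite derM; apply: JD; last exact: IH.
by apply: IH; apply: J_S; split.
Qed.
Lemma JMr m F G : J m F -> J m (F * G).
Proof. by rewrite mulrC; apply: JMl. Qed.

Lemma JM a b F G : J a F -> J b G -> J (a + b) (F * G).
Proof.
elim: a b F G => [|a IHa] b F G HF HG; first exact: JMl.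
elim: b F G HF HG => [|b IHb] F G HF HG; first by rewrite addn0; apply: JMr.
rewrite addSn; split=> [|j]; first by rewrite mulrC; apply: ZM; exact (proj1 HF).
rewrite derM; apply: JD; first by apply: IHa => //; apply: J_der.
by rewrite addnS -addSn; apply: IHb => //; apply: J_der.
Qed.

Lemma JX F m : Z F -> J m (F ^+ m).
Proof. by move=> ZF; elim: m => // m IH; rewrite exprS -add1n; apply: JM. Qed.

Lemma J_phi (phi : A -> A) (be : I -> I -> A) m F :
  (forall j G, der j (phi G) = \sum_k be j k * phi (der k G)) ->
  (forall G, Z G -> Z (phi G)) -> J m F -> J m (phi F).
Proof.
move=> dphi Zphi; elim: m F => //= m IH F [ZF HF]; split=> [|j]; first exact: Zphi.
by rewrite dphi; apply: J_sum => k; apply: JMl; apply: IH.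
Qed.

Section Taylor.
Variables (K S : A -> Prop) (xx : I -> A).
Hypothesis der_xx : forall i j, der i (xx j) = (i == j)%:R.
Hypothesis der_K : forall c, K c -> forall j, der j c = 0.
Hypothesis Kval : forall F, exists2 c, K c & Z (F - c).
Hypothesis Kinv : forall m : nat, exists2 c, K c & c * m.+1%:R = 1.
Hypothesis SK : forall c, K c -> S c.
Hypothesis Sxx : forall k, S (xx k).
Hypothesis SB : forall F G, S F -> S G -> S (F - G).
Hypothesis SM : forall F G, S F -> S G -> S (F * G).

Lemma centered_coord k : exists y, [/\ S y, Z y & forall j, der j y = (j == k)%:R].
Proof.
have [c Kc Zc] := Kval (xx k); exists (xx k - c); split=> //.
  by apply: SB => //; apply: SK.
by move=> j; rewrite derB der_xx der_K // subr0.
Qed.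

(** If [G] vanishes to order [q], then by Euler's relation [q%:R * G] and [Ey G] agree to one order
    more. In [Ey G] every [der k G] is replaced by an approximation from the induction hypothesis,
    and [q] is divided out. [S] is any property stable under the ring operations; [nrm_jet] takes
    for it a property of the function after a substitution. *)
Lemma taylor m F : exists2 Q, S Q & J m (F - Q).
Proof.
have [y Hy] := choice centered_coord.
have S0 : S 0.
  by have [c Kc _] := Kval 0; rewrite -(subrr c); apply: SB; apply: SK.
have SD X Y : S X -> S Y -> S (X + Y).
  by move=> hX hY; rewrite -[Y]opprK; apply: SB => //; rewrite -sub0r; apply: SB.
have ZD X Y : Z X -> Z Y -> Z (X + Y).
  by move=> hX hY; rewrite -[Y]opprK; apply: ZB => //; rewrite -sub0r; apply: ZB.
have Ssum (f : I -> A) : (forall k, S (f k)) -> S (\sum_k f k).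
  by move=> H; elim/big_rec: _ => // k x _ Sx; apply: SD.
pose Ey G := \sum_k y k * der k G.
have ZEy G : Z (Ey G).
  rewrite /Ey; elim/big_rec: _ => // k x _ Zx; apply: ZD => //.
  by rewrite mulrC; apply: ZM; have [] := Hy k.
have dEy j G : der j (Ey G) = der j G + Ey (der j G).
  rewrite /Ey (der_sum derB) -{1}[der j G](sum_delta' j (fun k => der k G)) -big_split /=.
  apply: eq_bigr => k _; rewrite derM (derC j k); have [_ _ ->] := Hy k.
  by [].
have euler q G : J q G -> J q.+1 (q%:R * G - Ey G).
  elim: q G => [|q IH] G HG.
    by split=> //; rewrite mul0r; apply: ZB.
  split.
    by apply: ZB => //; apply: ZM; exact (proj1 HG).
  move=> j; rewrite derB dEy (der_natM derB).
  have -> : q.+1%:R * der j G - (der j G + Ey (der j G)) = q%:R * der j G - Ey (der j G).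
    by rewrite [q.+1%:R]mulrS mulrDl mul1r opprD addrACA subrr add0r.
  by apply: IH; apply: J_der.
elim: m F => [|m IH] F; first by exists 0.
(* Order one is treated apart, since the Euler factor would be 0 there. *)
case: m IH => [|m] IH.
  by have [c Kc Zc] := Kval F; exists c; [apply: SK | split].
have [Q SQ HQ] := IH F; set G := F - Q in HQ.
have Hk k : exists c, S c /\ J m.+1 (der k G - c).
  by have [c Sc Hc] := IH (der k G); exists c.
have [q Hq] := choice Hk.
have [c Kc c1] := Kinv m.
exists (Q + c * \sum_k y k * q k).
  apply: SD => //; apply: SM; first exact: SK.
  by apply: Ssum => k; apply: SM; [have [] := Hy k | have [] := Hq k].
have -> : F - (Q + c * \sum_k y k * q k) =
    c * (m.+1%:R * G - Ey G) + c * \sum_k y k * (der k G - q k).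
  have -> : \sum_k y k * (der k G - q k) = Ey G - \sum_k y k * q k.
    by rewrite /Ey -sumrB; apply: eq_bigr => k _; rewrite mulrBr.
  rewrite -mulrDr addrA subrK mulrBr mulrA c1 mul1r /G opprD addrA; by [].
apply: JD; apply: JMl; first exact: euler.
apply: J_sum => k; rewrite -add1n; apply: JM; last by have [] := Hq k.
by split=> //; have [] := Hy k.
Qed.
End Taylor.
End Jets.

(** * Reduction of monomials under the functional *)

Section MonomialReduction.
Variables (A : comNzRingType) (C : numFieldType) (Lam : A -> C) (p : nat).
Hypothesis LamB : forall F G, Lam (F - G) = Lam F - Lam G.
Implicit Types (F G : A).
Local Notation I := 'I_p.

(** The largest ideal inside the kernel of [Lam]. Congruences modulo it absorb high jets and
    functions vanishing on the cone alike. *)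
Definition kerI F := forall G, Lam (G * F) = 0.

Lemma Lam0 : Lam 0 = 0. Proof. by rewrite -{1}(subrr 0) LamB subrr. Qed.
Lemma LamN F : Lam (- F) = - Lam F. Proof. by rewrite -sub0r LamB Lam0 sub0r. Qed.
Lemma LamD F G : Lam (F + G) = Lam F + Lam G.
Proof. by rewrite -{1}[G]opprK LamB LamN opprK. Qed.
Lemma Lam_sum (J : Type) (r : seq J) (P : pred J) (f : J -> A) :
  Lam (\sum_(u <- r | P u) f u) = \sum_(u <- r | P u) Lam (f u).
Proof. by rewrite (big_morph _ LamD Lam0). Qed.
Lemma Lam_natM m F : Lam (m%:R * F) = m%:R * Lam F.
Proof. by elim: m => [|m IH]; rewrite ?(mul0r, Lam0) // !mulrS !mulrDl LamD IH !mul1r. Qed.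

Lemma kerI0 : kerI 0. Proof. by move=> G; rewrite mulr0 Lam0. Qed.
Lemma kerIB F G : kerI F -> kerI G -> kerI (F - G).
Proof. by move=> hF hG H; rewrite mulrBr LamB hF hG subr0. Qed.
Lemma kerIN F : kerI F -> kerI (- F).
Proof. by move=> hF; rewrite -sub0r; apply: kerIB => //; apply: kerI0. Qed.
Lemma kerID F G : kerI F -> kerI G -> kerI (F + G).
Proof. by move=> hF hG; rewrite -[G]opprK; apply: kerIB => //; apply: kerIN. Qed.
Lemma kerIM F G : kerI G -> kerI (F * G).
Proof. by move=> hG H; rewrite mulrA; apply: hG. Qed.
Lemma kerIMr F G : kerI F -> kerI (F * G).
Proof. by move=> hF; rewrite mulrC; apply: kerIM. Qed.
Lemma kerI_Lam F : kerI F -> Lam F = 0.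
Proof. by move=> hF; rewrite -[F]mul1r hF. Qed.
Definition mon (X Xb : I -> A) (V Vb : A) (s t : seq I) a b : A :=
  (\prod_(i <- s) X i) * (\prod_(i <- t) Xb i) * (V ^+ a * Vb ^+ b).

Lemma mon_conj X Xb V Vb s t a b : mon X Xb V Vb s t a b = mon Xb X Vb V t s b a.
Proof. by rewrite /mon [_ * \prod_(i <- t) _]mulrC [V ^+ a * _]mulrC. Qed.

Section Derivation.
Variables (X Xb : I -> A) (V Vb : A) (d : I -> A -> A).
Hypothesis dM : forall j F G, d j (F * G) = d j F * G + F * d j G.
Hypothesis dX : forall j i, kerI (d j (X i) - (i == j)%:R * V).
Hypothesis dXb : forall j i, kerI (d j (Xb i) + Xb j * Xb i).
Hypothesis dV : forall j, kerI (d j V).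
Hypothesis dVb : forall j, kerI (d j Vb + Xb j * Vb).
Local Notation PX s := (\prod_(i <- s) X i).
Local Notation PXb s := (\prod_(i <- s) Xb i).
Local Notation mn := (mon X Xb V Vb).

Lemma d_one j : d j 1 = 0. Proof. exact: (der_one dM). Qed.

Lemma PX_rem s j : j \in s -> PX s = X j * PX (rem j s).
Proof. by move=> js; rewrite (perm_big _ (perm_to_rem js)) big_cons. Qed.

Lemma d_PX j s : kerI (d j (PX s) - (count_mem j s)%:R * (V * PX (rem j s))).
Proof.
elim: s => [|i s IH]; first by rewrite big_nil d_one mul0r subr0; apply: kerI0.
rewrite big_cons dM /=.
have -> : d j (X i) * PX s + X i * d j (PX s) -
     ((i == j) + count_mem j s)%:R * (V * PX (if i == j then s else i :: rem j s)) =
  (d j (X i) - (i == j)%:R * V) * PX s +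
  X i * (d j (PX s) - (count_mem j s)%:R * (V * PX (rem j s))).
  have [->|ij] := eqVneq i j; last first.
    rewrite add0n big_cons -[false%:R]/(0 : A) mul0r subr0.
    move: (d j (X i)) (d j (PX s)) => u v.
    by move: (PX (rem j s)) (X i) ((count_mem j s)%:R : A) (PX s) => w x y z; ring.
  rewrite natrD -[true%:R]/(1 : A).
  have [js|js] := boolP (j \in s).
    rewrite (PX_rem js); move: (d j (X j * PX (rem j s))) => u; move: (d j (X j)) => v.
    by move: (PX (rem j s)) (X j) ((count_mem j s)%:R : A) => w x y; ring.
  rewrite (count_memPn js) -[0%:R]/(0 : A) mul0r; move: (d j (PX s)) => u; move: (d j (X j)) (PX s) (PX _) => v w x; ring.
by apply: kerID; [apply: kerIMr | apply: kerIM].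
Qed.

Lemma d_PXb j s : kerI (d j (PXb s) + (size s)%:R * Xb j * PXb s).
Proof.
elim: s => [|i s IH]; first by rewrite big_nil d_one !mul0r addr0; apply: kerI0.
rewrite big_cons dM /= mulrS.
have -> : d j (Xb i) * PXb s + Xb i * d j (PXb s) + (1 + (size s)%:R) * Xb j * (Xb i * PXb s) =
   (d j (Xb i) + Xb j * Xb i) * PXb s + Xb i * (d j (PXb s) + (size s)%:R * Xb j * PXb s).
  by move: (d j (Xb i)) (d j (PXb s)) => u v; move: (PXb s) ((size s)%:R : A) => *; ring.
by apply: kerID; [apply: kerIMr | apply: kerIM].
Qed.

Lemma d_Vpow j a : kerI (d j (V ^+ a)).
Proof.
elim: a => [|a IH]; first by rewrite expr0 d_one; apply: kerI0.
by rewrite exprS dM; apply: kerID; [apply: kerIMr | apply: kerIM].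
Qed.

Lemma d_Vbpow j b : kerI (d j (Vb ^+ b) + b%:R * Xb j * Vb ^+ b).
Proof.
elim: b => [|b IH]; first by rewrite expr0 d_one !mul0r addr0; apply: kerI0.
rewrite exprS dM mulrS.
have -> : d j Vb * Vb ^+ b + Vb * d j (Vb ^+ b) + (1 + b%:R) * Xb j * (Vb * Vb ^+ b) =
   (d j Vb + Xb j * Vb) * Vb ^+ b + Vb * (d j (Vb ^+ b) + b%:R * Xb j * Vb ^+ b).
  by move: (d j Vb) (d j (Vb ^+ b)) => u v; move: (Vb ^+ b) (b%:R : A) => *; ring.
by apply: kerID; [apply: kerIMr | apply: kerIM].
Qed.

(** The field sends w_j to v and ub to wb_j. In quotients by u and ub this means that X_j goes to V,
    while each of the [size t + b] factors with denominator ub contributes, by the quotient rule,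
    the same term with a further [Xb j]. *)
Lemma d_mon j s t a b : kerI (d j (mn s t a b) -
  ((count_mem j s)%:R * mn (rem j s) t a.+1 b - (size t + b)%:R * mn s (j :: t) a b)).
Proof.
rewrite /mon !dM big_cons exprS natrD.
have -> : (d j (PX s) * PXb t + PX s * d j (PXb t)) * (V ^+ a * Vb ^+ b) +
  PX s * PXb t * (d j (V ^+ a) * Vb ^+ b + V ^+ a * d j (Vb ^+ b)) -
  ((count_mem j s)%:R * (PX (rem j s) * PXb t * (V * V ^+ a * Vb ^+ b)) -
   ((size t)%:R + b%:R) * (PX s * (Xb j * PXb t) * (V ^+ a * Vb ^+ b))) =
  PXb t * (V ^+ a * Vb ^+ b) * (d j (PX s) - (count_mem j s)%:R * (V * PX (rem j s))) +
  PX s * (V ^+ a * Vb ^+ b) * (d j (PXb t) + (size t)%:R * Xb j * PXb t) +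
  PX s * PXb t * Vb ^+ b * d j (V ^+ a) +
  PX s * PXb t * V ^+ a * (d j (Vb ^+ b) + b%:R * Xb j * Vb ^+ b).
  move: (d j (PX s)) (d j (PXb t)) (d j (V ^+ a)) (d j (Vb ^+ b)) => d1 d2 d3 d4.
  move: (PX s) (PXb t) (PX _) (V ^+ a) (Vb ^+ b) => e1 e2 e3 e4 e5.
  by move: ((count_mem _ _)%:R : A) ((size t)%:R : A) (b%:R : A) => *; ring.
apply: kerID; last by apply: kerIM; apply: d_Vbpow.
apply: kerID; last by apply: kerIM; apply: d_Vpow.
by apply: kerID; apply: kerIM; [apply: d_PX | apply: d_PXb].
Qed.

Hypothesis Lam_d : forall j s t a b, Lam (d j (mn s t a b)) = 0.

Lemma mon_step j s t a b :
  (size t + b)%:R * Lam (mn s (j :: t) a b) = (count_mem j s)%:R * Lam (mn (rem j s) t a.+1 b).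
Proof.
have := kerI_Lam (@d_mon j s t a b); rewrite !LamB Lam_d !Lam_natM sub0r opprB.
by move/eqP; rewrite subr_eq0 => /eqP.
Qed.
End Derivation.

Variables (X Xb : I -> A) (V Vb : A) (d db : I -> A -> A) (th : A -> A).
Hypothesis p_gt0 : (0 < p)%N.
Hypothesis dM : forall j F G, d j (F * G) = d j F * G + F * d j G.
Hypothesis dX : forall j i, kerI (d j (X i) - (i == j)%:R * V).
Hypothesis dXb : forall j i, kerI (d j (Xb i) + Xb j * Xb i).
Hypothesis dV : forall j, kerI (d j V).
Hypothesis dVb : forall j, kerI (d j Vb + Xb j * Vb).
Hypothesis dbM : forall j F G, db j (F * G) = db j F * G + F * db j G.
Hypothesis dbXb : forall j i, kerI (db j (Xb i) - (i == j)%:R * Vb).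
Hypothesis dbX : forall j i, kerI (db j (X i) + X j * X i).
Hypothesis dbVb : forall j, kerI (db j Vb).
Hypothesis dbV : forall j, kerI (db j V + X j * V).
Hypothesis thM : forall F G, th (F * G) = th F * G + F * th G.
Hypothesis thX : forall i, kerI (th (X i) - X i).
Hypothesis thXb : forall i, kerI (th (Xb i) - Xb i).
Hypothesis thV : kerI (th V - 2%:R * V).
Hypothesis thVb : kerI (th Vb - 2%:R * Vb).
Local Notation mn := (mon X Xb V Vb).
Hypothesis Lam_d : forall j s t a b, Lam (d j (mn s t a b)) = 0.
Hypothesis Lam_db : forall j s t a b, Lam (db j (mn s t a b)) = 0.
Hypothesis Lam_th : forall s t a b, Lam (th (mn s t a b)) = (2 * p.+1)%:R * Lam (mn s t a b).
Hypothesis cone_rel : kerI (V + Vb - \sum_j X j * Xb j).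
Hypothesis Lam_1p : Lam (V * Vb ^+ p) = 0.

Lemma weightM (m l : nat) F G : kerI (th F - m%:R * F) -> kerI (th G - l%:R * G) ->
  kerI (th (F * G) - (m + l)%:R * (F * G)).
Proof.
move=> hF hG; have -> : th (F * G) - (m + l)%:R * (F * G) =
  (th F - m%:R * F) * G + F * (th G - l%:R * G) by rewrite thM natrD; ring.
by apply: kerID; [apply: kerIMr | apply: kerIM].
Qed.

Lemma weight1 : kerI (th 1 - 0%:R * 1).
Proof.
have -> : th 1 = 0 by have := der_one (der := fun _ : 'I_1 => th) (fun _ => thM) ord0.
by rewrite mul0r subrr; apply: kerI0.
Qed.

Lemma weight_prod (Y : I -> A) s : (forall i, kerI (th (Y i) - Y i)) ->
  kerI (th (\prod_(i <- s) Y i) - (size s)%:R * \prod_(i <- s) Y i).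
Proof.
move=> hY; elim: s => [|i s IH]; first by rewrite big_nil; apply: weight1.
by rewrite big_cons /= -add1n; apply: weightM => //; rewrite mul1r.
Qed.

Lemma weight_pow Y m a : kerI (th Y - m%:R * Y) -> kerI (th (Y ^+ a) - (m * a)%:R * Y ^+ a).
Proof.
move=> hY; elim: a => [|a IH]; first by rewrite expr0 muln0; apply: weight1.
by rewrite exprS mulnS; apply: weightM.
Qed.

Lemma Lam_weight s t a b : (size s + size t + (2 * a + 2 * b) != 2 * p.+1)%N ->
  Lam (mn s t a b) = 0.
Proof.
move=> wt; have K : kerI (th (mn s t a b) -
    (size s + size t + (2 * a + 2 * b))%:R * mn s t a b).
  apply: weightM; apply: weightM; [exact: weight_prod|exact: weight_prod| |];
    exact: weight_pow.
have := kerI_Lam K; rewrite LamB Lam_th Lam_natM -mulrBl => /eqP.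
rewrite mulf_eq0 => /orP[|/eqP//].
by rewrite subr_eq0 eqr_nat eq_sym (negbTE wt).
Qed.

Let step1 := mon_step dM dX dXb dV dVb Lam_d.

Lemma step2 i s t a b :
  (size s + a)%:R * Lam (mn (i :: s) t a b) = (count_mem i t)%:R * Lam (mn s (rem i t) a b.+1).
Proof.
rewrite mon_conj [in RHS]mon_conj; apply: (mon_step dbM dbXb dbX dbVb dbV) => j u w c e.
by rewrite mon_conj.
Qed.

(* The cone relation trades V + Vb for the X_j Xb_j, on which the nilpotent fields act. *)
Lemma pair_step a b : (a + b)%N = p ->
  b%:R * Lam (V ^+ a * Vb ^+ b.+1) = a%:R * Lam (V ^+ a.+1 * Vb ^+ b).
Proof.
move=> ab; have S1 j : b%:R * Lam (X j * Xb j * (V ^+ a * Vb ^+ b)) = Lam (V ^+ a.+1 * Vb ^+ b).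
  have := step1 j [:: j] [::] a b.
  rewrite /mon /= eqxx /= !big_cons !big_nil add0n addn0 !mulr1 !mul1r => ->.
  by [].
have : Lam ((V ^+ a * Vb ^+ b) * (V + Vb - \sum_j X j * Xb j)) = 0 by apply: cone_rel.
rewrite mulrBr mulrDr LamB LamD mulr_sumr Lam_sum => /eqP; rewrite subr_eq0 => /eqP E.
(* All [p] indices contribute the same term; since [p = a + b], the part with coefficient [b]
   cancels against the left side. *)
have : b%:R * \sum_j Lam (V ^+ a * Vb ^+ b * (X j * Xb j)) = p%:R * Lam (V ^+ a.+1 * Vb ^+ b).
  rewrite mulr_sumr (eq_bigr (fun _ => Lam (V ^+ a.+1 * Vb ^+ b))).
    by rewrite sumr_const card_ord mulr_natl.
  by move=> j _; rewrite -(S1 j) [X j * Xb j * _]mulrC.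
rewrite -E -ab natrD mulrDr mulrDl [V ^+ a * Vb ^+ b * V]mulrAC -exprSr -mulrA -exprSr.
by move=> H; apply: (addrI (b%:R * Lam (V ^+ a.+1 * Vb ^+ b))); rewrite H addrC.
Qed.

(** [pair_step] climbs from [V * Vb ^+ p] to higher powers of [V], dividing by positive integers.
    The remaining power [Vb ^+ p.+1] comes from [a = 0], where one divides by [p]. *)
Lemma Lam_VVb a b : Lam (V ^+ a * Vb ^+ b) = 0.
Proof.
have M c e : mn [::] [::] c e = V ^+ c * Vb ^+ e by rewrite /mon !big_nil !mul1r.
have [ab|ab] := eqVneq (a + b)%N p.+1; last first.
  rewrite -M; apply: Lam_weight; apply: contra_neq ab => /= /eqP.
  by rewrite -mulnDr eqn_pmul2l // => /eqP.
have main c e : (c.+1 + e)%N = p.+1 -> Lam (V ^+ c.+1 * Vb ^+ e) = 0.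
  elim: c e => [|c IH] e ce.
    by move: ce; rewrite add1n expr1 => -[->]; exact: Lam_1p.
  have ce' : (c.+1 + e)%N = p by move: ce; rewrite addSn => -[].
  have := pair_step ce'; rewrite IH ?mulr0; last by rewrite -addSnnS.
  by move/esym/eqP; rewrite mulf_eq0 pnatr_eq0 => /eqP.
case: a ab => [|a] ab; last exact: main.
rewrite add0n in ab; have := pair_step (add0n p); rewrite mul0r ab => /eqP.
by rewrite mulf_eq0 pnatr_eq0 (gtn_eqF p_gt0) => /eqP.
Qed.

(** Induction on the number of factors [X] and [Xb]. One step of either kind removes an [Xb] and an
    equal [X], or gives zero if there is no match. If neither coefficient can be divided by, only
    X_i Xb_j or a single factor times a power of [V] or [Vb] remains. The first has weight 2, below
    [2 * p.+1], and the others have odd weight. *)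
Lemma Lam_mon s t a b : Lam (mn s t a b) = 0.
Proof.
have [k] := ubnP (size s + size t)%N.
elim: k s t a b => // k IH s t a b; rewrite ltnS => st.
have nz (m : nat) (z w : C) : m != 0%N -> m%:R * z = w -> w = 0 -> z = 0.
  by move=> m0 E w0; move: E; rewrite w0 => /eqP; rewrite mulf_eq0 pnatr_eq0 (negbTE m0) => /eqP.
case: t st => [|j t] st.
  case: s st => [|i s] st; first by rewrite /mon !big_nil !mul1r Lam_VVb.
  have [sa|sa] := eqVneq (size s + a)%N 0%N; last first.
    by apply: (nz _ _ _ sa (step2 i s [::] a b)); rewrite mul0r.
  move/eqP: sa; rewrite addn_eq0 => /andP[/eqP s0 /eqP ->]; rewrite (size0nil s0).
  by apply: Lam_weight => /=; apply/eqP; lia.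
have [tb|tb] := eqVneq (size t + b)%N 0%N; last first.
  apply: (nz _ _ _ tb (step1 j s t a b)).
  have [js|js] := boolP (j \in s); last by rewrite (count_memPn js) mul0r.
  rewrite IH ?mulr0 // size_rem //; move: st js => /=; case: (s) => //= i s' H _; lia.
move/eqP: tb; rewrite addn_eq0 => /andP[/eqP t0 /eqP b0]; subst b; move: st; rewrite (size0nil t0) => st.
case: s st => [|i s] st.
  by apply: Lam_weight => /=; apply/eqP; lia.
have [sa|sa] := eqVneq (size s + a)%N 0%N; last first.
  apply: (nz _ _ _ sa (step2 i s [:: j] a 0)).
  have [ij|ij] := boolP (i \in [:: j]); last by rewrite (count_memPn ij) mul0r.
  rewrite IH ?mulr0 // size_rem //=; move: st => /=; lia.
move/eqP: sa; rewrite addn_eq0 => /andP[/eqP s0 /eqP ->]; rewrite (size0nil s0).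
by apply: Lam_weight => /=; apply/eqP; lia.
Qed.

Variable K : A -> Prop.
Hypothesis LamK : forall c F, K c -> Lam F = 0 -> Lam (c * F) = 0.

(* Multipliers preserving the annihilated functions form a subring, so membership need only be checked on generators. *)
Definition annih G := forall s t a b, Lam (G * mn s t a b) = 0.
Definition polys F := forall G, annih G -> annih (F * G).

Lemma polys_Lam F : polys F -> Lam F = 0.
Proof.
move=> hF; have h1 : annih 1 by move=> s t a b; rewrite mul1r Lam_mon.
have := hF 1 h1 [::] [::] 0%N 0%N; by rewrite /mon !big_nil !expr0 !mulr1.
Qed.
Lemma polysB F G : polys F -> polys G -> polys (F - G).
Proof. by move=> hF hG H aH s t a b; rewrite !mulrBl LamB hF // hG // subrr. Qed.
Lemma polysM F G : polys F -> polys G -> polys (F * G).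
Proof. by move=> hF hG H aH; rewrite -mulrA; apply: hF; apply: hG. Qed.
Lemma polysK c : K c -> polys c.
Proof. by move=> Kc H aH s t a b; rewrite -mulrA; apply: LamK. Qed.
Lemma polys_kerI F G : kerI (F - G) -> polys G -> polys F.
Proof.
move=> hFG hG H aH s t a b; rewrite -[F](subrK G); move: (F - G) hFG => D hD; rewrite !mulrDl LamD hG // addr0.
by apply: kerI_Lam; apply: kerIMr; apply: kerIMr.
Qed.
Lemma polysX i : polys (X i).
Proof.
move=> H aH s t a b; have := aH (i :: s) t a b; rewrite /mon big_cons => <-.
congr Lam; move: (\prod_(i <- s) _) (\prod_(i <- t) _) (V ^+ a) (Vb ^+ b) => *; ring.
Qed.
Lemma polysXb i : polys (Xb i).
Proof.
move=> H aH s t a b; have := aH s (i :: t) a b; rewrite /mon big_cons => <-.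
congr Lam; move: (\prod_(i <- s) _) (\prod_(i <- t) _) (V ^+ a) (Vb ^+ b) => *; ring.
Qed.
Lemma polysV : polys V.
Proof.
move=> H aH s t a b; have := aH s t a.+1 b; rewrite /mon exprS => <-.
congr Lam; move: (\prod_(i <- s) _) (\prod_(i <- t) _) (V ^+ a) (Vb ^+ b) => *; ring.
Qed.
Lemma polysVb : polys Vb.
Proof.
move=> H aH s t a b; have := aH s t a b.+1; rewrite /mon exprS => <-.
congr Lam; move: (\prod_(i <- s) _) (\prod_(i <- t) _) (V ^+ a) (Vb ^+ b) => *; ring.
Qed.
End MonomialReduction.

(** * Infinitesimal invariance at a fixed point *)

Section LieInvariance.
Variables (R : realType) (n : nat).
Local Notation V := 'rV[R]_(rdim n).
Local Notation I := 'I_(rdim n).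
Local Notation C := R[i].
Local Notation Re := (@complex.Re R).
Local Notation Im := (@complex.Im R).
Local Notation cinf := (cinf R n).
Local Notation cst := (@scst R n).
Local Notation coord := (@scoord R n).
Local Notation inN := (@inN R n).
Local Notation d_ := (@der R n).
Local Notation pt := (pt R n).
Implicit Types (F G : cinf) (x : V) (i j k : I) (z : pt).
Local Opaque der scst scoord sadd smul sopp mkS.

Lemma d_D j F G : d_ j (F + G) = d_ j F + d_ j G. Proof. exact: raddfD. Qed.
Lemma d_sum j (T : Type) (r : seq T) (P : pred T) (f : T -> cinf) :
  d_ j (\sum_(u <- r | P u) f u) = \sum_(u <- r | P u) d_ j (f u).
Proof. exact: raddf_sum. Qed.

Lemma derw_rcons s j F : derw (rcons s j) F = derw s (d_ j F).
Proof. by rewrite /derw foldr_rcons. Qed.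
Lemma derwB s F G : derw s (F - G) = derw s F - derw s G.
Proof. by elim: s => //= j s ->; rewrite d_B. Qed.
Lemma derw_cstM s c F : derw s (cst c * F) = cst c * derw s F.
Proof. by elim: s => //= j s ->; rewrite der_cstM. Qed.
Lemma derw0 s : derw s 0 = 0 :> cinf.
Proof. by rewrite -{1}(subrr 0) derwB subrr. Qed.
Lemma derwD s F G : derw s (F + G) = derw s F + derw s G.
Proof. by rewrite -{1}[G]opprK derwB -[- G]sub0r derwB derw0 sub0r opprK. Qed.
Lemma derw_sum s (T : Type) (r : seq T) (P : pred T) (f : T -> cinf) :
  derw s (\sum_(u <- r | P u) f u) = \sum_(u <- r | P u) derw s (f u).
Proof. by rewrite (big_morph _ (derwD s) (derw0 s)). Qed.

Section AtPoint.
Variable (x0 : V).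
Hypothesis x0_neq0 : x0 != 0.

Definition vanish F := F x0 = 0.
Lemma vanish0 : vanish 0. Proof. exact: sE_0. Qed.
Lemma vanishB F G : vanish F -> vanish G -> vanish (F - G).
Proof. by move=> hF hG; rewrite /vanish sE_D sE_N hF hG subr0. Qed.
Lemma vanishM F G : vanish G -> vanish (F * G).
Proof. by move=> hG; rewrite /vanish sE_M hG mulr0. Qed.

Local Notation Jt := (J d_ vanish).

Lemma J_derw s m F : Jt (m + size s) F -> Jt m (derw s F).
Proof.
elim: s m F => [|j s IH] m F /=; first by rewrite addn0.
by rewrite addnS -addSn => /IH [_ H]; exact: H.
Qed.

Lemma J_derw_vanish s F : Jt (size s).+1 F -> derw s F x0 = 0.
Proof. by rewrite -add1n => /J_derw[H _]; exact: H. Qed.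

(** The linear vector field whose value at [x] is [x *m A]. *)
Definition field (A : 'M[R]_(rdim n)) F : cinf := \sum_k lin A k * d_ k F.

Lemma fieldB A F G : field A (F - G) = field A F - field A G.
Proof. by rewrite /field -sumrB; apply: eq_bigr => k _; rewrite d_B mulrBr. Qed.
Lemma fieldD A F G : field A (F + G) = field A F + field A G.
Proof. by rewrite /field -big_split; apply: eq_bigr => k _; rewrite d_D mulrDr. Qed.
Lemma fieldM A F G : field A (F * G) = field A F * G + F * field A G.
Proof.
rewrite /field mulr_suml mulr_sumr -big_split; apply: eq_bigr => k _ /=.
by rewrite derM; move: (lin A k) (d_ k F) (d_ k G) => *; ring.
Qed.
Lemma field_cst A c : field A (cst c) = 0.
Proof. by rewrite /field big1 // => k _; rewrite der_cst mulr0. Qed.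
Lemma field_coord A k : field A (coord k) = lin A k.
Proof.
rewrite /field -[RHS](sum_delta k (fun j => lin A j)).
by apply: eq_bigr => j _; rewrite der_coord; exact: mulrC.
Qed.
Lemma J_field A m F : Jt m.+1 F -> Jt m (field A F).
Proof.
move=> [_ H]; apply: (J_sum (@d_B R n) vanish0 vanishB) => k.
apply: (JMl (@d_B R n) (@derM R n) vanish0 vanishB vanishM); exact: H.
Qed.

Lemma d_lin A j k : d_ j (lin A k) = cst (A j k)%:C%C.
Proof.
rewrite /lin d_sum (bigD1 j) //= der_cstM der_coord eqxx mulr1 big1 ?addr0 // => i ij.
by rewrite der_cstM der_coord eq_sym (negbTE ij) mulr0.
Qed.

Lemma d_field A j F : d_ j (field A F) =
  \sum_k cst (A j k)%:C%C * d_ k F + field A (d_ j F).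
Proof.
rewrite /field d_sum -big_split; apply: eq_bigr => k _ /=.
by rewrite derM d_lin (derC j k).
Qed.

Section Family.
Variables (A1 A2 : 'M[R]_(rdim n)).
Hypothesis (x0A1 : x0 *m A1 = 0) (x0A2 : x0 *m A2 = 0).
Let At (t : R) : 'M[R]_(rdim n) := 1%:M + t *: A1 + t ^+ 2 *: A2.

Lemma derw_pull_poly s F : exists P : {poly C},
  [/\ forall t, At t \in unitmx -> derw s (pull (At t) F) x0 = P.[t%:C%C],
      P`_0 = derw s F x0 & P`_1 = derw s (field A1 F) x0].
Proof.
elim/last_ind: s F => [|s j IH] F.
  exists (F x0)%:P; split=> [t ut||]; rewrite ?hornerC ?coefC //=.
    by rewrite pullE // /At !mulmxDr mulmx1 -!scalemxAr x0A1 x0A2 !scaler0 !addr0.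
  rewrite /field sE_sum big1 // => k _.
  by rewrite sE_M linE // x0A1 mxE rmorph0 mul0r.
have [P HP] := choice (fun k => IH (d_ k F)).
pose lam k : {poly C} := ((j == k)%:R)%:P + (A1 j k)%:C%C *: 'X + (A2 j k)%:C%C *: 'X^2.
have lam0 k : (lam k)`_0 = (j == k)%:R.
  by rewrite /lam !coefD !coefZ coefC coefX coefXn /= !mulr0 !addr0.
have lam1 k : (lam k)`_1 = (A1 j k)%:C%C.
  by rewrite /lam !coefD !coefZ coefC coefX coefXn /= mulr0 mulr1 add0r addr0.
exists (\sum_k lam k * P k); split=> [t ut||].
- rewrite derw_rcons der_pull // derw_sum sE_sum horner_sum; apply: eq_bigr => k _.
  have [HPk _ _] := HP k; rewrite derw_cstM sE_M sE_cst // HPk // hornerM; congr (_ * _).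
  rewrite /lam !hornerD !hornerZ hornerC hornerX hornerXn /At !mxE.
  rewrite -!(rmorph_nat (real_complex R)) -rmorphXn -!rmorphM -!rmorphD; congr (_ %:C%C).
  by rewrite [t * _]mulrC [t ^+ 2 * _]mulrC.
- rewrite coef_sum derw_rcons (bigD1 j) //= coefM big_ord1 subnn lam0 eqxx mul1r.
  have [_ -> _] := HP j; rewrite big1 ?addr0 // => k kj.
  by rewrite coefM big_ord1 lam0 eq_sym (negbTE kj) mul0r.
rewrite coef_sum derw_rcons d_field derwD sE_D derw_sum sE_sum.
have E k : (lam k * P k)`_1 = (j == k)%:R * (P k)`_1 + (A1 j k)%:C%C * (P k)`_0.
  by rewrite coefM big_ord_recl big_ord1 /= lam0 lam1 subn0.
rewrite (eq_bigr _ (fun k _ => E k)) big_split /= addrC; congr (_ + _).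
  by apply: eq_bigr => k _; have [_ -> _] := HP k; rewrite derw_cstM sE_M sE_cst.
rewrite (bigD1 j) //= eqxx mul1r big1 ?addr0; first by have [_ _ ->] := HP j.
by move=> k kj; rewrite eq_sym (negbTE kj) mul0r.
Qed.

(* Along the quadratic family At the functional is polynomial in the parameter, so invariance at natural parameters already gives the infinitesimal statement. *)
Lemma lie_invariance (S : seq (seq I * C)) (Lam : cinf -> C) F (q : {poly R}) :
  (forall G, Lam G = \sum_(p <- S) p.2 * derw p.1 G x0) ->
  (forall m : nat, At m%:R \in unitmx /\
     Lam (pull (At m%:R) F) = (q.[m%:R])%:C%C * Lam F) ->
  Lam (field A1 F) = (q`_1)%:C%C * Lam F.
Proof.
move=> LamE inv.
have [P HP] := choice (fun s => derw_pull_poly s F).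
pose T : {poly C} := \sum_(p <- S) p.2 *: P p.1.
have T1 : T`_1 = Lam (field A1 F).
  rewrite /T coef_sum LamE; apply: eq_bigr => p _.
  by rewrite coefZ; have [_ _ ->] := HP p.1.
pose U : {poly C} := Lam F *: map_poly (real_complex R) q.
suff E : T = U by rewrite -T1 E /U coefZ coef_map mulrC.
have TU (m : nat) : T.[m%:R] = U.[m%:R].
  have [um E] := inv m.
  have -> : (m%:R : C) = (m%:R : R)%:C%C by rewrite rmorph_nat.
  rewrite /U hornerZ horner_map mulrC -E LamE /T horner_sum; apply: eq_bigr => p _.
  by rewrite hornerZ; have [/(_ _ um) <- _ _] := HP p.1.
apply/eqP; rewrite -subr_eq0; apply: contraT => D0.
have := max_poly_roots D0 (rs := [seq (m%:R : C) | m <- iota 0 (size (T - U))]).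
rewrite size_map size_iota ltnn; apply.
  by apply/allP => y /mapP[m _ ->]; rewrite rootE hornerD hornerN TU subrr.
rewrite map_inj_uniq ?iota_uniq // => a b /eqP; by rewrite eqr_nat => /eqP.
Qed.
End Family.
End AtPoint.

Lemma rmxD (g h : 'M[C]_n.+1) : rmx (g + h) = rmx g + rmx h.
Proof.
rewrite /rmx linearD /= (_ : map_mx Re _ = map_mx Re g^T + map_mx Re h^T); last first.
  by apply/matrixP => i j; rewrite !mxE cReD.
rewrite (_ : map_mx Im _ = map_mx Im g^T + map_mx Im h^T); last first.
  by apply/matrixP => i j; rewrite !mxE cImD.
by rewrite opprD add_block_mx.
Qed.

Lemma rmxZ (t : R) (h : 'M[C]_n.+1) : rmx (t%:C%C *: h) = t *: rmx h.
Proof.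
rewrite /rmx linearZ /= (_ : map_mx Re _ = t *: map_mx Re h^T); last first.
  by apply/matrixP => i j; rewrite !mxE cReM /= mul0r subr0.
rewrite (_ : map_mx Im _ = t *: map_mx Im h^T); last first.
  by apply/matrixP => i j; rewrite !mxE cImM /= mul0r addr0.
by rewrite -scalerN scale_block_mx.
Qed.

Lemma rmx1 : rmx (1%:M : 'M[C]_n.+1) = 1%:M.
Proof.
rewrite /rmx trmx1 (_ : map_mx Re _ = 1%:M); last first.
  by apply/matrixP => i j; rewrite !mxE; case: (i == j).
rewrite (_ : map_mx Im _ = 0); last first.
  by apply/matrixP => i j; rewrite !mxE; case: (i == j).
by rewrite oppr0 -scalar_mx_block.
Qed.

Definition zc (k : 'I_n.+1) : cinf := coord (lshift _ k) + cst 'i%C * coord (rshift _ k).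
Definition zb (k : 'I_n.+1) : cinf := coord (lshift _ k) - cst 'i%C * coord (rshift _ k).

Lemma zcE (k : 'I_n.+1) z : z != 0 -> zc k (realify z) = z 0 k.
Proof.
move=> z0; have x0 : realify z != 0 by rewrite realify_eq0.
rewrite /zc sE_D sE_M sE_cst // !sE_coord realify_l realify_r.
by rewrite [RHS]complexE.
Qed.

Lemma zbE (k : 'I_n.+1) z : z != 0 -> zb k (realify z) = ((z 0 k)^*)%C.
Proof.
move=> z0; have x0 : realify z != 0 by rewrite realify_eq0.
rewrite /zb sE_D sE_N sE_M sE_cst // !sE_coord realify_l realify_r.
by case: (z 0 k) => a b; apply: complexP => /=; ring.
Qed.

Lemma cinf_realifyP F G : (forall z, z != 0 -> F (realify z) = G (realify z)) -> F = G.
Proof.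
move=> H; apply: sfunP => x x0; rewrite -(cplxK x); apply: H.
by rewrite -realify_eq0 cplxK.
Qed.

Lemma field_zc (h : 'M[C]_n.+1) (k : 'I_n.+1) z : z != 0 ->
  field (rmx h) (zc k) (realify z) = (act h z) 0 k.
Proof.
move=> z0; have x0 : realify z != 0 by rewrite realify_eq0.
rewrite /zc -[cst 'i%C * _]opprK fieldB -mulNr -rmorphN fieldM field_cst mul0r add0r.
rewrite !field_coord sE_D sE_N sE_M sE_cst // !linE // -realify_act realify_l realify_r.
by case: (act h z 0 k) => a b; apply: complexP => /=; ring.
Qed.

Lemma field_zb (h : 'M[C]_n.+1) (k : 'I_n.+1) z : z != 0 ->
  field (rmx h) (zb k) (realify z) = (((act h z) 0 k)^*)%C.
Proof.
move=> z0; have x0 : realify z != 0 by rewrite realify_eq0.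
rewrite /zb fieldB fieldM field_cst mul0r add0r.
rewrite !field_coord sE_D sE_N sE_M sE_cst // !linE // -realify_act realify_l realify_r.
by case: (act h z 0 k) => a b; apply: complexP => /=; ring.
Qed.
End LieInvariance.

(** * The stabilizer of a null line *)

Section HeisenbergCoordinates.
Variables (R : realType) (p : nat).
Local Notation n := p.+1.
Local Opaque der scst scoord sadd smul sopp mkS field zc zb.
Local Notation C := R[i].
Local Notation cinf := (cinf R n).
Local Notation cst := (@scst R n).
Local Notation inN := (@inN R n).
Local Notation pt := (pt R n).
Local Notation field := (@field R n).
Local Notation zc := (@zc R n).
Local Notation zb := (@zb R n).
Implicit Types (F G : cinf) (z : pt).

Definition i1 : 'I_n.+1 := lift ord0 ord0.
Definition iw (j : 'I_p) : 'I_n.+1 := lift ord0 (lift ord0 j).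

Definition row3 (a b : C) (w : 'I_p -> C) : pt :=
  \row_k match unlift ord0 k with
         | None => a
         | Some k' => match unlift ord0 k' with None => b | Some j => w j end
         end.
Lemma row3_0 a b w : row3 a b w 0 ord0 = a. Proof. by rewrite mxE unlift_none. Qed.
Lemma row3_1 a b w : row3 a b w 0 i1 = b. Proof. by rewrite mxE liftK unlift_none. Qed.
Lemma row3_w a b w j : row3 a b w 0 (iw j) = w j. Proof. by rewrite mxE !liftK. Qed.
Definition row3E := (row3_0, row3_1, row3_w).

Lemma row3P z z' : z 0 ord0 = z' 0 ord0 -> z 0 i1 = z' 0 i1 ->
  (forall j, z 0 (iw j) = z' 0 (iw j)) -> z = z'.
Proof.
move=> h0 h1 hw; apply/rowP => k; case: (unliftP ord0 k) => [k'|] -> //.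
case: (unliftP ord0 k') => [j|] ->; [exact: hw | exact: h1].
Qed.

Lemma big_row3 (S : zmodType) (f : 'I_n.+1 -> S) :
  \sum_k f k = f ord0 + (f i1 + \sum_j f (iw j)).
Proof. by rewrite !big_ord_recl. Qed.

Lemma Lform_row3 z : Lform z =
  normsq (z 0 ord0) - (normsq (z 0 i1) + \sum_j normsq (z 0 (iw j))).
Proof.
rewrite /Lform; congr (_ - _); have := big_row3 (fun k => normsq (z 0 k)).
by rewrite (bigD1 ord0 (P := predT)) //=; apply: addrI.
Qed.

Definition mxof (f : pt -> pt) : 'M[C]_n.+1 := \matrix_(k, l) f (delta_mx 0 l) 0 k.

Lemma act_mxof f z : (forall (a : C) (x y : pt), f (a *: x + y) = a *: f x + f y) ->
  act (mxof f) z = f z.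
Proof.
move=> fl; have f0 : f 0 = 0.
  by have := fl 1 0 0; rewrite !scale1r !addr0 => /eqP; rewrite -subr_eq0 opprD addNKr oppr_eq0 => /eqP.
have fD : {morph f : x y / x + y} by move=> x y; rewrite -[x]scale1r fl !scale1r.
have fZ (a : C) (x : pt) : f (a *: x) = a *: f x by rewrite -[a *: x]addr0 fl f0 addr0.
apply/rowP => k; rewrite {2}(row_sum_delta z) (big_morph f fD f0) summxE mxE.
by apply: eq_bigr => l _; rewrite fZ !mxE.
Qed.

(** In the coordinates (u, v, w) the curve built from this map and [dil2_fun] is (u, (1+t)^2 v,
    (1+t) w). The parameter is 1 + t, not its logarithm, so that the curve is quadratic in [t]. *)
Definition dil1_fun z := row3 (z 0 ord0 - z 0 i1) (z 0 i1 - z 0 ord0) (fun j => z 0 (iw j)).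
Definition dil2_fun z := row3 (2^-1 * (z 0 ord0 - z 0 i1)) (2^-1 * (z 0 i1 - z 0 ord0)) (fun=> 0).
(** Here u goes to conj(b) w_j and w_j to b v. For |b| = 1 the map [nil2_fun] is half the square of
    this one and the cube vanishes, so the quadratic curve is the unipotent one-parameter group
    itself. *)
Definition nil1_fun (b : C) j z :=
  row3 (b^*%C * z 0 (iw j)) (b^*%C * z 0 (iw j)) (fun i => (i == j)%:R * b * (z 0 ord0 - z 0 i1)).
Definition nil2_fun z := row3 (2^-1 * (z 0 ord0 - z 0 i1)) (2^-1 * (z 0 ord0 - z 0 i1)) (fun=> 0).

Lemma act_dil1 z : act (mxof dil1_fun) z = dil1_fun z.
Proof. by apply: act_mxof => a x y; apply: row3P => [||j]; rewrite !(row3E, mxE); ring. Qed.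
Lemma act_dil2 z : act (mxof dil2_fun) z = dil2_fun z.
Proof. by apply: act_mxof => a x y; apply: row3P => [||j]; rewrite !(row3E, mxE); ring. Qed.
Lemma act_nil1 b j z : act (mxof (nil1_fun b j)) z = nil1_fun b j z.
Proof. by apply: act_mxof => a x y; apply: row3P => [||i]; rewrite !(row3E, mxE); ring. Qed.
Lemma act_nil2 z : act (mxof nil2_fun) z = nil2_fun z.
Proof. by apply: act_mxof => a x y; apply: row3P => [||j]; rewrite !(row3E, mxE); ring. Qed.

Lemma actD (g h : 'M[C]_n.+1) z : act (g + h) z = act g z + act h z.
Proof. by rewrite /act linearD mulmxDr. Qed.
Lemma actZ (c : C) (h : 'M[C]_n.+1) z : act (c *: h) z = c *: act h z.
Proof. by rewrite /act linearZ /= -scalemxAr. Qed.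
Lemma act1 z : act 1%:M z = z.
Proof. by rewrite /act trmx1 mulmx1. Qed.

Definition curve (H1 H2 : 'M[C]_n.+1) (t : R) : 'M[C]_n.+1 :=
  1%:M + t%:C%C *: H1 + (t ^+ 2)%:C%C *: H2.

Lemma act_curve H1 H2 t z :
  act (curve H1 H2 t) z = z + t%:C%C *: act H1 z + (t ^+ 2)%:C%C *: act H2 z.
Proof. by rewrite /curve !actD !actZ act1. Qed.

Lemma rmx_curve H1 H2 t :
  rmx (curve H1 H2 t) = 1%:M + t *: rmx H1 + t ^+ 2 *: rmx H2.
Proof. by rewrite /curve !rmxD !rmxZ rmx1. Qed.

Lemma curveE H1 H2 t z (k : 'I_n.+1) : act (curve H1 H2 t) z 0 k =
  z 0 k + t%:C%C * act H1 z 0 k + (t ^+ 2)%:C%C * act H2 z 0 k.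
Proof. by rewrite act_curve mxE [X in X + _]mxE [X in _ + X + _]mxE [X in _ + _ + X]mxE. Qed.

Lemma half_real : (2^-1 : C) = (2^-1)%:C%C.
Proof. by rewrite -(rmorph_nat (real_complex R)) -fmorphV. Qed.

Lemma normsq_dil (t : R) (a b : C) (S : R) :
  normsq (a + t%:C%C * (a - b) + (t ^+ 2)%:C%C * (2^-1 * (a - b))) -
  (normsq (b + t%:C%C * (b - a) + (t ^+ 2)%:C%C * (2^-1 * (b - a))) + (1 + t) ^+ 2 * S) =
  (1 + t) ^+ 2 * (normsq a - (normsq b + S)).
Proof.
rewrite half_real; case: a b => a0 a1 [b0 b1].
rewrite /normsq !(cReD, cReM, cImD, cImM, cReN, cImN) /=; by field.
Qed.

Lemma Lform_dil t z :
  Lform (act (curve (mxof dil1_fun) (mxof dil2_fun) t) z) = (1 + t) ^+ 2 * Lform z.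
Proof.
rewrite !Lform_row3 !curveE act_dil1 act_dil2 !row3E.
rewrite (eq_bigr (fun j => (1 + t) ^+ 2 * normsq (z 0 (iw j)))); last first.
  move=> j _; rewrite curveE act_dil1 act_dil2 !row3E; case: (z 0 (iw j)) => a b.
  by rewrite /normsq !(cReD, cReM, cImD, cImM) /=; ring.
by rewrite -mulr_sumr normsq_dil.
Qed.

Lemma normsq_nil (t : R) (b z0 z1 w : C) (S : R) : normsq b = 1 ->
  normsq (z0 + t%:C%C * (b^*%C * w) + (t ^+ 2)%:C%C * (2^-1 * (z0 - z1))) -
  (normsq (z1 + t%:C%C * (b^*%C * w) + (t ^+ 2)%:C%C * (2^-1 * (z0 - z1))) +
   (normsq (w + t%:C%C * (b * (z0 - z1))) + S)) =
  normsq z0 - (normsq z1 + (normsq w + S)).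
Proof.
rewrite half_real; case: b z0 z1 w => b0 b1 [a0 a1] [c0 c1] [w0 w1].
rewrite /normsq !(cReD, cReM, cImD, cImM, cReN, cImN) /= => E.
transitivity (a0 ^+ 2 + a1 ^+ 2 - (c0 ^+ 2 + c1 ^+ 2 + (w0 ^+ 2 + w1 ^+ 2 + S)) +
  t ^+ 2 * ((a0 - c0) ^+ 2 + (a1 - c1) ^+ 2) * (1 - (b0 ^+ 2 + b1 ^+ 2))).
  by field.
by rewrite E subrr mulr0 addr0.
Qed.

Lemma Lform_nil (b : C) j t z : normsq b = 1 ->
  Lform (act (curve (mxof (nil1_fun b j)) (mxof nil2_fun) t) z) = Lform z.
Proof.
move=> b1; rewrite !Lform_row3 !curveE act_nil1 act_nil2 !row3E.
rewrite (bigD1 j) //= [in RHS](bigD1 j) //= (eq_bigr (fun j => normsq (z 0 (iw j)))); last first.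
  move=> i /negbTE ij; rewrite curveE act_nil1 act_nil2 !row3E ij.
  by rewrite !mul0r !mulr0 !addr0.
rewrite curveE act_nil1 act_nil2 !row3E eqxx !mul1r mulr0 addr0.
exact: normsq_nil.
Qed.

Definition zbase : pt := row3 1 1 (fun=> 0).
Lemma zbase_neq0 : zbase != 0.
Proof.
apply/eqP => /rowP/(_ ord0); rewrite row3_0 mxE => /eqP; by rewrite oner_eq0.
Qed.
Lemma realify_zbase_neq0 : realify zbase != 0.
Proof. by rewrite realify_eq0 zbase_neq0. Qed.

Lemma act_zbase_dil1 : act (mxof dil1_fun) zbase = 0.
Proof. by rewrite act_dil1; apply: row3P => [||j]; rewrite !row3E mxE ?subrr. Qed.
Lemma act_zbase_dil2 : act (mxof dil2_fun) zbase = 0.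
Proof. by rewrite act_dil2; apply: row3P => [||j]; rewrite !row3E mxE ?subrr ?mulr0. Qed.
Lemma act_zbase_nil1 b j : act (mxof (nil1_fun b j)) zbase = 0.
Proof. by rewrite act_nil1; apply: row3P => [||i]; rewrite !row3E mxE ?subrr ?mulr0. Qed.
Lemma act_zbase_nil2 : act (mxof nil2_fun) zbase = 0.
Proof. by rewrite act_nil2; apply: row3P => [||j]; rewrite !row3E mxE ?subrr ?mulr0. Qed.

(** With the factor 1/2, u is 1 at the base point and the form becomes u vb + ub v - sum w_j
    wb_j. *)
Definition uc : cinf := cst 2^-1 * (zc ord0 + zc i1).
Definition ub : cinf := cst 2^-1 * (zb ord0 + zb i1).
Definition vc : cinf := zc ord0 - zc i1.
Definition vb : cinf := zb ord0 - zb i1.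
Definition wc j : cinf := zc (iw j).
Definition wb j : cinf := zb (iw j).

Section Values.
Variable z : pt.
Hypothesis z0 : z != 0.
Let x0 : realify z != 0. Proof. by rewrite realify_eq0. Qed.

Lemma ucE : uc (realify z) = 2^-1 * (z 0 ord0 + z 0 i1).
Proof. by rewrite /uc (sE_M (cst _)) (sE_cst _ x0) (sE_D (zc _)) (zcE ord0 z0) (zcE i1 z0). Qed.
Lemma ubE : ub (realify z) = 2^-1 * (((z 0 ord0)^*)%C + ((z 0 i1)^*)%C).
Proof. by rewrite /ub (sE_M (cst _)) (sE_cst _ x0) (sE_D (zb _)) (zbE ord0 z0) (zbE i1 z0). Qed.
Lemma vcE : vc (realify z) = z 0 ord0 - z 0 i1.
Proof. by rewrite /vc (sE_D (zc _)) (sE_N (zc _)) (zcE ord0 z0) (zcE i1 z0). Qed.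
Lemma vbE : vb (realify z) = ((z 0 ord0)^*)%C - ((z 0 i1)^*)%C.
Proof. by rewrite /vb (sE_D (zb _)) (sE_N (zb _)) (zbE ord0 z0) (zbE i1 z0). Qed.
Lemma wcE j : wc j (realify z) = z 0 (iw j).
Proof. by rewrite /wc (zcE _ z0). Qed.
Lemma wbE j : wb j (realify z) = ((z 0 (iw j))^*)%C.
Proof. by rewrite /wb (zbE _ z0). Qed.

Variable (h : 'M[C]_n.+1).
Local Notation Y := (field (rmx h)).
Lemma field_uc : Y uc (realify z) = 2^-1 * (act h z 0 ord0 + act h z 0 i1).
Proof.
rewrite /uc (fieldM _ (cst _)) field_cst mul0r add0r (fieldD _ (zc _)).
rewrite (sE_M (cst _)) (sE_cst _ x0) (sE_D (Y _)).
by exact (congr1 (fun t => 2^-1 * t) (congr2 +%R (field_zc h ord0 z0) (field_zc h i1 z0))).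
Qed.
Lemma field_ub : Y ub (realify z) = 2^-1 * ((act h z 0 ord0)^*%C + (act h z 0 i1)^*%C).
Proof.
rewrite /ub (fieldM _ (cst _)) field_cst mul0r add0r (fieldD _ (zb _)).
rewrite (sE_M (cst _)) (sE_cst _ x0) (sE_D (Y _)).
by exact (congr1 (fun t => 2^-1 * t) (congr2 +%R (field_zb h ord0 z0) (field_zb h i1 z0))).
Qed.
Lemma field_vc : Y vc (realify z) = act h z 0 ord0 - act h z 0 i1.
Proof.
rewrite /vc (fieldB _ (zc _)) (sE_D (Y _)) (sE_N (Y _)).
by exact (congr2 (fun s t => s - t) (field_zc h ord0 z0) (field_zc h i1 z0)).
Qed.
Lemma field_vb : Y vb (realify z) = (act h z 0 ord0)^*%C - (act h z 0 i1)^*%C.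
Proof.
rewrite /vb (fieldB _ (zb _)) (sE_D (Y _)) (sE_N (Y _)).
by exact (congr2 (fun s t => s - t) (field_zb h ord0 z0) (field_zb h i1 z0)).
Qed.
Lemma field_wc j : Y (wc j) (realify z) = act h z 0 (iw j).
Proof. by rewrite /wc (field_zc _ _ z0). Qed.
Lemma field_wb j : Y (wb j) (realify z) = (act h z 0 (iw j))^*%C.
Proof. by rewrite /wb (field_zb _ _ z0). Qed.
End Values.

Local Notation YD := (field (rmx (mxof dil1_fun))).
Local Notation YN b j := (field (rmx (mxof (nil1_fun b j)))).

Lemma conjcD (a b : C) : (a + b)^*%C = a^*%C + b^*%C. Proof. exact: rmorphD. Qed.
Lemma conjcB (a b : C) : (a - b)^*%C = a^*%C - b^*%C. Proof. exact: rmorphB. Qed.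
Lemma conjcM (a b : C) : (a * b)^*%C = a^*%C * b^*%C. Proof. exact: rmorphM. Qed.

Lemma dil_uc : YD uc = 0.
Proof.
apply: cinf_realifyP => z z0; rewrite (field_uc z0) sE_0 act_dil1 !row3E.
by rewrite addrC subrKA subrr mulr0.
Qed.
Lemma dil_ub : YD ub = 0.
Proof.
apply: cinf_realifyP => z z0; rewrite (field_ub z0) sE_0 act_dil1 !row3E.
by rewrite !conjcB addrC subrKA subrr mulr0.
Qed.
Lemma dil_vc : YD vc = 2%:R * vc.
Proof.
apply: cinf_realifyP => z z0; rewrite (field_vc z0) mulr_natl mulr2n (sE_D vc) (vcE z0).
by rewrite act_dil1 !row3E opprB.
Qed.
Lemma dil_vb : YD vb = 2%:R * vb.
Proof.
apply: cinf_realifyP => z z0; rewrite (field_vb z0) mulr_natl mulr2n (sE_D vb) (vbE z0).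
by rewrite act_dil1 !row3E !conjcB opprB.
Qed.
Lemma dil_wc j : YD (wc j) = wc j.
Proof. by apply: cinf_realifyP => z z0; rewrite (field_wc z0) (wcE z0) act_dil1 !row3E. Qed.
Lemma dil_wb j : YD (wb j) = wb j.
Proof. by apply: cinf_realifyP => z z0; rewrite (field_wb z0) (wbE z0) act_dil1 !row3E. Qed.

Lemma half2 (a : C) : 2^-1 * (a + a) = a.
Proof. by field. Qed.

Lemma nil_uc b j : YN b j uc = cst b^*%C * wc j.
Proof.
apply: cinf_realifyP => z z0; rewrite (field_uc z0) (sE_M (cst _)) sE_cst ?realify_eq0 //.
by rewrite (wcE z0) act_nil1 !row3E half2.
Qed.
Lemma nil_ub b j : YN b j ub = cst b * wb j.
Proof.
apply: cinf_realifyP => z z0; rewrite (field_ub z0) (sE_M (cst _)) sE_cst ?realify_eq0 //.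
by rewrite (wbE z0) act_nil1 !row3E conjcM conjcK half2.
Qed.
Lemma nil_vc b j : YN b j vc = 0.
Proof. by apply: cinf_realifyP => z z0; rewrite (field_vc z0) sE_0 act_nil1 !row3E subrr. Qed.
Lemma nil_vb b j : YN b j vb = 0.
Proof. by apply: cinf_realifyP => z z0; rewrite (field_vb z0) sE_0 act_nil1 !row3E subrr. Qed.
Lemma nil_wc b j i : YN b j (wc i) = cst ((i == j)%:R * b) * vc.
Proof.
apply: cinf_realifyP => z z0; rewrite (field_wc z0) (sE_M (cst _)) sE_cst ?realify_eq0 //.
by rewrite (vcE z0) act_nil1 !row3E.
Qed.
Lemma nil_wb b j i : YN b j (wb i) = cst ((i == j)%:R * b^*%C) * vb.
Proof.
apply: cinf_realifyP => z z0; rewrite (field_wb z0) (sE_M (cst _)) sE_cst ?realify_eq0 //.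
by rewrite (vbE z0) act_nil1 !row3E 2!conjcM conjcB conjc_nat.
Qed.

(** The fields [YN b j] depend on [b] through a linear and a conjugate linear part. The combinations
    of [b = 1] and [b = 'i] in [dN] and [dbN] separate the two, giving the complex nilpotent
    fields. *)
Definition dN j F : cinf := cst 2^-1 * (YN 1 j F - cst 'i%C * YN 'i%C j F).
Definition dbN j F : cinf := cst 2^-1 * (YN 1 j F + cst 'i%C * YN 'i%C j F).

Lemma dNM j F G : dN j (F * G) = dN j F * G + F * dN j G.
Proof.
rewrite /dN !fieldM; move: (YN 1 j F) (YN 1 j G) (YN 'i%C j F) (YN 'i%C j G) => a b c d.
by move: (cst 2^-1) (cst 'i%C) => h t; ring.
Qed.
Lemma dbNM j F G : dbN j (F * G) = dbN j F * G + F * dbN j G.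
Proof.
rewrite /dbN !fieldM; move: (YN 1 j F) (YN 1 j G) (YN 'i%C j F) (YN 'i%C j G) => a b c d.
by move: (cst 2^-1) (cst 'i%C) => h t; ring.
Qed.

Lemma sqri : ('i%C * 'i%C : C) = -1. Proof. by rewrite -expr2 sqr_i. Qed.
Lemma dN_comb (a b : C) G : cst 2^-1 * (cst a * G - cst 'i%C * (cst b * G)) =
  cst (2^-1 * (a - 'i%C * b)) * G.
Proof. by rewrite rmorphM rmorphB (rmorphM cst 'i%C); ring. Qed.
Lemma dbN_comb (a b : C) G : cst 2^-1 * (cst a * G + cst 'i%C * (cst b * G)) =
  cst (2^-1 * (a + 'i%C * b)) * G.
Proof. by rewrite rmorphM rmorphD (rmorphM cst 'i%C); ring. Qed.

Lemma conjci : ('i^*)%C = - 'i%C :> C. Proof. by apply: complexP; rewrite /= ?oppr0. Qed.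
Lemma conjc1 : (1^*)%C = 1 :> C. Proof. exact: rmorph1. Qed.

Lemma dN_uc j : dN j uc = 0.
Proof.
by rewrite /dN !nil_uc dN_comb conjc1 conjci mulrN sqri opprK subrr mulr0 rmorph0 mul0r.
Qed.
Lemma dN_ub j : dN j ub = wb j.
Proof. by rewrite /dN !nil_ub dN_comb sqri opprK half2 rmorph1 mul1r. Qed.
Lemma dN_vc j : dN j vc = 0.
Proof. by rewrite /dN !nil_vc mulr0 subr0 mulr0. Qed.
Lemma dN_vb j : dN j vb = 0.
Proof. by rewrite /dN !nil_vb mulr0 subr0 mulr0. Qed.
Lemma dN_wc j i : dN j (wc i) = (i == j)%:R * vc.
Proof.
rewrite /dN !nil_wc dN_comb mulr1 mulrCA sqri mulrN1 opprK half2; congr (_ * _).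
by rewrite rmorph_nat.
Qed.
Lemma dN_wb j i : dN j (wb i) = 0.
Proof.
rewrite /dN !nil_wb dN_comb conjc1 conjci mulr1 mulrCA mulrN sqri opprK mulr1.
by rewrite subrr mulr0 rmorph0 mul0r.
Qed.

Lemma dbN_ub j : dbN j ub = 0.
Proof. by rewrite /dbN !nil_ub dbN_comb sqri subrr mulr0 rmorph0 mul0r. Qed.
Lemma dbN_uc j : dbN j uc = wc j.
Proof. by rewrite /dbN !nil_uc dbN_comb conjc1 conjci mulrN sqri opprK half2 rmorph1 mul1r. Qed.
Lemma dbN_vc j : dbN j vc = 0.
Proof. by rewrite /dbN !nil_vc mulr0 addr0 mulr0. Qed.
Lemma dbN_vb j : dbN j vb = 0.
Proof. by rewrite /dbN !nil_vb mulr0 addr0 mulr0. Qed.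
Lemma dbN_wb j i : dbN j (wb i) = (i == j)%:R * vb.
Proof.
rewrite /dbN !nil_wb dbN_comb conjc1 conjci mulr1 mulrCA mulrN sqri opprK mulr1 half2.
by congr (_ * _); rewrite rmorph_nat.
Qed.
Lemma dbN_wc j i : dbN j (wc i) = 0.
Proof.
by rewrite /dbN !nil_wc dbN_comb mulr1 mulrCA sqri mulrN1 subrr mulr0 rmorph0 mul0r.
Qed.
End HeisenbergCoordinates.

(** * Quotient rule modulo an ideal, and the degree zero generators *)

Section Congruences.
Variables (A : comNzRingType) (K : A -> Prop) (d : A -> A).
Hypothesis KB : forall F G, K F -> K G -> K (F - G).
Hypothesis KM : forall F G, K G -> K (F * G).
Hypothesis dM : forall F G, d (F * G) = d F * G + F * d G.
Variables (u psi : A).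
Hypothesis upsi : K (u * psi - 1).
Hypothesis dupsi : K (d (u * psi)).

Lemma d_quotient a : K (d (a * psi) - (d a * psi - d u * psi * (a * psi))).
Proof.
have -> : d (a * psi) - (d a * psi - d u * psi * (a * psi)) =
    a * (psi * d (u * psi)) - a * d psi * (u * psi - 1).
  by rewrite !dM; move: (d a) (d u) (d psi) => *; ring.
by apply: KB; apply: KM => //; apply: KM.
Qed.
End Congruences.

Section Generators.
Variables (R : realType) (p : nat).
Local Opaque der scst scoord sadd smul sopp mkS field zc zb uc ub vc vb wc wb.
Local Notation n := p.+1.
Local Notation C := R[i].
Local Notation cinf := (cinf R n).
Local Notation inN := (@inN R n).
Local Notation pt := (pt R n).
Local Notation x0 := (realify (zbase R p)).
Local Notation uc := (@uc R p).
Local Notation ub := (@ub R p).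
Local Notation vc := (@vc R p).
Local Notation vb := (@vb R p).
Local Notation wc := (@wc R p).
Local Notation wb := (@wb R p).
Implicit Types (F G : cinf) (z : pt).

Lemma ub_conj z : z != 0 -> ub (realify z) = (uc (realify z))^*%C.
Proof. by move=> z0; rewrite (ubE z0) (ucE z0) conjcM conjcD half_real conjc_real. Qed.
Lemma vb_conj z : z != 0 -> vb (realify z) = (vc (realify z))^*%C.
Proof. by move=> z0; rewrite (vbE z0) (vcE z0) conjcB. Qed.
Lemma wb_conj j z : z != 0 -> wb j (realify z) = (wc j (realify z))^*%C.
Proof. by move=> z0; rewrite (wbE z0) (wcE z0). Qed.

Lemma mulJ_normsq (a : C) : a * a^*%C = (normsq a)%:C%C.
Proof. by case: a => a b; apply: complexP => /=; rewrite /normsq /=; ring. Qed.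

Lemma uv_eq0 z : z != 0 -> uc (realify z) = 0 -> vc (realify z) = 0 ->
  (forall j, wc j (realify z) = 0) -> False.
Proof.
move=> z0 u0 v0 w0; move/eqP: (z0); apply.
have e : z 0 ord0 = z 0 (i1 p).
  by apply/eqP; rewrite -subr_eq0; apply/eqP; rewrite -(vcE z0).
have e0 : z 0 (i1 p) = 0 by rewrite -[LHS]half2 -{1}e -(ucE z0).
apply: row3P => [||j]; rewrite mxE ?e //.
by rewrite -(wcE z0).
Qed.

Definition hnorm : cinf := uc * ub + vc * vb + \sum_j wc j * wb j.

Lemma hnormE z : z != 0 -> hnorm (realify z) =
  (normsq (uc (realify z)) + normsq (vc (realify z)) +
   \sum_j normsq (wc j (realify z)))%:C%C.
Proof.
move=> z0; rewrite /hnorm (sE_D (_ + _)) (sE_D (uc * _)) (sE_M uc) (sE_M vc) sE_sum.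
rewrite (ub_conj z0) (vb_conj z0) 2!rmorphD rmorph_sum !mulJ_normsq; congr (_ + _).
by apply: eq_bigr => j _; rewrite (sE_M (wc j)) (wb_conj j z0) mulJ_normsq.
Qed.

Lemma normsq_ge0 (a : C) : 0 <= normsq a.
Proof. by rewrite /normsq addr_ge0 // sqr_ge0. Qed.

Lemma realC_eq0 (a : R) : ((a%:C%C : C) == 0) = (a == 0).
Proof. by rewrite -(rmorph0 (real_complex R)) (inj_eq (@complexI R)). Qed.

Lemma hnorm_neq0 (x : 'rV[R]_(rdim n)) : x != 0 -> hnorm x != 0.
Proof.
rewrite -(cplxK x) realify_eq0 => z0; rewrite hnormE // realC_eq0.
apply/eqP => H.
have S0 : 0 <= \sum_j normsq (wc j (realify (cplx x))) by apply: sumr_ge0 => j _; exact: normsq_ge0.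
have a0 := normsq_ge0 (uc (realify (cplx x))); have b0 := normsq_ge0 (vc (realify (cplx x))).
have ua : normsq (uc (realify (cplx x))) = 0 by move: a0 b0 S0 H; lra.
have va : normsq (vc (realify (cplx x))) = 0 by move: a0 b0 S0 H; lra.
move/eqP: ua va; rewrite normsq_eq0 => /eqP u0 /eqP; rewrite normsq_eq0 => /eqP v0.
have : \sum_j normsq (wc j (realify (cplx x))) == 0 by apply/eqP; move: a0 b0 S0 H; lra.
rewrite psumr_eq0 => [|j _]; last exact: normsq_ge0.
move=> /allP W; apply: (uv_eq0 z0) => // j.
by have := W j (mem_index_enum j); rewrite normsq_eq0 => /eqP.
Qed.

Definition hinv : cinf := sval (cid (sfun_inv hnorm_neq0)).
Lemma hinvE : hnorm * hinv = 1. Proof. by rewrite /hinv; case: cid. Qed.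
Lemma hinv_val x : x != 0 -> hinv x = (hnorm x)^-1.
Proof.
move=> x0; apply: (mulfI (hnorm_neq0 x0)); rewrite mulfV ?hnorm_neq0 //.
by rewrite -(sE_M hnorm hinv) hinvE sE_1.
Qed.

Variable (M : nat).
(* 1/u is not smooth on the whole space; psi is a smooth substitute of the same homogeneity, with u psi = 1 modulo jets of order M at the base point. *)
Definition rho : cinf := uc * ub * hinv.
(** The truncated geometric series of 1/rho; [rho] is 1 at the base point, has degree zero, and is
    smooth where u vanishes. *)
Definition geo : cinf := \sum_(i < M) (1 - rho) ^+ i.
Definition psi : cinf := ub * hinv * geo.
Definition psib : cinf := uc * hinv * geo.

Lemma rho_geo : rho * geo = 1 - (1 - rho) ^+ M.
Proof.
have := subrX1 (1 - rho) M; rewrite -/geo; move: rho geo ((1 - rho) ^+ M) => c b a E.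
by rewrite -[1 - a]opprB E; ring.
Qed.
Lemma uc_psi : uc * psi = 1 - (1 - rho) ^+ M.
Proof. by rewrite -rho_geo /psi /rho; move: geo hinv uc ub => *; ring. Qed.
Lemma ub_psib : ub * psib = 1 - (1 - rho) ^+ M.
Proof. by rewrite -rho_geo /psib /rho; move: geo hinv uc ub => *; ring. Qed.

Let zb0 := zbase_neq0 R p.
Lemma uc_base : uc x0 = 1.
Proof. by rewrite (ucE zb0) row3_0 row3_1 half2. Qed.
Lemma ub_base : ub x0 = 1.
Proof. by rewrite (ub_conj zb0) uc_base conjc1. Qed.
Lemma vc_base : vc x0 = 0.
Proof. by rewrite (vcE zb0) row3_0 row3_1 subrr. Qed.
Lemma wc_base j : wc j x0 = 0.
Proof. by rewrite (wcE zb0) row3_w. Qed.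
Lemma hnorm_base : hnorm x0 = 1.
Proof.
rewrite (hnormE zb0) uc_base vc_base big1 => [|j _]; last first.
  by rewrite wc_base /normsq /= expr0n addr0.
by apply: complexP; rewrite /normsq /= ?expr0n /= ?expr1n ?addr0.
Qed.
Lemma rho_base : rho x0 = 1.
Proof.
rewrite /rho (sE_M (uc * ub)) (sE_M uc) uc_base ub_base hinv_val ?realify_zbase_neq0 //.
by rewrite hnorm_base invr1 !mulr1.
Qed.

Local Notation Jt := (J (@der R n) (vanish x0)).
Lemma J_rho : Jt M ((1 - rho) ^+ M).
Proof.
apply: (JX (@d_B R n) (@derM R n) (vanish0 _) (@vanishB R n x0) (@vanishM R n x0)).
by rewrite /vanish (sE_D 1) (sE_N rho) sE_1 ?realify_zbase_neq0 // rho_base subrr.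
Qed.

Section Scaling.
Variables (z : pt) (l : C).
Hypotheses (z0 : z != 0) (l0 : l != 0).
Let lz0 : l *: z != 0. Proof. by rewrite scaler_eq0 negb_or l0. Qed.
Local Notation at_ F := (F (realify z)).
Local Notation at_l F := (F (realify (l *: z))).

Lemma uc_scale : at_l uc = l * at_ uc.
Proof. by rewrite (ucE z0) (ucE lz0) !mxE; ring. Qed.
Lemma vc_scale : at_l vc = l * at_ vc.
Proof. by rewrite (vcE z0) (vcE lz0) !mxE; ring. Qed.
Lemma wc_scale j : at_l (wc j) = l * at_ (wc j).
Proof. by rewrite (wcE z0 j) (wcE lz0 j) !mxE. Qed.
Lemma ub_scale : at_l ub = l^*%C * at_ ub.
Proof. by rewrite (ub_conj z0) (ub_conj lz0) uc_scale conjcM. Qed.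
Lemma vb_scale : at_l vb = l^*%C * at_ vb.
Proof. by rewrite (vb_conj z0) (vb_conj lz0) vc_scale conjcM. Qed.
Lemma wb_scale j : at_l (wb j) = l^*%C * at_ (wb j).
Proof. by rewrite (wb_conj j z0) (wb_conj j lz0) wc_scale conjcM. Qed.
Lemma hnorm_scale : at_l hnorm = (normsq l)%:C%C * at_ hnorm.
Proof.
have E : \sum_j normsq (at_l (wc j)) = normsq l * \sum_j normsq (at_ (wc j)).
  by rewrite mulr_sumr; apply: eq_bigr => j _; rewrite wc_scale normsqM.
rewrite (hnormE z0) (hnormE lz0) -rmorphM uc_scale vc_scale 2!normsqM E.
move: (normsq l) (normsq _) (normsq _) (\sum_j _) => a b c d.
by congr (_%:C%C); ring.
Qed.
Lemma hinv_scale : at_l hinv = (l * l^*%C)^-1 * at_ hinv.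
Proof.
by rewrite !hinv_val ?realify_eq0 // hnorm_scale invfM mulJ_normsq.
Qed.
Lemma conj_neq0 : l^*%C != 0. Proof. by rewrite conjc_eq0. Qed.
Lemma rho_scale : at_l rho = at_ rho.
Proof.
rewrite /rho !(sE_M (uc * ub)) !(sE_M uc) uc_scale ub_scale hinv_scale.
have lb0 := conj_neq0; move: (at_ uc) (at_ ub) (at_ hinv) => a b c; by field; rewrite lb0.
Qed.
Lemma geo_scale : at_l geo = at_ geo.
Proof.
rewrite /geo !sE_sum; apply: eq_bigr => i _.
by rewrite !sE_X ?realify_eq0 // !(sE_D 1) !(sE_N rho) !sE_1 ?realify_eq0 // rho_scale.
Qed.
Lemma psi_scale : at_l psi = l^-1 * at_ psi.
Proof.
rewrite /psi !(sE_M (ub * hinv)) !(sE_M ub) ub_scale hinv_scale geo_scale.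
have lb0 := conj_neq0; move: (at_ geo) (at_ ub) (at_ hinv) => a b c; field; by rewrite ?l0 ?lb0.
Qed.
Lemma psib_scale : at_l psib = (l^*%C)^-1 * at_ psib.
Proof.
rewrite /psib !(sE_M (uc * hinv)) !(sE_M uc) uc_scale hinv_scale geo_scale.
have lb0 := conj_neq0; move: (at_ geo) (at_ uc) (at_ hinv) => a b c; field; by rewrite ?l0 ?lb0.
Qed.
End Scaling.

Definition Xg j : cinf := wc j * psi.
Definition Xbg j : cinf := wb j * psib.
Definition Vg : cinf := vc * psi.
Definition Vbg : cinf := vb * psib.

Lemma cinvM F G : cinv F -> cinv G -> cinv (F * G).
Proof. by move=> hF hG z l hz l0; rewrite !(sE_M F G) hF // hG. Qed.
Lemma cinv1 : cinv (1 : cinf).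
Proof.
by move=> z l [hz _] l0; rewrite !sE_1 ?realify_eq0 // scaler_eq0 negb_or l0.
Qed.
Lemma cinvX F m : cinv F -> cinv (F ^+ m).
Proof. by move=> hF; elim: m => [|m IH]; rewrite ?exprS; [exact: cinv1 | exact: cinvM]. Qed.
Lemma cinv_prod (T : Type) (r : seq T) (f : T -> cinf) :
  (forall t, cinv (f t)) -> cinv (\prod_(t <- r) f t).
Proof. by move=> hf; elim/big_rec: _ => [|t F _ hF]; [exact: cinv1 | exact: cinvM]. Qed.

Lemma cinv_Xg j : cinv (Xg j).
Proof.
move=> z l [hz _] l0; rewrite /Xg !(sE_M (wc j)) wc_scale // psi_scale //.
by rewrite mulrACA mulfV // mul1r.
Qed.
Lemma cinv_Xbg j : cinv (Xbg j).
Proof.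
move=> z l [hz _] l0; rewrite /Xbg !(sE_M (wb j)) wb_scale // psib_scale //.
by rewrite mulrACA mulfV ?conjc_eq0 // mul1r.
Qed.
Lemma cinv_Vg : cinv Vg.
Proof.
move=> z l [hz _] l0; rewrite /Vg !(sE_M vc) vc_scale // psi_scale //.
by rewrite mulrACA mulfV // mul1r.
Qed.
Lemma cinv_Vbg : cinv Vbg.
Proof.
move=> z l [hz _] l0; rewrite /Vbg !(sE_M vb) vb_scale // psib_scale //.
by rewrite mulrACA mulfV ?conjc_eq0 // mul1r.
Qed.
Lemma cinv_mon s t a b : cinv (mon Xg Xbg Vg Vbg s t a b).
Proof.
apply: cinvM; apply: cinvM; [apply: cinv_prod|apply: cinv_prod|apply: cinvX|apply: cinvX].
- exact: cinv_Xg.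
- exact: cinv_Xbg.
- exact: cinv_Vg.
- exact: cinv_Vbg.
Qed.

Definition cone_fun : cinf := uc * vb + ub * vc - \sum_j wc j * wb j.
Lemma inN_cone : inN cone_fun.
Proof.
apply/inNP => z [hz Lz]; rewrite /cone_fun (sE_D (_ + _)) (sE_N (\sum_j _)) (sE_D (uc * _)).
rewrite (sE_M uc) (sE_M ub) sE_sum (ucE hz) (ubE hz) (vcE hz) (vbE hz).
rewrite (eq_bigr (fun j => (normsq (z 0 (iw j)))%:C%C)) => [|j _]; last first.
  by rewrite (sE_M (wc j)) (wb_conj j hz) (wcE hz j) mulJ_normsq.
rewrite -rmorph_sum; transitivity ((Lform z)%:C%C : C); last by rewrite Lz.
rewrite Lform_row3 opprD addrA rmorphB [X in _ = X - _]rmorphB; congr (_ - _).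
transitivity (z 0 ord0 * (z 0 ord0)^*%C - z 0 (i1 p) * (z 0 (i1 p))^*%C).
  by move: (z 0 ord0) ((z 0 ord0)^*%C) (z 0 (i1 p)) ((z 0 (i1 p))^*%C) => a b c d; field.
by rewrite !mulJ_normsq.
Qed.
End Generators.

(** * Invariant functionals on the generators *)

Section FunctionalVanishing.
Variables (R : realType) (p : nat).
Hypothesis p_gt0 : (0 < p)%N.
Local Opaque der scst scoord sadd smul sopp mkS field zc zb uc ub vc vb wc wb.
Local Notation n := p.+1.
Local Notation I := 'I_(rdim n).
Local Notation C := R[i].
Local Notation cinf := (cinf R n).
Local Notation cst := (@scst R n).
Local Notation inN := (@inN R n).
Local Notation pt := (pt R n).
Local Notation d_ := (@der R n).
Local Notation zbase := (@zbase R p).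
Local Notation x0 := (realify zbase).
Local Notation uc := (@uc R p).
Local Notation ub := (@ub R p).
Local Notation vc := (@vc R p).
Local Notation vb := (@vb R p).
Local Notation wc := (@wc R p).
Local Notation wb := (@wb R p).
Local Notation YD := (field (rmx (mxof (@dil1_fun R p)))).
Local Notation YN b j := (field (rmx (mxof (@nil1_fun R p b j)))).
Implicit Types (F G : cinf) (z : pt).

Variables (Lam : cinf -> C) (S : seq (seq I * C)) (M0 : nat).
Hypothesis LamE : forall G, Lam G = \sum_(q <- S) q.2 * derw q.1 G x0.
Hypothesis Ssize : forall q, q \in S -> (size q.1 < M0)%N.
Hypothesis LamN : forall F, inN F -> Lam F = 0.
Hypothesis LamH : forall (h : 'M[C]_n.+1) (c : R) F, 0 < c ->
  (forall z, Lform (act h z) = c * Lform z) -> act h zbase = zbase -> cinv F ->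
  Lam (pull (rmx h) F) = (c ^+ n)%:C%C * Lam F.

Local Notation M := M0.+1.
Local Notation Xg := (@Xg R p M).
Local Notation Xbg := (@Xbg R p M).
Local Notation Vg := (@Vg R p M).
Local Notation Vbg := (@Vbg R p M).
Local Notation psi := (@psi R p M).
Local Notation psib := (@psib R p M).
Local Notation rho := (@rho R p).
Local Notation Jt := (J d_ (vanish x0)).
Local Notation K := (kerI Lam).

Lemma functionalB F G : Lam (F - G) = Lam F - Lam G.
Proof.
rewrite !LamE -sumrB; apply: eq_bigr => q _.
by rewrite derwB (sE_D (derw _ _)) (sE_N (derw _ _)) mulrBr.
Qed.
Lemma functional_cstM c F : Lam (cst c * F) = c * Lam F.
Proof.
rewrite !LamE mulr_sumr; apply: eq_bigr => q _.
by rewrite derw_cstM (sE_M (cst _)) sE_cst ?realify_zbase_neq0 // mulrCA.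
Qed.

Let JMl' := JMl (@d_B R n) (@derM R n) (vanish0 x0) (@vanishB R n x0) (@vanishM R n x0).

Lemma J_kerI F : Jt M0 F -> K F.
Proof.
move=> hF G; have hGF : Jt M0 (G * F) by apply: JMl'.
rewrite LamE big_seq big1 // => q /Ssize qM.
by rewrite J_derw_vanish ?mulr0 //; apply: J_le hGF.
Qed.
Lemma inN_kerI F : inN F -> K F.
Proof. by move=> hF G; apply: LamN; apply: inNM. Qed.

(** Positivity of [c] is required for [t >= 0] only: the dilation curve degenerates at [t = -1], and
    [lie_invariance] asks for natural parameters. *)
Lemma field_invariance H1 H2 (c : R -> R) (q : {poly R}) F :
  (forall t, 0 <= t -> 0 < c t) ->
  (forall t z, Lform (act (curve H1 H2 t) z) = c t * Lform z) ->
  act H1 zbase = 0 -> act H2 zbase = 0 -> (forall t, c t ^+ n = q.[t]) ->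
  cinv F -> Lam (field (rmx H1) F) = (q`_1)%:C%C * Lam F.
Proof.
move=> cpos HL H10 H20 cq hF.
apply: (@lie_invariance R n x0 (realify_zbase_neq0 R p) (rmx H1) (rmx H2) _ _ S Lam F q LamE).
- by rewrite -realify_act H10 realify0.
- by rewrite -realify_act H20 realify0.
move=> m; have c0 := cpos m%:R (ler0n R m); rewrite -rmx_curve; split.
  by apply: similitude_unit (similitude_act (lt0r_neq0 c0) (HL m%:R)).
rewrite -cq; apply: (LamH c0 (HL m%:R) _ hF).
by rewrite act_curve H10 H20 !scaler0 !addr0.
Qed.

(** The dilation multiplies the form by (1+t)^2, hence the functional by (1+t)^(2n), whose linear
    coefficient is the weight 2n. *)
Lemma Lam_dil F : cinv F -> Lam (YD F) = (2 * p.+1)%:R * Lam F.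
Proof.
move=> hF; rewrite (@field_invariance _ (mxof (@dil2_fun R p)) (fun t => (1 + t) ^+ 2)
  (('X + 1%:P) ^+ (2 * n)) F) //.
- congr (_ * _); rewrite -(rmorph_nat (real_complex R)); congr (_ %:C%C).
  have := coef_deriv (('X + 1%:P : {poly R}) ^+ (2 * n)) 0; rewrite mulr1n => <-.
  rewrite -horner_coef0 deriv_exp derivD derivX derivC addr0 mul1r hornerMn.
  by rewrite horner_exp hornerD hornerX hornerC add0r expr1n.
- by move=> t t0; rewrite exprn_gt0 // ltr_pwDl.
- by move=> t z; exact: Lform_dil.
- exact: act_zbase_dil1.
- exact: act_zbase_dil2.
- by move=> t; rewrite horner_exp hornerD hornerX hornerC -exprM addrC.
Qed.

Lemma Lam_nil b j F : normsq b = 1 -> cinv F -> Lam (YN b j F) = 0.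
Proof.
move=> b1 hF; rewrite (@field_invariance _ (mxof (@nil2_fun R p)) (fun=> 1) 1%:P F) //.
- by rewrite coefC /= mul0r.
- by move=> t z; rewrite mul1r; exact: Lform_nil.
- exact: act_zbase_nil1.
- exact: act_zbase_nil2.
- by move=> t; rewrite hornerC expr1n.
Qed.

Lemma normsq1 : normsq (1 : C) = 1.
Proof. by rewrite /normsq /= expr1n expr0n addr0. Qed.
Lemma normsqi : normsq ('i%C : C) = 1.
Proof. by rewrite /normsq /= expr1n expr0n add0r. Qed.

Lemma Lam_dN j F : cinv F -> Lam (dN j F) = 0.
Proof.
move=> hF; rewrite /dN functional_cstM functionalB functional_cstM.
by rewrite [X in X - _](Lam_nil j normsq1 hF) (Lam_nil j normsqi hF) mulr0 subrr mulr0.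
Qed.
Lemma Lam_dbN j F : cinv F -> Lam (dbN j F) = 0.
Proof.
move=> hF; rewrite /dbN functional_cstM (LamD functionalB) functional_cstM.
by rewrite [X in X + _](Lam_nil j normsq1 hF) (Lam_nil j normsqi hF) mulr0 addr0 mulr0.
Qed.

Lemma kerI_uc_psi : K (uc * psi - 1).
Proof.
apply: J_kerI; rewrite uc_psi addrC addKr; apply: J_S.
apply: (JN (@d_B R n) (vanish0 x0) (@vanishB R n x0)); exact: J_rho.
Qed.
Lemma kerI_ub_psib : K (ub * psib - 1).
Proof. by rewrite ub_psib -(uc_psi R p M); exact: kerI_uc_psi. Qed.

Section Jet.
Variable (d : cinf -> cinf).
Hypothesis dB : forall F G, d (F - G) = d F - d G.
Hypothesis dJ : forall m F, Jt m.+1 F -> Jt m (d F).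
Hypothesis dM : forall F G, d (F * G) = d F * G + F * d G.
(** A field costs one order of vanishing. This is why [psi] is built to order [M0.+1], one more than
    the functional can see. *)
Lemma kerI_der_uc_psi : K (d (uc * psi)).
Proof.
have d1 : d 1 = 0 by have := der_one (der := fun _ : 'I_1 => d) (fun _ => dM) ord0.
rewrite uc_psi dB d1 sub0r; apply: J_kerI; apply: (JN (@d_B R n) (vanish0 x0) (@vanishB R n x0)).
apply: dJ; exact: J_rho.
Qed.
Lemma kerI_der_ub_psib : K (d (ub * psib)).
Proof. by rewrite ub_psib -(uc_psi R p M); exact: kerI_der_uc_psi. Qed.

Lemma kerI_gen a b : d a = b -> d uc = 0 -> K (d (a * psi) - b * psi).
Proof.
move=> da du.
have := @d_quotient _ K d (kerIB functionalB) (@kerIM _ _ Lam) dM _ _ kerI_uc_psi kerI_der_uc_psi a.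
by rewrite da du !mul0r subr0.
Qed.
Lemma kerI_genb a b : d a = b -> d ub = 0 -> K (d (a * psib) - b * psib).
Proof.
move=> da du.
have := @d_quotient _ K d (kerIB functionalB) (@kerIM _ _ Lam) dM _ _ kerI_ub_psib kerI_der_ub_psib a.
by rewrite da du !mul0r subr0.
Qed.
Lemma kerI_gen_quot a b : d a = 0 -> d uc = b -> K (d (a * psi) + b * psi * (a * psi)).
Proof.
move=> da du.
have := @d_quotient _ K d (kerIB functionalB) (@kerIM _ _ Lam) dM _ _ kerI_uc_psi kerI_der_uc_psi a.
by rewrite da du !mul0r sub0r opprK.
Qed.
Lemma kerI_genb_quot a b : d a = 0 -> d ub = b -> K (d (a * psib) + b * psib * (a * psib)).
Proof.
move=> da du.
have := @d_quotient _ K d (kerIB functionalB) (@kerIM _ _ Lam) dM _ _ kerI_ub_psib kerI_der_ub_psib a.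
by rewrite da du !mul0r sub0r opprK.
Qed.
End Jet.

Let JB' := JB (@d_B R n) (@vanishB R n x0).
Let fB b j := fieldB (rmx (mxof (@nil1_fun R p b j))).

Lemma dN_B j F G : dN j (F - G) = dN j F - dN j G.
Proof.
rewrite /dN !fB; move: (YN 1 j F) (YN 1 j G) (YN 'i%C j F) (YN 'i%C j G) => a b c d.
by move: (cst 2^-1) (cst 'i%C) => h t; ring.
Qed.
Lemma dbN_B j F G : dbN j (F - G) = dbN j F - dbN j G.
Proof.
rewrite /dbN !fB; move: (YN 1 j F) (YN 1 j G) (YN 'i%C j F) (YN 'i%C j G) => a b c d.
by move: (cst 2^-1) (cst 'i%C) => h t; ring.
Qed.
Lemma J_dN j m F : Jt m.+1 F -> Jt m (dN j F).
Proof.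
move=> hF; rewrite /dN; apply: JMl'; apply: JB'; last apply: JMl'; exact: J_field.
Qed.
Lemma J_dbN j m F : Jt m.+1 F -> Jt m (dbN j F).
Proof.
move=> hF; rewrite /dbN; apply: JMl'.
apply: (JD (@d_B R n) (vanish0 x0) (@vanishB R n x0)); last apply: JMl'; exact: J_field.
Qed.

(** This is the equation of the cone multiplied by [psi * psib], with [uc * psi] and [ub * psib]
    replaced by 1. *)
Lemma kerI_cone : K (Vg + Vbg - \sum_j Xg j * Xbg j).
Proof.
have -> : Vg + Vbg - \sum_j Xg j * Xbg j = psi * psib * cone_fun R p
   - vc * psi * (ub * psib - 1) - vb * psib * (uc * psi - 1).
  rewrite (eq_bigr (fun j => psi * psib * (wc j * wb j))); last first.
    by move=> j _; rewrite /Xg /Xbg; move: (wc j) (wb j) psi psib => *; ring.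
  rewrite -mulr_sumr /cone_fun /Vg /Vbg; move: uc ub vc vb psi psib (\sum_j _) => *; ring.
apply: (kerIB functionalB); last exact: kerIM kerI_uc_psi.
apply: (kerIB functionalB); last exact: kerIM kerI_ub_psib.
by apply: kerIM; apply: inN_kerI; exact: inN_cone.
Qed.

Hypothesis Lam_1p : Lam (Vg * Vbg ^+ p) = 0.

Lemma polys_vanish F : polys Lam Xg Xbg Vg Vbg F -> Lam F = 0.
Proof.
apply: (@polys_Lam _ _ Lam p functionalB Xg Xbg Vg Vbg (@dN R p) (@dbN R p) YD p_gt0) => //.
- exact: dNM.
- move=> j i; rewrite mulrA.
  exact: (kerI_gen (dN_B j) (@J_dN j) (@dNM R p j) (dN_wc R j i) (dN_uc R j)).
- move=> j i.
  exact: (kerI_genb_quot (dN_B j) (@J_dN j) (@dNM R p j) (dN_wb R j i) (dN_ub R j)).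
- move=> j; have := kerI_gen (dN_B j) (@J_dN j) (@dNM R p j) (dN_vc R j) (dN_uc R j).
  by rewrite mul0r subr0.
- move=> j.
  exact: (kerI_genb_quot (dN_B j) (@J_dN j) (@dNM R p j) (dN_vb R j) (dN_ub R j)).
- exact: dbNM.
- move=> j i; rewrite mulrA.
  exact: (kerI_genb (dbN_B j) (@J_dbN j) (@dbNM R p j) (dbN_wb R j i) (dbN_ub R j)).
- move=> j i.
  exact: (kerI_gen_quot (dbN_B j) (@J_dbN j) (@dbNM R p j) (dbN_wc R j i) (dbN_uc R j)).
- move=> j; have := kerI_genb (dbN_B j) (@J_dbN j) (@dbNM R p j) (dbN_vb R j) (dbN_ub R j).
  by rewrite mul0r subr0.
- move=> j.
  exact: (kerI_gen_quot (dbN_B j) (@J_dbN j) (@dbNM R p j) (dbN_vc R j) (dbN_uc R j)).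
- exact: fieldM.
- move=> i.
  exact: (kerI_gen (fieldB _) (@J_field _ _ _ _) (fieldM _) (dil_wc R i) (dil_uc R p)).
- move=> i.
  exact: (kerI_genb (fieldB _) (@J_field _ _ _ _) (fieldM _) (dil_wb R i) (dil_ub R p)).
- rewrite mulrA.
  exact: (kerI_gen (fieldB _) (@J_field _ _ _ _) (fieldM _) (dil_vc R p) (dil_uc R p)).
- rewrite mulrA.
  exact: (kerI_genb (fieldB _) (@J_field _ _ _ _) (fieldM _) (dil_vb R p) (dil_ub R p)).
- by move=> j s t a b; apply: Lam_dN; exact: cinv_mon.
- by move=> j s t a b; apply: Lam_dbN; exact: cinv_mon.
- by move=> s t a b; apply: Lam_dil; exact: cinv_mon.
- exact: kerI_cone.
Qed.
End FunctionalVanishing.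

(** * Normalized representatives and jets of degree zero functions *)

Section Normalization.
Variables (R : realType) (p M0 : nat).
Local Opaque der scst scoord sadd smul sopp mkS field zc zb uc ub vc vb wc wb.
Local Notation n := p.+1.
Local Notation I := 'I_(rdim n).
Local Notation C := R[i].
Local Notation Re := (@complex.Re R).
Local Notation Im := (@complex.Im R).
Local Notation cinf := (cinf R n).
Local Notation cst := (@scst R n).
Local Notation coord := (@scoord R n).
Local Notation inN := (@inN R n).
Local Notation pt := (pt R n).
Local Notation d_ := (@der R n).
Local Notation zbase := (@zbase R p).
Local Notation x0 := (realify zbase).
Local Notation uc := (@uc R p).
Local Notation ub := (@ub R p).
Local Notation vc := (@vc R p).
Local Notation vb := (@vb R p).
Local Notation wc := (@wc R p).
Local Notation wb := (@wb R p).
Implicit Types (F G : cinf) (z : pt).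
Local Notation M := M0.+1.
Local Notation Xg := (@Xg R p M).
Local Notation Xbg := (@Xbg R p M).
Local Notation Vg := (@Vg R p M).
Local Notation Vbg := (@Vbg R p M).
Local Notation psi := (@psi R p M).
Local Notation psib := (@psib R p M).
Local Notation Jt := (J d_ (vanish x0)).

(* den agrees with u to high order at the base point but has no zero, so z -> z / den z is globally defined and fixes the projectivization. *)
Definition tail : cinf := ((uc - 1) * (ub - 1)) ^+ M.
Definition den : cinf := uc + tail.
Definition denb : cinf := ub + tail.

Lemma tailE z : z != 0 -> tail (realify z) = (normsq (uc (realify z) - 1) ^+ M)%:C%C.
Proof.
move=> z0; have x0 : realify z != 0 by rewrite realify_eq0.
rewrite /tail sE_X // (sE_M (uc - 1)) (sE_D uc) (sE_D ub) !sE_N !sE_1 // (ub_conj z0).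
have -> : (uc (realify z))^*%C - 1 = (uc (realify z) - 1)^*%C by rewrite conjcB conjc1.
by rewrite mulJ_normsq -rmorphXn.
Qed.
Lemma denE z : z != 0 -> den (realify z) =
  uc (realify z) + (normsq (uc (realify z) - 1) ^+ M)%:C%C.
Proof. by move=> z0; rewrite /den (sE_D uc) tailE. Qed.
Lemma denb_conj z : z != 0 -> denb (realify z) = (den (realify z))^*%C.
Proof.
move=> z0; rewrite /denb (sE_D ub) (denE z0) tailE // (ub_conj z0) conjcD.
by rewrite conjc_real.
Qed.

(* If u + |u-1|^(2M) = 0 then u <= 0, so N = |u-1|^2 >= 1 and N = (1+N^M)^2 > N. *)
Lemma den_aux (a : C) : a + (normsq (a - 1) ^+ M)%:C%C != 0.
Proof.
apply/eqP; case: a => r s E; have := congr1 Im E; rewrite cImD /= addr0 => s0.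
have := congr1 Re E; rewrite cReD /= {E} s0 /normsq !(cReD, cImD, cReN, cImN) /= oppr0 addr0 expr0n /= addr0.
set N := (r - 1) ^+ 2 => E.
have N0 : 0 <= N ^+ M by rewrite exprn_ge0 // sqr_ge0.
have N1 : 1 <= N by rewrite /N; move: N0 E; set T := N ^+ M => T0 E; nra.
have NM : N <= N ^+ M by rewrite exprS ler_peMr ?(le_trans ler01) // exprn_ege1.
have EN : N = (1 + N ^+ M) ^+ 2 by rewrite {1}/N (_ : r = - N ^+ M); [ring | lra].
by move: EN NM N1; move: (N ^+ M) => T; nra.
Qed.

Lemma den_neq0 (x : 'rV[R]_(rdim n)) : x != 0 -> den x != 0.
Proof. rewrite -(cplxK x) realify_eq0 => z0; rewrite denE //; exact: den_aux. Qed.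
Lemma denb_neq0 (x : 'rV[R]_(rdim n)) : x != 0 -> denb x != 0.
Proof.
move=> hx; have z0 : cplx x != 0 by rewrite -realify_eq0 cplxK.
by rewrite -(cplxK x) denb_conj // conjc_eq0 cplxK den_neq0.
Qed.

Definition gh : cinf := sval (cid (sfun_inv den_neq0)).
Definition gb : cinf := sval (cid (sfun_inv denb_neq0)).
Lemma ghE : den * gh = 1. Proof. by rewrite /gh; case: cid. Qed.
Lemma gbE : denb * gb = 1. Proof. by rewrite /gb; case: cid. Qed.
Lemma gh_val x : x != 0 -> gh x = (den x)^-1.
Proof.
move=> hx; apply: (mulfI (den_neq0 hx)); rewrite mulfV ?den_neq0 //.
by rewrite -(sE_M den gh) ghE sE_1.
Qed.
Lemma gb_val x : x != 0 -> gb x = (denb x)^-1.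
Proof.
move=> hx; apply: (mulfI (denb_neq0 hx)); rewrite mulfV ?denb_neq0 //.
by rewrite -(sE_M denb gb) gbE sE_1.
Qed.
Lemma gh_neq0 x : x != 0 -> gh x != 0.
Proof. by move=> hx; rewrite gh_val // invr_eq0 den_neq0. Qed.
Lemma gb_conj z : z != 0 -> gb (realify z) = (gh (realify z))^*%C.
Proof.
move=> z0; have hx : realify z != 0 by rewrite realify_eq0.
by rewrite gb_val // gh_val // denb_conj // conjc_inv.
Qed.
Lemma gh_base : gh x0 = 1.
Proof.
rewrite gh_val ?realify_zbase_neq0 // denE ?zbase_neq0 // uc_base subrr.
by rewrite /normsq /= expr0n /= addr0 expr0n addr0 invr1.
Qed.

(** The real and imaginary parts of z_k / den, written through [zc R k * gh] and its conjugate,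
    because these are the functions that reduce to polynomials in the generators modulo jets. *)
Definition nrm (i : I) : cinf :=
  match fintype.split i with
  | inl k => cst 2^-1 * (zc R k * gh + zb R k * gb)
  | inr k => cst (- (2^-1 * 'i%C)) * (zc R k * gh - zb R k * gb)
  end.
Lemma nrm_l k : nrm (lshift _ k) = cst 2^-1 * (zc R k * gh + zb R k * gb).
Proof. by rewrite /nrm (unsplitK (inl k)). Qed.
Lemma nrm_r k : nrm (rshift _ k) = cst (- (2^-1 * 'i%C)) * (zc R k * gh - zb R k * gb).
Proof. by rewrite /nrm (unsplitK (inr k)). Qed.

Lemma half_Re (a : C) : 2^-1 * (a + a^*%C) = (Re a)%:C%C.
Proof.
by rewrite half_real; case: a => a b; apply: complexP;
  rewrite !(cReD, cReM, cImD, cImM) /=; field.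
Qed.
Lemma half_Im (a : C) : - (2^-1 * 'i%C) * (a - a^*%C) = (Im a)%:C%C.
Proof.
by rewrite half_real; case: a => a b; apply: complexP;
  rewrite !(cReD, cReM, cImD, cImM, cReN, cImN) /=; field.
Qed.

Lemma nrmE i z : z != 0 -> nrm i (realify z) = (realify (gh (realify z) *: z) 0 i)%:C%C.
Proof.
move=> z0; have hx : realify z != 0 by rewrite realify_eq0.
case: (split_ordP i) => k ->.
  rewrite nrm_l (sE_M (cst _)) (sE_D (_ * gh)) (sE_M (zc R k)) (sE_M (zb R k)).
  rewrite (sE_cst _ hx) (zcE k z0) (zbE k z0) (gb_conj z0) -conjcM half_Re realify_l mxE.
  by rewrite mulrC.
rewrite nrm_r (sE_M (cst _)) (sE_D (_ * gh)) (sE_N (_ * gb)) (sE_M (zc R k)) (sE_M (zb R k)).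
rewrite (sE_cst _ hx) (zcE k z0) (zbE k z0) (gb_conj z0) -conjcM half_Im realify_r mxE.
by rewrite mulrC.
Qed.

Lemma nrm_row z : z != 0 ->
  \row_k Re (nrm k (realify z)) = realify (gh (realify z) *: z).
Proof. by move=> z0; apply/rowP => k; rewrite mxE nrmE. Qed.

Lemma nrm_ok : comp_ok nrm.
Proof.
split=> [k x|x hx].
  have [->|hx] := eqVneq x 0; first by rewrite sfun_at0.
  by rewrite -(cplxK x) nrmE // -realify_eq0 cplxK.
have z0 : cplx x != 0 by rewrite -realify_eq0 cplxK.
by rewrite -(cplxK x) nrm_row // realify_eq0 scaler_eq0 negb_or z0 cplxK gh_neq0.
Qed.

Lemma scomp_nrm F z : z != 0 ->
  scomp nrm F (realify z) = F (realify (gh (realify z) *: z)).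
Proof.
by move=> z0; rewrite (sE_comp F nrm_ok) ?realify_eq0 // nrm_row.
Qed.

Lemma inN_nrm F : cinv F -> inN (F - scomp nrm F).
Proof.
move=> hF; apply/inNP => z hz; have z0 := hz.1.
rewrite (sE_D F) (sE_N (scomp nrm F)) scomp_nrm // hF ?subrr //.
by rewrite gh_neq0 // realify_eq0.
Qed.

Lemma vanish_nrm F : vanish x0 F -> vanish x0 (scomp nrm F).
Proof.
by move=> hF; rewrite /vanish scomp_nrm ?zbase_neq0 // gh_base scale1r.
Qed.

Let JMr' := JMr (@d_B R n) (@derM R n) (vanish0 x0) (@vanishB R n x0) (@vanishM R n x0).
Let JMl' := JMl (@d_B R n) (@derM R n) (vanish0 x0) (@vanishB R n x0) (@vanishM R n x0).
Let JN' := JN (@d_B R n) (vanish0 x0) (@vanishB R n x0).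
Let JB' := JB (@d_B R n) (@vanishB R n x0).

Lemma J_tail : Jt M tail.
Proof.
apply: (JX (@d_B R n) (@derM R n) (vanish0 _) (@vanishB R n x0) (@vanishM R n x0)).
rewrite /vanish (sE_M (uc - 1)) (sE_D uc) (sE_N 1) uc_base sE_1 ?realify_zbase_neq0 //.
by rewrite subrr mul0r.
Qed.

Lemma J_inv (a c : cinf) : (a + tail) * c = 1 -> Jt M (a * c - 1).
Proof.
move=> E; have -> : a * c - 1 = - (tail * c) by rewrite -E mulrDl opprD addrA subrr sub0r.
by apply: JN'; apply: JMr'; exact: J_tail.
Qed.

Lemma J_geo_tail (a c e : cinf) : Jt M (a * c - 1) -> Jt M (a * e - 1) -> Jt M (c - e).
Proof.
move=> hc he; have -> : c - e = e * (a * c - 1) - c * (a * e - 1) by ring.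
by apply: JB'; apply: JMl'.
Qed.

Lemma J_uc_psi : Jt M (uc * psi - 1).
Proof. by rewrite uc_psi addrC addKr; apply: JN'; exact: J_rho. Qed.
Lemma J_ub_psib : Jt M (ub * psib - 1).
Proof. by rewrite ub_psib addrC addKr; apply: JN'; exact: J_rho. Qed.

Lemma J_uc_gh : Jt M (uc * gh - 1). Proof. exact: J_inv ghE. Qed.
Lemma J_ub_gb : Jt M (ub * gb - 1). Proof. exact: J_inv gbE. Qed.
Lemma J_gh : Jt M (gh - psi). Proof. exact: J_geo_tail J_uc_gh J_uc_psi. Qed.
Lemma J_gb : Jt M (gb - psib). Proof. exact: J_geo_tail J_ub_gb J_ub_psib. Qed.

Section Polys.
Variables (Lam : cinf -> C) (S : seq (seq I * C)).
Hypothesis LamE : forall G, Lam G = \sum_(q <- S) q.2 * derw q.1 G x0.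
Hypothesis Ssize : forall q, q \in S -> (size q.1 < M0)%N.
Local Notation P := (polys Lam Xg Xbg Vg Vbg).
Let LamB := functionalB LamE.

Lemma J_P F G : Jt M (F - G) -> P G -> P F.
Proof. by move=> /J_S h; apply: (polys_kerI LamB); apply: (J_kerI LamE Ssize). Qed.
Lemma P_cst c : P (cst c).
Proof.
apply: (@polysK _ _ Lam p Xg Xbg Vg Vbg (fun F => exists a, F = cst a)); last by exists c.
by move=> _ F [a ->] h; rewrite (functional_cstM LamE) h mulr0.
Qed.
Lemma P_B F G : P F -> P G -> P (F - G). Proof. exact: (polysB LamB). Qed.
Lemma P_M F G : P F -> P G -> P (F * G). Proof. exact: polysM. Qed.
Lemma P_D F G : P F -> P G -> P (F + G).
Proof.
move=> hF hG; rewrite -[G]opprK; apply: P_B => //; rewrite -sub0r; apply: P_B => //.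
by rewrite -(rmorph0 cst); exact: P_cst.
Qed.
Lemma P_1 : P 1. Proof. by rewrite -(rmorph1 cst); exact: P_cst. Qed.

Lemma zc0_uv : zc R ord0 = uc + cst 2^-1 * vc.
Proof.
apply: cinf_realifyP => z z0; have hx : realify z != 0 by rewrite realify_eq0.
rewrite (zcE _ z0) (sE_D uc) (sE_M (cst _)) (sE_cst _ hx) (ucE z0) (vcE z0).
by move: (z 0 ord0) (z 0 (i1 p)) => a b; field.
Qed.
Lemma zc1_uv : zc R (i1 p) = uc - cst 2^-1 * vc.
Proof.
apply: cinf_realifyP => z z0; have hx : realify z != 0 by rewrite realify_eq0.
rewrite (zcE _ z0) (sE_D uc) (sE_N (cst _ * _)) (sE_M (cst _)) (sE_cst _ hx) (ucE z0) (vcE z0).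
by move: (z 0 ord0) (z 0 (i1 p)) => a b; field.
Qed.
Lemma zb0_uv : zb R ord0 = ub + cst 2^-1 * vb.
Proof.
apply: cinf_realifyP => z z0; have hx : realify z != 0 by rewrite realify_eq0.
rewrite (zbE _ z0) (sE_D ub) (sE_M (cst _)) (sE_cst _ hx) (ubE z0) (vbE z0).
by move: ((z 0 ord0)^*%C) ((z 0 (i1 p))^*%C) => a b; field.
Qed.
Lemma zb1_uv : zb R (i1 p) = ub - cst 2^-1 * vb.
Proof.
apply: cinf_realifyP => z z0; have hx : realify z != 0 by rewrite realify_eq0.
rewrite (zbE _ z0) (sE_D ub) (sE_N (cst _ * _)) (sE_M (cst _)) (sE_cst _ hx) (ubE z0) (vbE z0).
by move: ((z 0 ord0)^*%C) ((z 0 (i1 p))^*%C) => a b; field.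
Qed.

Lemma P_mul_gh F : P (F * psi) -> P (F * gh).
Proof.
by apply: J_P; rewrite -mulrBr; apply: JMl'; exact: J_gh.
Qed.
Lemma P_mul_gb F : P (F * psib) -> P (F * gb).
Proof.
by apply: J_P; rewrite -mulrBr; apply: JMl'; exact: J_gb.
Qed.

Lemma P_zc k : P (zc R k * gh).
Proof.
have Pu : P (uc * gh) by apply: J_P J_uc_gh P_1.
have Pv : P (cst 2^-1 * vc * gh).
  by rewrite -mulrA; apply: P_M; [exact: P_cst | apply: P_mul_gh; exact: polysV].
case: (unliftP ord0 k) => [k'|] ->; last by rewrite zc0_uv mulrDl; apply: P_D.
case: (unliftP ord0 k') => [j|] ->; first by apply: P_mul_gh; exact: polysX.
by rewrite zc1_uv mulrBl; apply: P_B.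
Qed.
Lemma P_zb k : P (zb R k * gb).
Proof.
have Pu : P (ub * gb) by apply: J_P J_ub_gb P_1.
have Pv : P (cst 2^-1 * vb * gb).
  by rewrite -mulrA; apply: P_M; [exact: P_cst | apply: P_mul_gb; exact: polysVb].
case: (unliftP ord0 k) => [k'|] ->; last by rewrite zb0_uv mulrDl; apply: P_D.
case: (unliftP ord0 k') => [j|] ->; first by apply: P_mul_gb; exact: polysXb.
by rewrite zb1_uv mulrBl; apply: P_B.
Qed.

Lemma P_nrm i : P (nrm i).
Proof.
case: (split_ordP i) => k ->.
  rewrite nrm_l; apply: P_M; first exact: P_cst.
  by apply: P_D; [exact: P_zc | exact: P_zb].
rewrite nrm_r; apply: P_M; first exact: P_cst.
by apply: P_B; [exact: P_zc | exact: P_zb].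
Qed.

(** [taylor] approximates [F] by polynomials in the linear coordinates; the property carried along
    is that substituting [nrm] gives a member of [polys], which holds for the coordinates by
    [P_nrm]. *)
Lemma nrm_jet F : exists2 Q, P (scomp nrm Q) & Jt M (F - Q).
Proof.
apply: (@taylor _ _ d_ (vanish x0) (@d_B R n) (@derM R n) (@derC R n) (vanish0 x0)
  (@vanishB R n x0) (@vanishM R n x0) (fun F => exists a, F = cst a)
  (fun Q => P (scomp nrm Q)) coord (@der_coord R n)).
- by move=> _ [a ->] j; exact: der_cst.
- move=> G; exists (cst (G x0)); first by exists (G x0).
  by rewrite /vanish (sE_D G) (sE_N (cst _)) sE_cst ?realify_zbase_neq0 // subrr.
- move=> m; exists (cst (m.+1%:R)^-1); first by exists (m.+1%:R)^-1.
  by rewrite -(rmorph_nat cst) -rmorphM mulVf ?rmorph1 // pnatr_eq0.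
- by move=> _ [a ->]; rewrite (scomp_cst nrm_ok); exact: P_cst.
- by move=> k; rewrite (scomp_coord nrm_ok); exact: P_nrm.
- by move=> G H hG hH; rewrite (scompB nrm_ok); exact: P_B.
- by move=> G H hG hH; rewrite (scompM nrm_ok); exact: P_M.
Qed.

(** A degree zero function agrees on the cone with its composition with [nrm]. As [nrm] fixes the
    base point, the composition preserves orders of vanishing, so [Lam] only sees the composed
    Taylor polynomial. *)
Lemma cinv_jet F : (forall F, inN F -> Lam F = 0) -> cinv F ->
  exists2 Q, P Q & Lam F = Lam Q.
Proof.
move=> LamN hF; have [Q PQ hQ] := nrm_jet F; exists (scomp nrm Q) => //.
have H : Jt M (scomp nrm (F - Q)).
  apply: (J_phi (@d_B R n) (@derM R n) (vanish0 x0) (@vanishB R n x0) (@vanishM R n x0)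
    (be := fun j k => d_ j (nrm k))) hQ.
    by move=> j G; exact: (der_comp nrm_ok).
  exact: vanish_nrm.
have /eqP := LamN _ (inN_nrm hF); rewrite LamB subr_eq0 => /eqP ->.
apply/eqP; rewrite -subr_eq0 -LamB -(scompB nrm_ok); apply/eqP.
by apply: kerI_Lam; apply: (J_kerI LamE Ssize); apply: J_S.
Qed.
End Polys.
End Normalization.

Section UniqueFunctional.
Variables (R : realType) (p M0 : nat).
Local Notation n := p.+1.
Local Notation I := 'I_(rdim n).
Local Notation C := R[i].
Local Notation cinf := (cinf R n).
Local Notation zbase := (@zbase R p).

(* Values at [zbase] of differential operators with the invariance of a CR operator of weight -n. *)
Definition cr_functional (S : seq (seq I * C)) (Lam : cinf -> C) :=
  [/\ forall G, Lam G = \sum_(q <- S) q.2 * derw q.1 G (realify zbase),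
      forall q, q \in S -> (size q.1 < M0)%N,
      forall F, inN F -> Lam F = 0 &
      forall (h : 'M[C]_n.+1) (c : R) F, 0 < c ->
        (forall z, Lform (act h z) = c * Lform z) -> act h zbase = zbase -> cinv F ->
        Lam (pull (rmx h) F) = (c ^+ n)%:C%C * Lam F].

Definition test_fun : cinf := Vg R p M0.+1 * Vbg R p M0.+1 ^+ p.

Lemma cr_functional_eq0 S Lam F : (0 < p)%N -> cr_functional S Lam ->
  Lam test_fun = 0 -> cinv F -> Lam F = 0.
Proof.
move=> p0 [LamE Ssize LamN LamH] L0 hF.
have [Q PQ ->] := cinv_jet LamE Ssize LamN hF.
exact: (polys_vanish p0 LamE Ssize LamN LamH L0 PQ).
Qed.

End UniqueFunctional.

(** * Uniqueness *)

Section HermitianForm.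
Variables (R : realType) (n : nat).
Local Notation C := R[i].
Local Notation Re := (@complex.Re R).
Local Notation pt := (pt R n).
Implicit Types (z x y : pt) (h : 'M[C]_n.+1).

Lemma realcM (a b : R) : (a * b)%:C%C = a%:C%C * b%:C%C :> C. Proof. exact: rmorphM. Qed.

Definition sig (k : 'I_n.+1) : R := if k == ord0 then 1 else -1.
Definition herm x y : C := \sum_k (sig k)%:C%C * (x 0 k * (y 0 k)^*%C).

Lemma Lform_sig z : Lform z = \sum_k sig k * normsq (z 0 k).
Proof.
rewrite /Lform [RHS](bigD1 ord0) //= /sig eqxx mul1r -sumrN; congr (_ + _).
by apply: eq_bigr => k /negbTE ->; rewrite mulN1r.
Qed.

Lemma normsq_comb (a b t : C) :
  normsq (a + t * b) = normsq a + 2 * Re (t^*%C * (a * b^*%C)) + normsq t * normsq b.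
Proof.
case: a b t => a0 a1 [b0 b1] [t0 t1]; rewrite /normsq.
by rewrite !(cReD, cReM, cImD, cImM) /=; ring.
Qed.

Lemma Lform_comb x y (t : C) :
  Lform (x + t *: y) = Lform x + 2 * Re (t^*%C * herm x y) + normsq t * Lform y.
Proof.
rewrite !Lform_sig /herm !mulr_sumr (big_morph Re (@cReD R) (erefl : Re 0 = 0)) mulr_sumr.
rewrite -!big_split; apply: eq_bigr => k _ /=.
rewrite !mxE normsq_comb [t^*%C * (_%:C%C * _)]mulrCA Re_scal.
by move: (Re _) (normsq _) (normsq _) (normsq _) (sig k) => *; ring.
Qed.

Lemma hermD x y z (a : C) : herm (a *: x + y) z = a * herm x z + herm y z.
Proof.
rewrite /herm mulr_sumr -big_split; apply: eq_bigr => k _ /=; rewrite !mxE; ring.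
Qed.

Lemma hermBr x y (a : C) : herm x (x - a *: y) = (Lform x)%:C%C - a^*%C * herm x y.
Proof.
rewrite /herm Lform_sig rmorph_sum mulr_sumr -sumrB; apply: eq_bigr => k _ /=.
rewrite !mxE conjcB conjcM realcM -mulJ_normsq.
by move: (x 0 k) (y 0 k) ((x 0 k)^*%C) ((y 0 k)^*%C) (sig k)%:C%C => *; ring.
Qed.

(** Polarization with [t = 1] and [t = 'i] separates [B i j] from [B j i]. *)
Lemma herm_form_eq0 (m : nat) (B : 'M[C]_m) :
  (forall x : 'rV[C]_m, (x *m B *m (map_mx (@conjc R) x)^T) 0 0 = 0) -> B = 0.
Proof.
move=> HB; apply/matrixP => i j; rewrite [RHS]mxE.
have form (a b : 'I_m) :
    (delta_mx (0 : 'I_1) a *m B *m (map_mx (@conjc R) (delta_mx (0 : 'I_1) b))^T) 0 0 = B a b.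
  have -> : map_mx (@conjc R) (delta_mx (0 : 'I_1) b) = delta_mx 0 b.
    by apply/matrixP => s t; rewrite !mxE; case: (_ && _); rewrite ?conjc0 ?conjc1.
  by rewrite trmx_delta -rowE -colE !mxE.
have cjD (u v : 'rV[C]_m) (t : C) : (map_mx (@conjc R) (u + t *: v))^T =
    (map_mx (@conjc R) u)^T + t^*%C *: (map_mx (@conjc R) v)^T.
  by apply/matrixP => s r; rewrite !mxE conjcD conjcM.
have D a : B a a = 0 by rewrite -form HB.
have addE (P Q : 'M[C]_1) : (P + Q) 0 0 = P 0 0 + Q 0 0 by rewrite mxE.
have sclE a (P : 'M[C]_1) : (a *: P) 0 0 = a * P 0 0 by rewrite mxE.
have pol (t : C) : t^*%C * B i j + t * B j i = 0.
  have := HB (delta_mx 0 i + t *: delta_mx 0 j).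
  rewrite cjD !mulmxDl !mulmxDr -!scalemxAl -!scalemxAr !(addE, sclE) !form !D.
  by rewrite !mulr0 addr0 add0r.
have e1 := pol 1; have e2 := pol 'i%C.
move: e1 e2; rewrite conjc1 conjci !mul1r mulNr => e1 e2.
have i0 : ('i%C : C) != 0 by apply/eqP => /eqP; rewrite eq_complex /= oner_eq0 andbF.
have e3 : B j i = B i j.
  by apply: (mulfI i0); apply/eqP; rewrite -subr_eq0 addrC; apply/eqP.
by move: e1; rewrite e3 -mulr2n => /eqP; rewrite mulrn_eq0 => /eqP.
Qed.

Lemma sig_sq k : sig k * sig k = 1.
Proof. by rewrite /sig; case: ifP; rewrite ?mulr1 // mulrNN mulr1. Qed.

(** By polarization [h] satisfies a matrix identity with the Hermitian form, whose determinant is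
    taken. The result allows a similitude to be rescaled into SU(1,n) by a scalar of the right
    modulus. *)
Lemma similitude_det h (c : R) : (forall z, Lform (act h z) = c * Lform z) ->
  normsq (\det h) = c ^+ n.+1.
Proof.
move=> H; pose E : 'M[C]_n.+1 := diag_mx (\row_k (sig k)%:C%C).
pose cj (m : nat) (A : 'M[C]_(m, n.+1)) := map_mx (@conjc R) A.
have LE z : (z *m E *m (cj _ z)^T) 0 0 = (Lform z)%:C%C.
  rewrite Lform_sig rmorph_sum mxE; apply: eq_bigr => k _ /=.
  by rewrite realcM -mulJ_normsq /E mul_mx_diag !mxE mulrA [z 0 k * _]mulrC.
have B0 : h^T *m E *m cj _ h - c%:C%C *: E = 0.
  apply: herm_form_eq0 => z; rewrite -/(cj 1%N z).
  rewrite mulmxBr mulmxBl -scalemxAr -scalemxAl mxE [X in _ + X]mxE [X in _ - X]mxE.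
  rewrite LE !mulmxA -(mulmxA _ (cj _ h)).
  have -> : cj _ h *m (cj _ z)^T = (cj _ (act h z))^T.
    by rewrite /cj /act map_mxM trmx_mul !map_trmx trmxK.
  by rewrite -/(act h z) LE H realcM subrr.
have E1 : \det E * \det E = 1.
  rewrite -det_mulmx (_ : E *m E = 1%:M) ?det1 // /E mulmx_diag.
  by apply/matrixP => i j; rewrite !mxE -realcM sig_sq.
have E0 : \det E != 0 by apply/eqP => e; move: E1 => /eqP; rewrite e mul0r eq_sym oner_eq0.
have := congr1 determinant (subr0_eq B0).
rewrite !det_mulmx det_tr detZ /cj det_map_mx mulrAC => /(mulIf E0).
rewrite mulJ_normsq => H1; apply: (@complexI R); rewrite H1.
by rewrite rmorphXn.
Qed.
End HermitianForm.

Section CROperators.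
Variables (R : realType) (n : nat).
Hypothesis n_gt0 : (0 < n)%N.
Local Opaque der scst scoord sadd smul sopp mkS.
Local Notation C := R[i].
Local Notation Re := (@complex.Re R).
Local Notation pt := (pt R n).
Local Notation cinf := (cinf R n).
Implicit Types (z x y : pt) (h : 'M[C]_n.+1) (f : pt -> R) (F G : cinf).

Lemma Ep_eq p f1 f2 : Ep p f1 -> (forall z, nullcone z -> f1 z = f2 z) -> Ep p f2.
Proof.
move=> [[F [sF hF]] H] e; split; first by exists F; split=> // z hz; rewrite -e // hF.
move=> z l hz l0; rewrite -!e //; first exact: H.
split; last by rewrite Lform_scale hz.2 mulr0.
by rewrite scaler_eq0 negb_or l0 hz.1.
Qed.

Lemma nullcone_scale z (l : C) : l != 0 -> nullcone z -> nullcone (l *: z).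
Proof.
move=> l0 [z0 Lz]; split; last by rewrite Lform_scale Lz mulr0.
by rewrite scaler_eq0 negb_or l0 z0.
Qed.

Lemma normsq_neq0_gt0 (l : C) : l != 0 -> 0 < normsq l.
Proof. by move=> l0; rewrite lt0r normsq_eq0 l0 normsq_ge0. Qed.

Lemma normsqX (l : C) m : normsq (l ^+ m) = normsq l ^+ m.
Proof.
by elim: m => [|m IH]; rewrite ?exprS ?normsqM ?IH // /normsq /= expr1n expr0n addr0.
Qed.

Section Operator.
Variable (D : operator R n).
Hypothesis crD : CR_invariant_op D.

(** The two functions have a common extension, and [diffop_on_E0] computes the operator from any
    extension. *)
Lemma CR_congr f1 f2 z : Ep 0 f1 -> (forall w, nullcone w -> f1 w = f2 w) ->
  nullcone z -> D f1 z = D f2 z.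
Proof.
move=> E1 e hz; have E2 := Ep_eq E1 e.
have [[S [a [_ HD]]] _ _ _] := crD; have [[F [sF hF]] _] := E1.
rewrite (HD f1 E1 F sF hF z hz) (HD f2 E2 F sF _ z hz) // => w hw.
by rewrite -e // hF.
Qed.

Lemma Ep_act h (c : R) f : 0 < c -> (forall z, Lform (act h z) = c * Lform z) ->
  Ep 0 f -> Ep 0 (fun w => f (act h w)).
Proof.
move=> c0 H [[F [sF hF]] hom]; have hN := nullcone_act (lt0r_neq0 c0) H.
have hI : isext f (ofR sF) by apply: isext_ofR.
have hA := isext_act (lt0r_neq0 c0) H hI; split.
  exists (fun x : 'rV[R]_(rdim n) => Re (pull (rmx h) (ofR sF) x)); split.
    exact: (proj1 (sfun_csmooth _)).
  by move=> z hz; rewrite hA.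
move=> z l hz l0; rewrite expr0z mul1r.
by have := hom _ _ (hN _ hz) l0; rewrite expr0z mul1r -/(act h z) /act -scalemxAl.
Qed.

(** A scalar multiple [l *: h] lies in SU(1,n). The scalar is invisible to a function of degree 0,
    and the value of degree -n turns it into the factor [c ^+ n]. *)
Lemma CR_act h (c : R) f z : 0 < c -> (forall z, Lform (act h z) = c * Lform z) ->
  Ep 0 f -> nullcone z ->
  D (fun w => f (act h w)) z = c ^+ n * D f (act h z).
Proof.
move=> c0 H fE hz; have [_ _ mapsD eqD] := crD.
have hN := nullcone_act (lt0r_neq0 c0) H.
have dh := similitude_det H.
have dh0 : \det h != 0 by rewrite -normsq_eq0 dh expf_neq0 // lt0r_neq0.
(* This choice makes the determinant of [l *: h] equal to 1; by [similitude_det] and uniqueness of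
   nonnegative roots it also gives [normsq l * c = 1]. *)
pose l : C := n.+1.-root (\det h)^-1.
have lE : l ^+ n.+1 = (\det h)^-1 by rewrite rootCK.
have l0 : l != 0.
  by apply: contra_neq dh0 => e; apply: invr_inj; rewrite -lE e expr0n invr0.
have nl : normsq l * c = 1.
  apply/eqP; rewrite -(@eqrXn2 _ n.+1) ?mulr_ge0 ?normsq_ge0 ?ltW // expr1n exprMn.
  by rewrite -dh -normsqX -normsqM lE mulVf // /normsq /= expr1n expr0n addr0.
pose g := l *: h.
have gA w : act g w = l *: act h w by rewrite /g /act linearZ /= scalemxAr.
have gS : inSU1n g.
  split; first by rewrite /g detZ lE mulVf.
  by move=> w; rewrite gA Lform_scale H mulrA nl mul1r.
have gI := inSU1n_inv gS.
have ug : g \in unitmx by rewrite unitmxE gS.1 unitr1.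
have := eqD _ gI _ fE z hz; rewrite invmxK => E.
have <- : D (fun w => f (act g w)) z = D (fun w => f (act h w)) z.
  have EA := Ep_act c0 H fE.
  rewrite -(CR_congr (f1 := fun w => f (act h w)) (f2 := fun w => f (act g w))) // => w hw.
  by rewrite gA fE.2 ?expr0z ?mul1r //; apply: hN.
rewrite E gA ((mapsD _ fE).2 _ _ (hN _ hz) l0); congr (_ * _).
have -> : c = (normsq l)^-1 by apply: (mulfI (lt0r_neq0 (normsq_neq0_gt0 l0))); rewrite nl mulfV // normsq_eq0.
by rewrite -exprnN exprVn.
Qed.
End Operator.

(** The map is the unitary reflection along [r]: the coefficient 1/N is -2 / L(r). *)
Lemma herm_reflection x r (N : R) : N != 0 -> Lform r = - (2 * N) ->
  Lform (x + (N^-1)%:C%C * herm x r *: r) = Lform x.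
Proof.
move=> N0 Lr; rewrite Lform_comb Lr conjcM conjc_real.
have -> : (N^-1)%:C%C * (herm x r)^*%C * herm x r = (N^-1 * normsq (herm x r))%:C%C.
  by rewrite -mulrA [_^*%C * _]mulrC mulJ_normsq realcM.
rewrite normsqM /=.
have -> : normsq ((N^-1)%:C%C) = N^-1 ^+ 2 by rewrite /normsq /= expr0n addr0.
by move: (normsq _) (Lform x) => a b; field.
Qed.
End CROperators.

Section Uniqueness.
Variables (R : realType) (p : nat).
Local Opaque der scst scoord sadd smul sopp mkS.
Local Notation n := p.+1.
Local Notation I := 'I_(rdim n).
Local Notation C := R[i].
Local Notation Re := (@complex.Re R).
Local Notation Im := (@complex.Im R).
Local Notation pt := (pt R n).
Local Notation cinf := (cinf R n).
Local Notation zbase := (@zbase R p).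
Local Notation x0 := (realify zbase).
Implicit Types (z : pt) (h : 'M[C]_n.+1) (f : pt -> R) (F G : cinf).

Lemma nullcone_base : nullcone zbase.
Proof.
split; first exact: zbase_neq0.
rewrite Lform_row3 !row3_0 row3_1 big1 ?addr0 ?subrr // => j _.
by rewrite row3_w /normsq /= expr0n addr0.
Qed.

Lemma nullcone_transitive z : nullcone z -> exists h (c : R),
  [/\ 0 < c, forall w, Lform (act h w) = c * Lform w & act h zbase = z].
Proof.
move=> hz; pose m := herm zbase z.
have [m0|m0] := eqVneq m 0; last first.
  pose N := normsq m; have N0 : N != 0 by rewrite normsq_eq0.
  (* The reflection along this vector takes [zbase] to [zbase - r = m *: z]; dividing by [m] reaches
     [z]. *)
  pose r := zbase - m *: z.
  have Lr : Lform r = - (2 * N).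
    rewrite /r -scaleNr Lform_comb nullcone_base.2 hz.2 mulr0 addr0 add0r -/m.
    by rewrite /N /normsq; case: (m) => a b; rewrite !(cReM, cReN, cImN) /=; ring.
  have hr : herm zbase r = - N%:C%C.
    by rewrite /r hermBr nullcone_base.2 -/m sub0r mulrC mulJ_normsq.
  pose s := fun x : pt => x + (N^-1)%:C%C * herm x r *: r.
  have sE x : act (mxof s) x = s x.
    apply: act_mxof => a u v; rewrite /s hermD; apply/rowP => k; rewrite !mxE; ring.
  exists (m^-1 *: mxof s), (normsq m^-1); split.
  - by rewrite normsq_neq0_gt0 // invr_eq0.
  - by move=> w; rewrite actZ sE Lform_scale /s herm_reflection.
  rewrite actZ sE /s hr mulrN -realcM mulVf // scaleN1r /r opprB addrC subrK.
  by rewrite scalerA mulVf // scale1r.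
(* Orthogonal null vectors are proportional in Lorentzian signature, so here [z] is a multiple of
   [zbase] and a scalar matrix suffices. *)
have e01 : z 0 (i1 p) = z 0 ord0.
  have := m0; rewrite /m /herm (big_row3 (fun k => (sig R k)%:C%C * _)) /=.
  rewrite big1 => [|j _]; last by rewrite row3_w mul0r mulr0.
  rewrite row3_0 row3_1 /sig eqxx !mul1r addr0 => /eqP.
  have -> : ((-1)%:C%C : C) = -1 by rewrite rmorphN1.
  rewrite mulN1r -conjcB conjc_eq0 subr_eq0 => /eqP ->; by [].
have Lz := hz.2; rewrite Lform_row3 e01 opprD addrA subrr sub0r in Lz.
have w0 j : z 0 (iw j) = 0.
  move/eqP: Lz; rewrite oppr_eq0 psumr_eq0 => [/allP W|i _]; last exact: normsq_ge0.
  by have := W j (mem_index_enum j); rewrite normsq_eq0 => /eqP.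
have zE : z = z 0 ord0 *: zbase.
  by apply: row3P => [||j]; rewrite [RHS]mxE row3E ?mulr1 ?mulr0 ?e01 ?w0.
have a0 : z 0 ord0 != 0.
  by apply/eqP => e; case: hz; rewrite {1}zE e scale0r eqxx.
exists (z 0 ord0)%:M, (normsq (z 0 ord0)); split.
- exact: normsq_neq0_gt0.
- by move=> w; rewrite act_scalar Lform_scale.
by rewrite act_scalar -zE.
Qed.

Section Functional.
Variable (D : operator R n).
Hypothesis crD : CR_invariant_op D.

Lemma CR_zero f z : Ep 0 f -> (forall w, nullcone w -> f w = 0) -> nullcone z -> D f z = 0.
Proof.
move=> fE f0 hz; have [_ linD _ _] := crD.
have := linD 0 0 f f fE fE z hz; rewrite !mul0r addr0 => <-.
by apply: (CR_congr crD fE _ hz) => w hw; rewrite f0 // !mul0r addr0.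
Qed.

Definition fRe F z := Re (F (realify z)).
Definition fIm F z := Im (F (realify z)).

Lemma Ep_Re F : cinv F -> Ep 0 (fRe F).
Proof.
move=> hF; split; first by exists (fun y => Re (F y)); split=> //; exact: (proj1 (sfun_csmooth F)).
by move=> z l hz l0; rewrite expr0z mul1r /fRe hF.
Qed.
Lemma Ep_Im F : cinv F -> Ep 0 (fIm F).
Proof.
move=> hF; split; first by exists (fun y => Im (F y)); split=> //; exact: (proj2 (sfun_csmooth F)).
by move=> z l hz l0; rewrite expr0z mul1r /fIm hF.
Qed.

Lemma inN_cinv F : inN F -> cinv F.
Proof.
by move=> /inNP hF z l hz l0; rewrite !hF //; exact: nullcone_scale.
Qed.

(** The operator is extended to complex functions through real and imaginary parts and evaluated at
    [zbase]. Every bound [M] beyond [M0] is allowed, so that two operators can be given a common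
    one, and with it the same test function. *)
Lemma functional_of_operator : exists (M0 : nat) (S : seq (seq I * C)) (Lam : cinf -> C),
  (forall M, (M0 <= M)%N -> cr_functional M S Lam) /\
  forall F, cinv F -> Lam F = (D (fRe F) zbase +i* D (fIm F) zbase)%C.
Proof.
have [[S [a [_ HD]]] _ _ _] := crD.
pose S' : seq (seq I * C) := [seq (s, (a s x0)%:C%C) | s <- S].
pose Lam (G : cinf) : C := \sum_(q <- S') q.2 * derw q.1 G x0.
have LE F : cinv F -> Lam F = (D (fRe F) zbase +i* D (fIm F) zbase)%C.
  move=> hF; rewrite /Lam big_map /=; apply: complexP => /=.
    rewrite (big_morph Re (@cReD R) (erefl : Re 0 = 0)).
    rewrite (HD _ (Ep_Re hF) (fun y => Re (F y)) (proj1 (sfun_csmooth F)) _ _ nullcone_base) //.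
    apply: eq_bigr => s _; rewrite Re_scal; congr (_ * _).
    exact (congr1 Re (derwE s F (realify_zbase_neq0 R p))).
  rewrite (big_morph Im (@cImD R) (erefl : Im 0 = 0)).
  rewrite (HD _ (Ep_Im hF) (fun y => Im (F y)) (proj2 (sfun_csmooth F)) _ _ nullcone_base) //.
  apply: eq_bigr => s _; rewrite cImM /= mul0r addr0; congr (_ * _).
  exact (congr1 Im (derwE s F (realify_zbase_neq0 R p))).
exists (\max_(q <- S') size q.1).+1, S', Lam; split=> // M hM; split=> //.
- move=> q qS; apply: leq_trans hM; rewrite ltnS.
  by apply: (@leq_bigmax_seq _ S' xpredT (fun q => size q.1) q).
- move=> F hF; have hc := inN_cinv hF; rewrite (LE _ hc).
  move/inNP: hF => hF.
  rewrite (CR_zero (Ep_Re hc) _ nullcone_base) ?(CR_zero (Ep_Im hc) _ nullcone_base) //.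
    by move=> w hw; rewrite /fIm hF.
  by move=> w hw; rewrite /fRe hF.
move=> h c F c0 H hb hF.
have uA := similitude_unit (similitude_act (lt0r_neq0 c0) H).
have hN := nullcone_act (lt0r_neq0 c0) H.
have pE z : nullcone z -> pull (rmx h) F (realify z) = F (realify (act h z)).
  by move=> hz; rewrite (pullE F uA ((nullconeP z).1 hz).1) -realify_act.
have hP : cinv (pull (rmx h) F).
  move=> z l hz l0; rewrite !pE //; last exact: nullcone_scale.
  by rewrite {1}/act -scalemxAl; apply: hF => //; exact: hN.
have key (E : cinf -> pt -> R) : (E = fRe \/ E = fIm) ->
    D (E (pull (rmx h) F)) zbase = c ^+ n * D (E F) zbase.
  move=> EE; have [E1 E2] : Ep 0 (E (pull (rmx h) F)) /\ Ep 0 (E F).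
    by case: EE => ->; split; [exact: Ep_Re|exact: Ep_Re|exact: Ep_Im|exact: Ep_Im].
  rewrite -[in RHS]hb -(CR_act crD c0 H E2 nullcone_base).
  apply: (CR_congr crD E1 _ nullcone_base) => w hw.
  by case: EE => ->; rewrite /fRe /fIm pE.
rewrite (LE _ hP) (LE _ hF) (key fRe) ?(key fIm); [|by right|by left].
by apply: complexP; rewrite !(cReM, cImM) /=; ring.
Qed.
End Functional.

Lemma Ep_isext_cinv f : Ep 0 f -> exists F, isext f F /\ cinv F.
Proof. by move=> fE; have [F hF] := Ep_ext fE; exists F; split=> //; exact: cinv_Ep hF fE. Qed.

(** Transitivity moves evaluation at [z] to evaluation at [zbase]. The function [g] and the factor
    [c] serve all invariant operators simultaneously, which permits comparing two of them. *)
Lemma CR_transport (D : operator R n) f z : CR_invariant_op D -> Ep 0 f -> nullcone z ->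
  exists (c : R) g, [/\ c != 0, Ep 0 g & forall D', CR_invariant_op D' ->
    D' g zbase = c * D' f z].
Proof.
move=> crD fE hz; have [h [c [c0 H hb]]] := nullcone_transitive hz.
exists (c ^+ n), (fun w => f (act h w)); split.
- by rewrite expf_neq0 // lt0r_neq0.
- exact: Ep_act c0 H fE.
by move=> D' crD'; rewrite (CR_act crD' c0 H fE nullcone_base) hb.
Qed.

Lemma CR_unique (D D' : operator R n) : (0 < p)%N ->
  CR_invariant_op D -> nonzero_op D -> CR_invariant_op D' ->
  exists c : R, forall f z, Ep 0 f -> nullcone z -> D' f z = c * D f z.
Proof.
move=> p0 crD [f0 [z0 [f0E [hz0 nz]]]] crD'.
have [M1 [S1 [L1 [cr1 E1]]]] := functional_of_operator crD.
have [M2 [S2 [L2 [cr2 E2]]]] := functional_of_operator crD'.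
pose M := maxn M1 M2.
have {}cr1 := cr1 M (leq_maxl _ _); have {}cr2 := cr2 M (leq_maxr _ _).
pose T := test_fun R p M.
have val (E : operator R n) (L : cinf -> C) f F : CR_invariant_op E ->
    (forall F, cinv F -> L F = (E (fRe F) zbase +i* E (fIm F) zbase)%C) ->
    Ep 0 f -> isext f F -> cinv F -> L F = (E f zbase)%:C%C.
  move=> crE HL fE hf hF; rewrite HL //; apply: complexP => /=.
    by apply/esym/(CR_congr crE fE _ nullcone_base) => w hw; rewrite /fRe hf.
  apply: (CR_zero crE (Ep_Im hF) _ nullcone_base) => w hw; by rewrite /fIm hf.
(* Otherwise the functional of [D] would vanish on all degree zero functions, and by transport [D]
   would be zero. *)
have LT : L1 T != 0.
  apply/eqP => LT; have [c [g [c0 gE Hg]]] := CR_transport crD f0E hz0.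
  have [F [hF cF]] := Ep_isext_cinv gE.
  have := val D L1 g F crD E1 gE hF cF; rewrite (cr_functional_eq0 p0 cr1 LT cF) (Hg D crD).
  by move/eqP; rewrite eq_sym realC_eq0 mulf_eq0 (negbTE c0) (negbTE nz).
pose k := L2 T / L1 T.
pose S := S2 ++ [seq (q.1, - k * q.2) | q <- S1].
pose L (F : cinf) : C := L2 F - k * L1 F.
have crL : cr_functional M S L.
  have [a1 b1 c1 d1] := cr1; have [a2 b2 c2 d2] := cr2; split.
  - move=> G; rewrite /L a1 a2 big_cat big_map /= -mulNr mulr_sumr; congr (_ + _).
    by apply: eq_bigr => q _; rewrite mulrA.
  - move=> q; rewrite mem_cat => /orP[/b2 //|/mapP[q' /b1 hq ->]]; exact: hq.
  - by move=> F hF; rewrite /L c1 // c2 // mulr0 subr0.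
  - by move=> h c F c0 H hb hF; rewrite /L (d1 h c) // (d2 h c) //; ring.
have LT0 : L T = 0 by rewrite /L /k mulfVK // subrr.
(* [k] is a quotient of complex numbers, but both operators take real values on real functions, so
   its real part is the constant sought. *)
exists (Re k) => f z fE hz.
have [c [g [c0 gE Hg]]] := CR_transport crD fE hz.
have [F [hF cF]] := Ep_isext_cinv gE.
have /eqP := cr_functional_eq0 p0 crL LT0 cF; rewrite /L subr_eq0 => /eqP.
rewrite (val D' L2 g F crD' E2 gE hF cF) (val D L1 g F crD E1 gE hF cF) => E.
have := congr1 Re E; rewrite mulrC Re_scal /= (Hg D crD) (Hg D' crD') => E'.
by apply: (mulfI c0); rewrite E'; ring.
Qed.
End Uniqueness.

(** * The operator does not vanish *)

Section LaplacianOfProduct.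
Variables (A : comNzRingType) (I : finType) (der : I -> A -> A) (ee : I -> A).
Hypothesis derB : forall i F G, der i (F - G) = der i F - der i G.
Hypothesis derM : forall i F G, der i (F * G) = der i F * G + F * der i G.

(** No coordinate occurs in both factors, so the mixed terms drop out and the Laplacian acts on [w]
    alone. *)
Lemma Lap_harmonicM (H w : A) (i0 j0 : I) : i0 != j0 ->
  (forall i, der i (der i H) = 0) -> (forall i, der i H * der i w = 0) ->
  (forall i, i != i0 -> i != j0 -> der i w = 0) ->
  Lap der ee (H * w) =
  H * (ee i0 * der i0 (der i0 w) + ee j0 * der j0 (der j0 w)).
Proof.
move=> ij HH Hw w0; have E i : der i (der i (H * w)) = H * der i (der i w).
  by rewrite derM (derD derB) !derM HH mul0r Hw !add0r.
rewrite /Lap (bigD1 i0) //= (bigD1 j0) 1?eq_sym //= big1 ?addr0; last first.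
  by move=> i /andP[i1 i2]; rewrite E (w0 i i1 i2) (der0 derB) !mulr0.
by rewrite !E mulrDr !(mulrCA H).
Qed.
End LaplacianOfProduct.

(* The model functions are H z^-k zb^-1, where a and b are inverses of z and zb modulo jets. *)
Section LocalModel.
Variables (A : comNzRingType) (J : nat -> A -> Prop) (D0 Db E Dv : A -> A).
Variables (z zb H a b : A) (pp M : nat).
Hypothesis JB : forall m F G, J m F -> J m G -> J m (F - G).
Hypothesis JMl : forall m F G, J m G -> J m (F * G).
Hypothesis J_S : forall m F, J m.+1 F -> J m F.
Hypothesis D0B : forall F G, D0 (F - G) = D0 F - D0 G.
Hypothesis D0M : forall F G, D0 (F * G) = D0 F * G + F * D0 G.
Hypothesis D0J : forall m F, J m.+1 F -> J m (D0 F).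
Hypothesis DbB : forall F G, Db (F - G) = Db F - Db G.
Hypothesis DbM : forall F G, Db (F * G) = Db F * G + F * Db G.
Hypothesis DbJ : forall m F, J m.+1 F -> J m (Db F).
Hypothesis EB : forall F G, E (F - G) = E F - E G.
Hypothesis EM : forall F G, E (F * G) = E F * G + F * E G.
Hypothesis EJ : forall m F, J m.+1 F -> J m (E F).
Hypothesis D0z : D0 z = 1.
Hypothesis D0b : D0 b = 0.
Hypothesis D0H : D0 H = 0.
Hypothesis Dbzb : Db zb = 1.
Hypothesis Dba : Db a = 0.
Hypothesis Ez : E z = z.
Hypothesis Ezb : E zb = zb.
Hypothesis EH : E H = 2%:R * H.
Hypothesis za : J M.+2 (z * a - 1).
Hypothesis zbb : J M.+2 (zb * b - 1).
Hypothesis DvE : forall k, Dv (H * (a ^+ k * b)) =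
  2%:R * D0 (E (H * (a ^+ k * b)) + pp%:R * (H * (a ^+ k * b)))
  - 2%:R * zb * (H * Db (D0 (a ^+ k * b))).

Let one d (dM : forall F G : A, d (F * G) = d F * G + F * d G) : d 1 = 0 :=
  der_one (der := fun _ : 'I_1 => d) (fun _ => dM) ord0.
Let natM d (dB : forall F G : A, d (F - G) = d F - d G)
    (dM : forall F G : A, d (F * G) = d F * G + F * d G) m F : d (m%:R * F) = m%:R * d F :=
  der_natM (der := fun _ : 'I_1 => d) (fun _ => dB) ord0 m F.
Let JN m F : J m F -> J m (- F).
Proof. by move=> h; rewrite -mulN1r; apply: JMl. Qed.
Let JD m F G : J m F -> J m G -> J m (F + G).
Proof. by move=> h1 h2; rewrite -[G]opprK; apply: JB => //; apply: JN. Qed.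

Lemma J_dinv (d : A -> A) (u c : A) :
  (forall F G, d (F - G) = d F - d G) -> (forall F G, d (F * G) = d F * G + F * d G) ->
  (forall m F, J m.+1 F -> J m (d F)) -> J M.+2 (u * c - 1) -> J M.+1 (d c + d u * (c * c)).
Proof.
move=> dB dM dJ h; have h1 : J M.+1 (d (u * c)).
  by have := dJ _ _ h; rewrite dB (one dM) subr0.
have := @d_quotient A (J M.+1) d (@JB M.+1) (@JMl M.+1) dM u c (J_S h) h1 1.
by rewrite mul1r (one dM) mul0r sub0r opprK -mulrA.
Qed.

Lemma D0a : J M.+1 (D0 a + a * a).
Proof. by have := J_dinv D0B D0M D0J za; rewrite D0z mul1r. Qed.
Lemma Dbb : J M.+1 (Db b + b * b).
Proof. by have := J_dinv DbB DbM DbJ zbb; rewrite Dbzb mul1r. Qed.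
Lemma J_einv (u c : A) : E u = u -> J M.+2 (u * c - 1) -> J M.+1 (E c + c).
Proof.
move=> Eu h; have h1 := J_dinv EB EM EJ h; rewrite Eu in h1.
have -> : E c + c = E c + u * (c * c) - c * (u * c - 1) by ring.
by apply: JB => //; apply: JMl; apply: J_S.
Qed.

Lemma D0a_pow k : J M.+1 (D0 (a ^+ k) + k%:R * a ^+ k.+1).
Proof.
elim: k => [|k IH].
  by rewrite expr0 (one D0M) mul0r addr0 -(subrr (D0 a + a * a)); apply: JB; exact: D0a.
have -> : D0 (a ^+ k.+1) + k.+1%:R * a ^+ k.+2 =
    a ^+ k * (D0 a + a * a) + a * (D0 (a ^+ k) + k%:R * a ^+ k.+1).
  by rewrite !exprS D0M mulrS; move: (D0 a) (D0 (a ^+ k)) (a ^+ k) => *; ring.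
by apply: JD; apply: JMl => //; exact: D0a.
Qed.

Lemma Ea_pow k : J M.+1 (E (a ^+ k) + k%:R * a ^+ k).
Proof.
have h1 := J_einv Ez za.
elim: k => [|k IH].
  by rewrite expr0 (one EM) mul0r addr0 -(subrr (E a + a)); apply: JB.
have -> : E (a ^+ k.+1) + k.+1%:R * a ^+ k.+1 =
    a ^+ k * (E a + a) + a * (E (a ^+ k) + k%:R * a ^+ k).
  by rewrite !exprS EM mulrS; move: (E a) (E (a ^+ k)) (a ^+ k) => *; ring.
by apply: JD; apply: JMl.
Qed.

Lemma Dba_pow k : Db (a ^+ k) = 0.
Proof. by elim: k => [|k IH]; rewrite ?expr0 ?(one DbM) // exprS DbM Dba IH mul0r mulr0 addr0. Qed.

(** The product has degree 1 - k, so the part with [TT] contributes 2 (pp + 1 - k)(-k) and the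
    Laplacian -2k, together 2k (k - pp - 2). Since [a] and [b] are inverses only modulo jets, the
    two derivatives cost two orders. *)
Lemma Dv_model k : J M (Dv (H * (a ^+ k * b)) -
  2%:R * k%:R * (k%:R - pp%:R - 2%:R) * (H * (a ^+ k.+1 * b))).
Proof.
set G := H * (a ^+ k * b); set G' := H * (a ^+ k.+1 * b).
have hE : J M.+1 (E G + pp%:R * G - (pp.+1%:R * G - k%:R * G)).
  have -> : E G + pp%:R * G - (pp.+1%:R * G - k%:R * G) =
      H * b * (E (a ^+ k) + k%:R * a ^+ k) + H * a ^+ k * (E b + b).
    rewrite /G !EM EH -[pp.+1%:R]natr1.
    by move: (E (a ^+ k)) (E b) (a ^+ k) (pp%:R : A) (k%:R : A) => *; ring.
  by apply: JD; apply: JMl; [exact: Ea_pow | exact: (J_einv Ezb zbb)].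
have hDE := D0J hE; rewrite !D0B !(natM D0B D0M) in hDE.
have hG : J M.+1 (D0 G + k%:R * G').
  have -> : D0 G + k%:R * G' = H * b * (D0 (a ^+ k) + k%:R * a ^+ k.+1).
    by rewrite /G /G' !D0M D0H D0b; move: (a ^+ k.+1) (a ^+ k) (D0 _) => *; ring.
  by apply: JMl; exact: D0a_pow.
have hDD : J M (Db (D0 (a ^+ k * b)) - k%:R * (a ^+ k.+1 * (b * b))).
  have h1 : J M.+1 (D0 (a ^+ k * b) - - (k%:R * (a ^+ k.+1 * b))).
    have -> : D0 (a ^+ k * b) - - (k%:R * (a ^+ k.+1 * b)) = b * (D0 (a ^+ k) + k%:R * a ^+ k.+1).
      by rewrite D0M D0b; move: (a ^+ k.+1) (a ^+ k) (D0 _) => *; ring.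
    by apply: JMl; exact: D0a_pow.
  have h2 := DbJ h1.
  have DbN F : Db (- F) = - Db F.
    by rewrite -sub0r DbB -[X in Db X - _](subrr 1) DbB subrr sub0r.
  rewrite DbB DbN (natM DbB DbM) DbM Dba_pow mul0r add0r in h2.
  have -> : Db (D0 (a ^+ k * b)) - k%:R * (a ^+ k.+1 * (b * b)) =
     Db (D0 (a ^+ k * b)) - - (k%:R * (a ^+ k.+1 * Db b)) - k%:R * a ^+ k.+1 * (Db b + b * b).
    by move: (a ^+ k.+1) (Db b) (Db (D0 _)) => *; ring.
  by apply: JB => //; apply: JMl; apply: J_S; exact: Dbb.
have -> : Dv G - 2%:R * k%:R * (k%:R - pp%:R - 2%:R) * G' =
    2%:R * (D0 (E G + pp%:R * G) - (pp.+1%:R * D0 G - k%:R * D0 G)) +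
    2%:R * (pp.+1%:R - k%:R) * (D0 G + k%:R * G')
    - 2%:R * zb * H * (Db (D0 (a ^+ k * b)) - k%:R * (a ^+ k.+1 * (b * b)))
    - 2%:R * k%:R * H * a ^+ k.+1 * b * (zb * b - 1).
  rewrite [Dv G]DvE -/G /G' -[pp.+1%:R]natr1.
  by move: (k%:R : A) (pp%:R : A) (D0 (E G + _)) (Db (D0 _)) (D0 G) (a ^+ k.+1) => *; ring.
apply: JB; last by apply: JMl; do 2!apply: J_S.
apply: JB; last exact: JMl.
by apply: JD; apply: JMl => //; exact: J_S.
Qed.
End LocalModel.

Section Nonzero.
Variables (R : realType) (q : nat).
Local Opaque der scst scoord sadd smul sopp mkS zc zb PC.
Local Notation p := q.+1.
Local Notation n := q.+2.
Local Notation I := 'I_(rdim n).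
Local Notation C := R[i].
Local Notation Re := (@complex.Re R).
Local Notation Im := (@complex.Im R).
Local Notation pt := (pt R n).
Local Notation cinf := (cinf R n).
Local Notation cst := (@scst R n).
Local Notation coord := (@scoord R n).
Local Notation inN := (@inN R n).
Local Notation d_ := (@der R n).
Local Notation EU := (Eu d_ coord).
Local Notation sg := (@sgn R n).
Implicit Types (z : pt) (F G : cinf).

Definition i2 : 'I_n.+1 := iw (ord0 : 'I_p).
Local Notation l k := (lshift n.+1 (k : 'I_n.+1)).
Local Notation r k := (rshift n.+1 (k : 'I_n.+1)).
Local Notation j1 := (i1 p).

(** A rational null vector with z_1 and z_2 both nonzero, so that [harm] does not vanish at it. *)
Definition pbase : pt := row3 1 (3 / 5)%:C%C (fun j => if j == ord0 then (4 / 5)%:C%C else 0).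
Lemma pbase_neq0 : pbase != 0.
Proof. apply/eqP => /rowP/(_ ord0); rewrite row3_0 mxE => /eqP; by rewrite oner_eq0. Qed.
Lemma nullcone_pbase : nullcone pbase.
Proof.
split; first exact: pbase_neq0.
rewrite Lform_row3 /pbase !row3_0 row3_1 (bigD1 ord0) //= row3_w eqxx big1 => [|j /negbTE j0].
  by rewrite /normsq /= expr1n expr0n /=; field.
by rewrite row3_w j0 /normsq /= expr0n addr0.
Qed.
Let x0 := realify pbase.
Let x0_neq0 : x0 != 0. Proof. by rewrite realify_eq0 pbase_neq0. Qed.
Local Notation Jt := (J d_ (vanish x0)).
(** Each of the [n] applications of the second order operator costs two orders of vanishing; one
    order is left for evaluation. *)
Local Notation M := (n + n).+1.
Let JMl' m := JMl (@d_B R n) (@derM R n) (vanish0 x0) (@vanishB R n x0) (@vanishM R n x0) (m := m).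
Let JB' m := JB (@d_B R n) (@vanishB R n x0) (m := m).
Let JS' m := @J_S _ _ d_ (vanish x0) m.

(** Re(z_1 conj z_2): quadratic, free of z_0, and without squares of real coordinates, hence
    harmonic term by term. *)
Definition harm : cinf := coord (l j1) * coord (l i2) + coord (r j1) * coord (r i2).
Local Notation z0 := (zc R (ord0 : 'I_n.+1)).
Local Notation zb0 := (zb R (ord0 : 'I_n.+1)).
Definition ainv : cinf := \sum_(i < M) (1 - z0) ^+ i.
Definition binv : cinf := \sum_(i < M) (1 - zb0) ^+ i.

Lemma geo_mul (t : cinf) : t * (\sum_(i < M) (1 - t) ^+ i) - 1 = - (1 - t) ^+ M.
Proof.
have := subrX1 (1 - t) M; move: (\sum_(i < M) _) ((1 - t) ^+ M) => s e E.
by rewrite -[e](subrK 1) E; ring.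
Qed.

Lemma J_geo (t : cinf) : t x0 = 1 -> Jt M (t * (\sum_(i < M) (1 - t) ^+ i) - 1).
Proof.
move=> t1; rewrite geo_mul; apply: (JN (@d_B R n) (vanish0 x0) (@vanishB R n x0)).
apply: (JX (@d_B R n) (@derM R n) (vanish0 _) (@vanishB R n x0) (@vanishM R n x0)).
by rewrite /vanish (sE_D 1) (sE_N t) sE_1 // t1 subrr.
Qed.

Lemma z0_base : z0 x0 = 1.
Proof. by rewrite /x0 (zcE _ pbase_neq0) row3_0. Qed.
Lemma zb0_base : zb0 x0 = 1.
Proof. by rewrite /x0 (zbE _ pbase_neq0) row3_0 conjc1. Qed.
Lemma geo_base (t : cinf) : t x0 = 1 -> (\sum_(i < M) (1 - t) ^+ i) x0 = 1.
Proof.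
move=> t1; rewrite sE_sum big_ord_recl expr0 sE_1 // big1 ?addr0 // => i _.
by rewrite exprS (sE_M (1 - t)) (sE_D 1) (sE_N t) sE_1 // t1 subrr mul0r.
Qed.
Lemma J_za : Jt M (z0 * ainv - 1). Proof. exact: J_geo z0_base. Qed.
Lemma J_zb : Jt M (zb0 * binv - 1). Proof. exact: J_geo zb0_base. Qed.

(** [D0] and [Db] are the Wirtinger derivatives with respect to z_0 and its conjugate. *)
Definition D0 F : cinf := cst 2^-1 * (d_ (l ord0) F - cst 'i%C * d_ (r ord0) F).
Definition Db F : cinf := cst 2^-1 * (d_ (l ord0) F + cst 'i%C * d_ (r ord0) F).

Lemma D0B F G : D0 (F - G) = D0 F - D0 G.
Proof. by rewrite /D0 !d_B; move: (d_ _ F) (d_ _ F) (d_ _ G) (d_ _ G) => *; ring. Qed.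
Lemma DbB F G : Db (F - G) = Db F - Db G.
Proof. by rewrite /Db !d_B; move: (d_ _ F) (d_ _ F) (d_ _ G) (d_ _ G) => *; ring. Qed.
Lemma D0M F G : D0 (F * G) = D0 F * G + F * D0 G.
Proof. by rewrite /D0 !derM; move: (d_ _ F) (d_ _ F) (d_ _ G) (d_ _ G) => *; ring. Qed.
Lemma DbM F G : Db (F * G) = Db F * G + F * Db G.
Proof. by rewrite /Db !derM; move: (d_ _ F) (d_ _ F) (d_ _ G) (d_ _ G) => *; ring. Qed.
Lemma D0J m F : Jt m.+1 F -> Jt m (D0 F).
Proof. by move=> [_ h]; apply: JMl'; apply: JB'; [exact: h | apply: JMl'; exact: h]. Qed.
Lemma DbJ m F : Jt m.+1 F -> Jt m (Db F).
Proof.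
move=> [_ h]; apply: JMl'; apply: (JD (@d_B R n) (vanish0 x0) (@vanishB R n x0)); first exact: h.
by apply: JMl'; exact: h.
Qed.
Lemma EUJ m F : Jt m.+1 F -> Jt m (EU F).
Proof.
move=> [_ h]; apply: (J_sum (@d_B R n) (vanish0 x0) (@vanishB R n x0)) => k.
by apply: JMl'; exact: h.
Qed.

Lemma d_zc i (k : 'I_n.+1) : d_ i (zc R k) = (i == l k)%:R + cst 'i%C * (i == r k)%:R.
Proof. by rewrite d_D der_cstM !der_coord. Qed.
Lemma d_zb i (k : 'I_n.+1) : d_ i (zb R k) = (i == l k)%:R - cst 'i%C * (i == r k)%:R.
Proof. by rewrite d_B der_cstM !der_coord. Qed.

Let EuD' := EuD coord (@d_B R n).
Let EuM' := EuM coord (@derM R n).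
Lemma EUB F G : EU (F - G) = EU F - EU G.
Proof. by rewrite /Eu -sumrB; apply: eq_bigr => i _; rewrite d_B mulrBr. Qed.
Lemma EU_coord k : EU (coord k) = coord k.
Proof.
rewrite /Eu -[RHS](sum_delta k (fun j => coord j)).
by apply: eq_bigr => i _; rewrite der_coord mulrC.
Qed.
Lemma EU_cst c : EU (cst c) = 0.
Proof. by rewrite /Eu big1 // => i _; rewrite der_cst mulr0. Qed.
Lemma zcD (k : 'I_n.+1) : zc R k = coord (l k) + cst 'i%C * coord (r k).
Proof. exact: erefl. Qed.
Lemma zbD (k : 'I_n.+1) : zb R k = coord (l k) - cst 'i%C * coord (r k).
Proof. exact: erefl. Qed.
Lemma EU_z0 : EU z0 = z0.
Proof. by rewrite zcD EuD' EuM' EU_cst mul0r add0r !EU_coord. Qed.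
Lemma EU_zb0 : EU zb0 = zb0.
Proof. by rewrite zbD EUB EuM' EU_cst mul0r add0r !EU_coord. Qed.
Lemma EU_harm : EU harm = 2%:R * harm.
Proof.
rewrite /harm EuD' !EuM' !EU_coord.
by move: (coord _) (coord _) (coord _) (coord _) => *; ring.
Qed.

Lemma geo_der (d : cinf -> cinf) (t : cinf) m :
  (forall F G, d (F - G) = d F - d G) -> (forall F G, d (F * G) = d F * G + F * d G) ->
  d t = 0 -> d (\sum_(i < m) (1 - t) ^+ i) = 0.
Proof.
move=> dB dM dt; have d1 : d 1 = 0 := der_one (der := fun _ : 'I_1 => d) (fun _ => dM) ord0.
have d0 : d 0 = 0 by rewrite -{1}(subrr 0) dB subrr.
have dD F G : d (F + G) = d F + d G.
  by rewrite -{1}[G]opprK dB -[- G]sub0r dB d0 sub0r opprK.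
rewrite (big_morph d dD d0) big1 // => i _; elim: (i : nat) => [|j IH]; first by rewrite expr0.
by rewrite exprS dM IH dB d1 dt subrr mul0r mulr0 addr0.
Qed.

Lemma lE (j k : 'I_n.+1) : (l j == l k) = (j == k). Proof. exact: eq_lshift. Qed.
Lemma rE (j k : 'I_n.+1) : (r j == r k) = (j == k). Proof. exact: eq_rshift. Qed.
Lemma lrE (j k : 'I_n.+1) : (l j == r k) = false. Proof. exact: eq_lrshift. Qed.
Lemma rlE (j k : 'I_n.+1) : (r j == l k) = false. Proof. exact: eq_rlshift. Qed.
Definition idxE := (lE, rE, lrE, rlE).

Lemma D0_z0 : D0 z0 = 1.
Proof.
rewrite /D0 !d_zc !idxE eqxx -[true%:R]/(1 : cinf) -[false%:R]/(0 : cinf) !(mulr0, addr0, add0r, mulr1).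
by rewrite -rmorphM sqri rmorphN opprK rmorph1 -(rmorph1 cst) -rmorphD -rmorphM half2.
Qed.
Lemma D0_zb0 : D0 zb0 = 0.
Proof.
rewrite /D0 !d_zb !idxE eqxx -[true%:R]/(1 : cinf) -[false%:R]/(0 : cinf) !(mulr0, subr0, sub0r, mulr1).
by rewrite mulrN -rmorphM sqri rmorphN opprK rmorph1 subrr mulr0.
Qed.
Lemma Db_zb0 : Db zb0 = 1.
Proof.
rewrite /Db !d_zb !idxE eqxx -[true%:R]/(1 : cinf) -[false%:R]/(0 : cinf) !(mulr0, subr0, sub0r, mulr1).
by rewrite mulrN -rmorphM sqri rmorphN opprK rmorph1 -(rmorph1 cst) -rmorphD -rmorphM half2.
Qed.
Lemma Db_z0 : Db z0 = 0.
Proof.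
rewrite /Db !d_zc !idxE eqxx -[true%:R]/(1 : cinf) -[false%:R]/(0 : cinf) !(mulr0, addr0, add0r, mulr1).
by rewrite -rmorphM sqri rmorphN rmorph1 subrr mulr0.
Qed.

Lemma d_harm i : d_ i harm =
  (i == l j1)%:R * coord (l i2) + coord (l j1) * (i == l i2)%:R +
  ((i == r j1)%:R * coord (r i2) + coord (r j1) * (i == r i2)%:R).
Proof. by rewrite /harm d_D !derM !der_coord. Qed.

Lemma d_harm0 : (d_ (l ord0) harm = 0) * (d_ (r ord0) harm = 0).
Proof. by rewrite !d_harm !idxE /= -[false%:R]/(0 : cinf) !(mul0r, mulr0, addr0). Qed.

Lemma dd_harm i : d_ i (d_ i harm) = 0.
Proof.
have e (j k : I) : j != k -> (i == j)%:R * (i == k)%:R = 0 :> cinf.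
  move=> jk; case: (eqVneq i j) => [->|_]; last by rewrite mul0r.
  by rewrite (negbTE jk) mulr0.
rewrite d_harm !d_D !derM !der_nat !der_coord !(mul0r, mulr0, add0r, addr0).
by rewrite !e ?addr0 // !idxE.
Qed.

Lemma harm_D0 : D0 harm = 0.
Proof. by rewrite /D0 !d_harm0 mulr0 subr0 mulr0. Qed.

(** The direction of d/dz_0; the associated linear form [ax] is half the conjugate of z_0. *)
Definition av (i : I) : C :=
  if i == l ord0 then 2^-1 else if i == r ord0 then - (2^-1 * 'i%C) else 0.
Local Notation DV := (Dv n.-1 d_ coord sg (fun i => cst (av i))).

Lemma sgn0 : (sg (l ord0) = 1) * (sg (r ord0) = 1).
Proof. by rewrite /sgn eps_l eps_r eqxx !rmorph1. Qed.

Lemma sum_av (f : I -> cinf) :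
  \sum_i cst (av i) * f i = cst 2^-1 * (f (l ord0) - cst 'i%C * f (r ord0)).
Proof.
rewrite (bigD1 (l ord0)) //= (bigD1 (r ord0)) ?idxE //= big1 ?addr0; last first.
  by move=> i /andP[/negbTE i1 /negbTE i2]; rewrite /av i1 i2 rmorph0 mul0r.
by rewrite /av !idxE eqxx rmorphN rmorphM mulrBr mulNr -mulrA.
Qed.

Lemma DV_E F : DV F = 2%:R * D0 (TT n.-1 d_ coord F) - cst 2^-1 * zb0 * Lap d_ sg F.
Proof.
rewrite /Dv sum_av /DD /xf !sgn0 !mul1r zbD /D0.
move: (TT _ _ _ F) (Lap _ _ F) => T L; move: (d_ _ T) (d_ _ T) => t1 t2.
by move: (coord _) (coord _) (cst 'i%C) (cst 2^-1) => *; ring.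
Qed.

Lemma ax_base : ax coord sg (fun i => cst (av i)) x0 = 2^-1.
Proof.
rewrite /ax sum_av /xf !sgn0 !mul1r -zbD (sE_M (cst _)) sE_cst // zb0_base.
by rewrite mulr1.
Qed.

Lemma cst_half4 : 4%:R * (cst 2^-1 * cst 2^-1) = 1.
Proof.
rewrite -rmorphM -(rmorph_nat cst) -rmorphM.
by rewrite (_ : 4 * (2^-1 * 2^-1) = 1 :> C) ?rmorph1 //; field.
Qed.
Lemma cst_half2 : 2%:R * cst 2^-1 = 1.
Proof. by rewrite -(rmorph_nat cst) -rmorphM mulfV ?rmorph1 // pnatr_eq0. Qed.

Lemma DbD0 w : 4%:R * Db (D0 w) =
  d_ (l ord0) (d_ (l ord0) w) + d_ (r ord0) (d_ (r ord0) w).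
Proof.
rewrite /Db /D0 !(der_cstM, d_B) (derC (r ord0) (l ord0)).
have ii : cst 'i%C * cst 'i%C = -1 by rewrite -rmorphM sqri rmorphN1.
move: (d_ (l ord0) (d_ (l ord0) w)) (d_ (l ord0) (d_ (r ord0) w)) (d_ (r ord0) (d_ (r ord0) w)) => ll lr rr.
transitivity (4%:R * (cst 2^-1 * cst 2^-1) * (ll - cst 'i%C * cst 'i%C * rr)).
  by move: (cst 2^-1) (cst 'i%C) => *; ring.
by rewrite cst_half4 ii mulN1r opprK mul1r.
Qed.

Lemma d_pow0 i (a : cinf) k : d_ i a = 0 -> d_ i (a ^+ k) = 0.
Proof. by case: k => [|k] h; rewrite ?expr0 ?der1 // derX h mulr0. Qed.

Lemma d_w0 i k : i != l ord0 -> i != r ord0 -> d_ i (ainv ^+ k * binv) = 0.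
Proof.
move=> /negbTE i1 /negbTE i2.
have ha : d_ i ainv = 0.
  apply: geo_der; [exact: d_B | exact: derM |].
  by rewrite d_zc i1 i2 mulr0 addr0.
have hb : d_ i binv = 0.
  apply: geo_der; [exact: d_B | exact: derM |].
  by rewrite d_zb i1 i2 mulr0 subr0.
by rewrite derM (d_pow0 _ ha) hb mul0r mulr0 addr0.
Qed.

Lemma Lap_z0 w : sg (l ord0) * d_ (l ord0) (d_ (l ord0) w) +
  sg (r ord0) * d_ (r ord0) (d_ (r ord0) w) = 4%:R * Db (D0 w).
Proof.
apply: etrans (esym (DbD0 w)).
move: (d_ (l ord0) (d_ (l ord0) w)) (d_ (r ord0) (d_ (r ord0) w)) => t1 t2.
exact (congr2 +%R (etrans (congr1 (fun t => t * t1) (fst sgn0)) (mul1r t1))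
  (etrans (congr1 (fun t => t * t2) (snd sgn0)) (mul1r t2))).
Qed.

Lemma Lap_model k : Lap d_ sg (harm * (ainv ^+ k * binv)) =
  harm * (4%:R * Db (D0 (ainv ^+ k * binv))).
Proof.
have lr : l ord0 != r ord0 by rewrite idxE.
have hw i : d_ i harm * d_ i (ainv ^+ k * binv) = 0.
  have [->|i1] := eqVneq i (l ord0); first by rewrite (fst d_harm0) mul0r.
  have [->|i2] := eqVneq i (r ord0); first by rewrite (snd d_harm0) mul0r.
  by rewrite (d_w0 k i1 i2) mulr0.
have w0 i : i != l ord0 -> i != r ord0 -> d_ i (ainv ^+ k * binv) = 0 by exact: d_w0.
have E := @Lap_harmonicM _ _ d_ sg (@d_B R n) (@derM R n) _ _ _ _ lr dd_harm hw w0.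
exact (etrans E (congr1 (fun t => harm * t) (Lap_z0 _))).
Qed.

Definition model k : cinf := harm * (ainv ^+ k * binv).
Definition mcoef (k : nat) : R := 2 * k%:R * (k%:R - q.+1%:R - 2).

Lemma DV_model k m : (m.+2 <= M)%N ->
  Jt m (DV (model k) - cst (mcoef k)%:C%C * model k.+1).
Proof.
move=> mM.
have -> : cst (mcoef k)%:C%C = 2%:R * k%:R * (k%:R - q.+1%:R - 2%:R).
  by rewrite /mcoef !rmorphM !rmorphB !rmorph_nat.
apply: (@Dv_model cinf (fun m => Jt m) D0 Db EU DV z0 zb0 harm ainv binv q.+1 m).
- by move=> *; apply: JB'.
- by move=> *; apply: JMl'.
- exact: JS'.
- exact: D0B.
- exact: D0M.
- exact: D0J.
- exact: DbB.
- exact: DbM.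
- exact: DbJ.
- exact: EUB.
- exact: EuM'.
- exact: EUJ.
- exact: D0_z0.
- by apply: geo_der; [exact: D0B | exact: D0M | exact: D0_zb0].
- exact: harm_D0.
- exact: Db_zb0.
- by apply: geo_der; [exact: DbB | exact: DbM | exact: Db_z0].
- exact: EU_z0.
- exact: EU_zb0.
- exact: EU_harm.
- exact: J_le mM J_za.
- exact: J_le mM J_zb.
move=> {}k; rewrite DV_E Lap_model; congr (_ - _).
rewrite -[4%:R]/((2 * 2)%:R : cinf) natrM.
move: (Db _) => w; transitivity (2%:R * cst 2^-1 * (2%:R * zb0 * (harm * w))).
  by move: (cst _) zb0 harm => *; ring.
by rewrite cst_half2 mul1r.
Qed.

Lemma DVB F G : DV (F - G) = DV F - DV G.
Proof. exact: (DvB n.-1 coord sg (@d_B R n) _ F G). Qed.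
Lemma DV_cstM c F : DV (cst c * F) = cst c * DV F.
Proof.
rewrite /Dv mulr_sumr; apply: eq_bigr => i _.
have hc j : d_ j (cst c) = 0 by exact: der_cst.
rewrite (DD_constM n.-1 coord sg (@derM R n) hc); exact: mulrCA.
Qed.

Lemma DV_J m F : Jt m.+2 F -> Jt m (DV F).
Proof.
move=> hF; rewrite DV_E; apply: JB'; apply: JMl'.
  apply: D0J; apply: (JD (@d_B R n) (vanish0 x0) (@vanishB R n x0)); first exact: EUJ.
  by apply: JMl'; exact: J_S.
apply: (J_sum (@d_B R n) (vanish0 x0) (@vanishB R n x0)) => i; apply: JMl'.
by have [_ /(_ i)[_ /(_ i)]] := hF.
Qed.

(** Since [q.+1 + 2] is n + 1, the coefficient is 2k (k - n - 1); its positive zero k = n + 1 lies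
    just beyond the n factors that are used. *)
Lemma mcoef_neq0 k : (0 < k)%N -> (k <= n)%N -> mcoef k != 0.
Proof.
move=> k0 kn; rewrite /mcoef !mulf_neq0 ?pnatr_eq0 -?lt0n //.
have : k%:R <= n%:R :> R by rewrite ler_nat.
by rewrite -[n%:R]natr1 => h; rewrite lt_eqF //; lra.
Qed.

Lemma iter_DV_model m : (m <= n)%N -> exists2 c : R, c != 0 &
  Jt (M - (m + m)) (iter m DV (model 1) - cst c%:C%C * model m.+1).
Proof.
elim: m => [|m IH] mn.
  exists 1; first exact: oner_neq0.
  rewrite -[iter 0 _ _]/(model 1) rmorph1 mul1r subrr.
  exact: (J_zero (@d_B R n) (vanish0 x0)).
have [c c0 hc] := IH (ltnW mn); exists (c * mcoef m.+1).
  by rewrite mulf_neq0 // mcoef_neq0.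
have e : (M - (m + m) = (M - (m.+1 + m.+1)).+2)%N by lia.
rewrite e in hc; have := DV_J hc; rewrite DVB DV_cstM => h1.
have h2 := @DV_model m.+1 (M - (m.+1 + m.+1)) ltac:(lia).
rewrite iterS; move: (DV (iter m _ _)) h1 => X h1.
have -> : X - cst (c * mcoef m.+1)%:C%C * model m.+2 =
   X - cst c%:C%C * DV (model m.+1) -
   - (cst c%:C%C * (DV (model m.+1) - cst (mcoef m.+1)%:C%C * model m.+2)).
  have -> : cst (c * mcoef m.+1)%:C%C = cst c%:C%C * cst (mcoef m.+1)%:C%C.
    by rewrite realcM; exact: rmorphM.
  by move: (DV (model m.+1)) (cst c%:C%C) (cst (mcoef m.+1)%:C%C) (model m.+2) => *; ring.
apply: JB' => //; apply: (JN (@d_B R n) (vanish0 x0) (@vanishB R n x0)).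
exact: JMl'.
Qed.

Lemma DV_inN F : inN F -> inN (DV F).
Proof.
move=> hF; apply: (N_sum (@inN0 R n) (@inNB R n)) => i; apply: inNM.
exact: inN_DC.
Qed.

Definition nsq : cinf := \sum_i coord i * coord i.

Lemma nsqE z : nsq (realify z) = (\sum_k normsq (z 0 k))%:C%C.
Proof.
rewrite /nsq sE_sum big_split_ord /= -big_split rmorph_sum; apply: eq_bigr => k _ /=.
rewrite !(sE_M (coord _)) !sE_coord realify_l realify_r -!realcM -rmorphD.
by congr (_ %:C%C).
Qed.

Lemma nsq_neq0 (x : 'rV[R]_(rdim n)) : x != 0 -> nsq x != 0.
Proof.
rewrite -(cplxK x) realify_eq0 => hz; rewrite nsqE realC_eq0.
apply: contra_neq hz => e; apply/rowP => k; rewrite [RHS]mxE; apply/eqP.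
move/eqP: e; rewrite psumr_eq0 => [/allP W|i _]; last exact: normsq_ge0.
by have := W k (mem_index_enum k); rewrite normsq_eq0.
Qed.

Definition ninv : cinf := sval (cid (sfun_inv nsq_neq0)).
Lemma ninvE : nsq * ninv = 1. Proof. by rewrite /ninv; case: cid. Qed.
Lemma ninv_val x : x != 0 -> ninv x = (nsq x)^-1.
Proof.
move=> hx; apply: (mulfI (nsq_neq0 hx)); rewrite mulfV ?nsq_neq0 //.
by rewrite -(sE_M nsq ninv) ninvE sE_1.
Qed.

(* On the cone nsq = 2 |z_0|^2, so testf equals harm / |z_0|^2 there. *)
Definition testf : cinf := 2%:R * (harm * ninv).

Lemma z0zb0 : z0 * zb0 = coord (l ord0) * coord (l ord0) + coord (r ord0) * coord (r ord0).
Proof.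
rewrite zcD zbD; have ii : cst 'i%C * cst 'i%C = -1 by rewrite -rmorphM sqri rmorphN1.
move: (coord (l ord0)) (coord (r ord0)) => a b.
transitivity (a * a - cst 'i%C * cst 'i%C * (b * b)); first by move: (cst _) => *; ring.
by rewrite ii mulN1r opprK.
Qed.

Lemma nsq_LL : nsq + LL coord sg = 2%:R * (z0 * zb0).
Proof.
rewrite z0zb0 /nsq /LL -big_split (bigD1 (l ord0)) //= (bigD1 (r ord0)) ?idxE //=.
rewrite big1 => [|i /andP[i1 i2]]; last first.
  have -> : xf coord sg i = - coord i.
    rewrite /xf /sgn (_ : eps R i = -1) ?rmorphN ?rmorphN1 ?mulN1r //.
    by rewrite /eps (negbTE i1) (negbTE i2).
  by rewrite mulNr subrr.
rewrite addr0 /xf (fst sgn0) (snd sgn0) !mul1r.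
by move: (coord _) (coord _) => *; ring.
Qed.

Lemma testf_model : exists2 B, Jt M B & inN (testf - model 1 - B).
Proof.
have JN' m := JN (@d_B R n) (vanish0 x0) (@vanishB R n x0) (m := m).
(* The errors of the approximate inverses [ainv] and [binv]; what then remains is an explicit
   multiple of [LL]. *)
exists (- (2%:R * harm * ninv * (zb0 * binv * (z0 * ainv - 1) + (zb0 * binv - 1)))).
  apply: JN'; apply: JMl'; apply: (JD (@d_B R n) (vanish0 x0) (@vanishB R n x0)).
    by apply: JMl'; exact: J_za.
  exact: J_zb.
have -> : testf - model 1 - (- (2%:R * harm * ninv * (zb0 * binv * (z0 * ainv - 1) + (zb0 * binv - 1))))
   = harm * ninv * (ainv * binv) * LL coord sg.
  have -> : LL coord sg = 2%:R * (z0 * zb0) - nsq by rewrite -nsq_LL addrC addKr.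
  rewrite /testf /model expr1; have := ninvE.
  move: nsq ninv harm ainv binv z0 zb0 => N v h a b s t E.
  transitivity (2%:R * h * v * (s * t * a * b) - N * v * (h * (a * b))); last by ring.
  by rewrite E; ring.
by apply: inNM; exact: inN_LL.
Qed.

Lemma iter_DV_inN m F : inN F -> inN (iter m DV F).
Proof. by move=> h; elim: m => //= m; exact: DV_inN. Qed.
Lemma iter_DVB m F G : iter m DV (F - G) = iter m DV F - iter m DV G.
Proof. by elim: m => //= m ->; exact: DVB. Qed.
Lemma iter_DV_J m k F : Jt (k + (m + m)) F -> Jt k (iter m DV F).
Proof.
elim: m k => [|m IH] k h; first by apply: J_le h; lia.
by rewrite iterS; apply: DV_J; apply: IH; apply: J_le h; lia.
Qed.

Lemma harm_val z : harm (realify z) =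
  (Re (z 0 j1) * Re (z 0 i2) + Im (z 0 j1) * Im (z 0 i2))%:C%C.
Proof.
rewrite /harm (sE_D (_ * _)) !(sE_M (coord _)) !sE_coord !realify_l !realify_r.
by rewrite -!realcM -rmorphD.
Qed.

Lemma iter_testf : exists2 c : R, c != 0 & iter n DV testf x0 = c%:C%C.
Proof.
(* At [pbase] the approximate inverses are 1 and [harm] is 3/5 times 4/5. *)
have [c c0 hc] := @iter_DV_model n (leqnn n); exists (c * (12 / 25)).
  by rewrite mulf_neq0 // mulf_neq0 ?invr_eq0 ?pnatr_eq0.
have [B hB hN] := testf_model.
have hx : iter n DV (testf - model 1 - B) x0 = 0.
  exact: ((inNP _).1 (iter_DV_inN n hN) pbase nullcone_pbase).
have e1 : iter n DV (testf - model 1 - B) =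
    iter n DV testf - iter n DV (model 1) - iter n DV B.
  exact (etrans (iter_DVB n _ B)
    (congr1 (fun t => t - iter n DV B) (iter_DVB n testf (model 1)))).
have B0 : iter n DV B x0 = 0.
  have h : Jt 1 (iter n DV B) by apply: iter_DV_J.
  exact (proj1 h).
have M0 : vanish x0 (iter n DV (model 1) - cst c%:C%C * model n.+1).
  have e : (M - (n + n) = 1)%N by lia.
  by rewrite e in hc; exact (proj1 hc).
move: (iter n DV testf) (iter n DV (model 1)) (iter n DV B) e1 B0 M0 => T Y Z e1 B0 M0.
rewrite e1 (sE_D (T - Y)) (sE_D T) (sE_N Z) (sE_N Y) B0 subr0 in hx.
move: M0; rewrite /vanish (sE_D Y) (sE_N (cst _ * _)) (sE_M (cst _)) sE_cst // => /eqP.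
rewrite subr_eq0 => /eqP M0; move/eqP: hx; rewrite subr_eq0 => /eqP ->; rewrite M0.
rewrite /model (sE_M harm) (sE_M (ainv ^+ _)) sE_X // (geo_base z0_base) (geo_base zb0_base).
rewrite expr1n !mulr1 harm_val row3_1 row3_w eqxx realcM; congr (_ * _%:C%C).
by rewrite /=; field.
Qed.

Lemma testf_val z : z != 0 -> testf (realify z) =
  (2 * (Re (z 0 j1) * Re (z 0 i2) + Im (z 0 j1) * Im (z 0 i2)) / \sum_k normsq (z 0 k))%:C%C.
Proof.
move=> hz; rewrite /testf (sE_M 2%:R) (sE_M harm) ninv_val ?realify_eq0 // nsqE harm_val.
have -> : (2%:R : cinf) (realify z) = (2%:C%C : C).
  by rewrite -(rmorph_nat cst) sE_cst ?realify_eq0 // rmorph_nat.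
by rewrite -mulrA 2!realcM -fmorphV.
Qed.

Lemma cinv_testf : cinv testf.
Proof.
move=> z c hz c0; have [z_neq0 _] := hz.
rewrite !testf_val ?(nullcone_scale c0 hz).1 //; congr (_ %:C%C).
have -> : \sum_k normsq ((c *: z) 0 k) = normsq c * \sum_k normsq (z 0 k).
  by rewrite mulr_sumr; apply: eq_bigr => k _; rewrite mxE normsqM.
have s0 : \sum_k normsq (z 0 k) != 0.
  by rewrite -realC_eq0 -nsqE nsq_neq0 // realify_eq0.
have c1 : normsq c != 0 by rewrite normsq_eq0.
have -> : Re ((c *: z) 0 j1) * Re ((c *: z) 0 i2) + Im ((c *: z) 0 j1) * Im ((c *: z) 0 i2) =
   normsq c * (Re (z 0 j1) * Re (z 0 i2) + Im (z 0 j1) * Im (z 0 i2)).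
  by rewrite !mxE /normsq !(cReM, cImM); ring.
by move: (Re _ * _ + _) (\sum_k _) s0 (normsq c) c1 => u s s0 m m0; field; rewrite s0.
Qed.

(** By [PC_Dv] the iterated Thomas operator on [testf] is at [pbase] the n-th power of 1/2 times the
    value of the operator, and [iter_testf] says that it is not zero. *)
Lemma Dop_nonzero : nonzero_op (@Dop R n).
Proof.
exists (fRe testf), pbase; split; first exact: Ep_Re cinv_testf.
split; first exact: nullcone_pbase.
have hI : isext (fRe testf) testf by move=> z [hz _]; rewrite /fRe testf_val.
have n0 := ltn0Sn p; rewrite (DopE n0 hI nullcone_pbase).
have [c c0 hc] := iter_testf.
have := (inNP _).1 (PC_Dv n0 av (cinv_Eu cinv_testf)) pbase nullcone_pbase.
have := ax_base; move: (ax _ _ _) => a ha.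
move: (iter _ _ testf) hc (@PC R n testf) => T hc P.
rewrite (sE_D T) (sE_N (_ * P)) (sE_M (a ^+ _)) sE_X // hc ha => /eqP.
rewrite subr_eq0 half_real -rmorphXn => /eqP e; apply/eqP => p0.
have := congr1 Re e; rewrite Re_scal /= p0 mulr0 => c1.
by rewrite c1 eqxx in c0.
Qed.
End Nonzero.

Theorem mainTheorem1 (R : realType) (n : nat) (hn : (2 <= n)%N) :
  exists D : operator R n,
    CR_invariant_op D /\ nonzero_op D /\
    forall D' : operator R n, CR_invariant_op D' ->
      exists c : R, forall f z, Ep 0 f -> nullcone z -> D' f z = c * D f z.
Proof.
case: n hn => [|[|q]] // _.
have crD := Dop_CR_invariant R (ltn0Sn q.+1).
have nzD := Dop_nonzero R q.
exists (@Dop R q.+2); split=> //; split=> // D' crD'.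
exact: CR_unique (ltn0Sn q) crD nzD crD'.
Qed.
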